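(* Let $\rho$ be a non-zero state (positive trace class operator) on $L^2(\mathbb{R}^n)$ and $\widehat\rho$ its Fourier transform, defined by $\widehat\rho(\widehat f)=\widehat{\rho(f)}$. Set $$S_x(\rho)=-\int_{\mathbb{R}^n}\ln\Bigl(\frac{d\nu_\rho}{dx}\Bigr)d\nu_\rho,\qquad S_\xi(\widehat\rho)=-\int_{\mathbb{R}^n}\ln\Bigl(\frac{d\nu_{\widehat\rho}}{d^*\xi}\Bigr)d\nu_{\widehat\rho}.$$ Then $$S_x(\rho)+S_\xi(\widehat\rho)\ge-\tau(\rho)\,(\ln\tau(\rho)+\ln\|\rho\|_\infty),$$ provided the positive part of one of the integrals $S_x(\rho)$, $S_\xi(\widehat\rho)$ is finite.
   Context: $L^2(\mathbb{R}^n)$ is the space of complex valued square integrable functions for Lebesgue measure $dx$, and $d^*\xi=(2\pi)^{-n}d\xi$. The Fourier transform is $\widehat f(\xi)=\int_{\mathbb{R}^n}e^{-i\langle x,\xi\rangle}f(x)\,dx$, a unitary map from $L^2(\mathbb{R}^n,dx)$ onto $L^2(\mathbb{R}^n,d^*\xi)$; $\widehat\rho$ is thus a positive trace class operator on $L^2(\mathbb{R}^n,d^*\xi)$. $\tau$ is the usual trace and $\|\rho\|_\infty$ the $L^2$–$L^2$ operator norm. For a positive trace class operator $P$ on an $L^2$ space, $\nu_P(\Omega)=\tau(\chi_\Omega P\chi_\Omega)$, where $\chi_\Omega$ is multiplication by the indicator of $\Omega$. Concretely, if $\rho=\sum_ip_i\Pi_{f_i}$ with $p_i\ge0$, $(f_i)$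 orthonormal and $\Pi_{f_i}$ the orthogonal projection on $f_i$, then $\frac{d\nu_\rho}{dx}(x)=\sum_ip_i|f_i(x)|^2$ and $\frac{d\nu_{\widehat\rho}}{d^*\xi}(\xi)=\sum_ip_i|\widehat{f_i}(\xi)|^2$. Convention $0\ln0=0$. The positive part of $S_x(\rho)$ is the integral of the positive part of $-\ln(\frac{d\nu_\rho}{dx})$ against $\nu_\rho$, and similarly for $S_\xi(\widehat\rho)$. The inequality is in the extended reals: if one of the two integrals has finite positive part then the other has finite negative part, and if one equals $-\infty$ the assertion is that the other equals $+\infty$. *)

(* Defs.v *)
From HB Require Import structures.
From mathcomp Require Import all_boot all_order all_algebra.
From mathcomp Require Import generic_quotient ring_quotient.
From mathcomp Require Import all_classical all_reals all_analysis.
From mathcomp Require Import measurable_realfun complex ring lra.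

Set Implicit Arguments.
Unset Strict Implicit.
Unset Printing Implicit Defensive.
Import Order.TTheory GRing.Theory Num.Theory.
Import numFieldNormedType.Exports.
Import Normc.

Local Open Scope classical_set_scope.
Local Open Scope ring_scope.

(* A chosen element satisfying P, or x0 if there is none; unlike [xget], X need
   not be a choiceType. *)
Definition chooseor (X : Type) (x0 : X) (P : X -> Prop) : X :=
  if pselect (exists x, P x) is left h then projT1 (cid h) else x0.

Section LebesgueStep.
Context (R : realType) (n : nat).
Variable m : {sigma_finite_measure set (n.-tuple R) -> \bar R}.

Definition cons_pair (p : measurableTypeR R * n.-tuple R) : n.+1.-tuple R :=
  [tuple of p.1 :: p.2].

Lemma measurable_cons_pair : measurable_fun [set: _] cons_pair.
Proof.
exact: (measurable_cons (T2 := R : measurableType _) measurable_fst measurable_snd).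
Qed.

Definition lebesgueS : set (n.+1.-tuple R) -> \bar R :=
  pushforward (@lebesgue_measure R \x m)%E cons_pair.

HB.instance Definition _ := Measure.copy lebesgueS
  (@measure_function_pushforward__canonical__measure_function_Measure
    _ _ _ _ _ (@lebesgue_measure R \x m)%E cons_pair measurable_cons_pair).

Lemma lebesgueSX (A : set R) (B : set (n.-tuple R)) :
  measurable A -> measurable B ->
  lebesgueS [set x | A (tnth x ord0) /\ B [tuple of behead x]] =
    (lebesgue_measure A * m B)%E.
Proof.
move=> mA mB; rewrite /lebesgueS /pushforward -(@product_measure1E _ _ (measurableTypeR R) (n.-tuple R) R (@lebesgue_measure R) m)//.
congr (product_measure1 _ _ _); apply/seteqP; split=> -[a b] /=.
  by rewrite (_ : [tuple of _] = b) //; apply/val_inj.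
by move=> [? ?]; rewrite (_ : [tuple of _] = b) //; apply/val_inj.
Qed.

Lemma lebesgueS_sigma_finite : sigma_finite setT lebesgueS.
Proof.
have /sigma_finiteP[F [FT ndF Foo]] := sigma_finiteT (@lebesgue_measure R).
have /sigma_finiteP[G [GT ndG Goo]] := sigma_finiteT m.
have mS k : measurable ([set x | F k (tnth x ord0) /\
    G k [tuple of behead x]] : set (n.+1.-tuple R)).
  apply: measurableI.
  - rewrite -[X in measurable X]setTI.
    by apply: (@measurable_tnth _ R n.+1 ord0) => //; case: (Foo k).
  - rewrite -[X in measurable X]setTI.
    by apply: (@measurable_behead _ R n) => //; case: (Goo k).
exists (fun k => [set x | F k (tnth x ord0) /\ G k [tuple of behead x]]).
  apply/esym/seteqP; split=> // x _.
  have [i _ Fi] : (\bigcup_k F k) (tnth x ord0) by rewrite -FT.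
  have [j _ Gj] : (\bigcup_k G k) [tuple of behead x] by rewrite -GT.
  exists (maxn i j) => //; split.
  - by move: Fi; exact/subsetPset/ndF/leq_maxl.
  - by move: Gj; exact/subsetPset/ndG/leq_maxr.
move=> k; split => //.
have [mF Fk] := Foo k; have [mG Gk] := Goo k.
by rewrite lebesgueSX// lte_mul_pinfty// ge0_fin_numE.
Qed.

HB.instance Definition _ := Measure_isSigmaFinite.Build _ _ _ lebesgueS
  lebesgueS_sigma_finite.

End LebesgueStep.

(* Lebesgue measure on R^n, on the Borel sigma-algebra of n.-tuple R;
   [lebesgue_box] characterizes it by its values on boxes. *)
Fixpoint lebesgue (R : realType) (n : nat) :
    {sigma_finite_measure set (n.-tuple R) -> \bar R} :=
  if n is k.+1 then lebesgueS (lebesgue R k) else \d_[tuple].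

Arguments lebesgue {R} n.

Lemma lebesgue_box (R : realType) (n : nat) (A : 'I_n -> set R) :
  (forall i, measurable (A i)) ->
  lebesgue n [set x | forall i, A i (tnth x i)] =
    (\prod_(i < n) lebesgue_measure (A i))%E.
Proof.
elim: n A => [|n IHn] A mA /=.
  rewrite big_ord0 diracE mem_set//= => -[]//.
rewrite big_ord_recl -IHn// -lebesgueSX//.
  congr (lebesgueS _ _); apply/seteqP; split=> x /= Ax.
    split=> // i; rewrite (_ : tnth _ i = tnth x (lift ord0 i))//.
    by rewrite [in RHS](tuple_eta x) tnthS.
  move=> i; have [->|i0] := eqVneq i ord0; first by case: Ax.
  have [j ->] : exists j, i = lift ord0 j.
    by case: (unliftP ord0 i) => [j ->|/eqP]; [exists j|rewrite (negbTE i0)].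
  by case: Ax => _ /(_ j); rewrite [in X in _ -> X](tuple_eta x) tnthS.
rewrite (_ : [set _ | _] = \bigcap_(i in setT) (tnth (T:=R) ^~ i @^-1` A (lift ord0 i))).
  apply: fin_bigcap_measurable => // i _; rewrite -[X in measurable X]setTI.
  exact: (@measurable_tnth _ R n i).
by apply/seteqP; split=> x /= Hx i => [_|]; [exact: Hx|exact: (Hx i I)].
Qed.

Section ComplexIntegral.
Context d (T : measurableType d) (R : realType).
Implicit Type f : T -> R[i].

Definition cmeasurable f : Prop :=
  measurable_fun [set: T] (fun x => complex.Re (f x)) /\
  measurable_fun [set: T] (fun x => complex.Im (f x)).

Variable mu : {measure set T -> \bar R}.

Definition cintegrable f : Prop :=
  mu.-integrable [set: T] (fun x => (complex.Re (f x))%:E) /\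
  mu.-integrable [set: T] (fun x => (complex.Im (f x))%:E).

Definition cintegral f : R[i] :=
  Complex (\int[mu]_x complex.Re (f x)) (\int[mu]_x complex.Im (f x)).

Definition sqintegrable f : Prop :=
  cmeasurable f /\ (\int[mu]_x (normc (f x) ^+ 2)%:E < +oo)%E.

Lemma normcX2E (z : R[i]) :
  normc z ^+ 2 = complex.Re z ^+ 2 + complex.Im z ^+ 2.
Proof. by case: z => a b /=; rewrite sqr_sqrtr// addr_ge0// sqr_ge0. Qed.

Lemma sqintegrable0 : sqintegrable (0 : T -> R[i]).
Proof.
split; first by split; exact: measurable_cst.
by rewrite integral0_eq// => x _; rewrite -[X in normc X]/(0 : R[i]) normc0 expr0n.
Qed.

Lemma cmeasurable_linear (a : R[i]) f g :
  cmeasurable f -> cmeasurable g -> cmeasurable (a *: f + g).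
Proof.
case: a => a b [mRf mIf] [mRg mIg]; split.
- rewrite (_ : (fun x => _) = fun x =>
    a * complex.Re (f x) - b * complex.Im (f x) + complex.Re (g x)); last first.
    apply/funext => x /=; rewrite -[(_ + _) x]/(Complex a b * f x + g x).
    by case: (f x) (g x) => ? ? [].
  apply: measurable_funD => //; apply: measurable_funB => //;
  exact: measurable_funM.
- rewrite (_ : (fun x => _) = fun x =>
    a * complex.Im (f x) + b * complex.Re (f x) + complex.Im (g x)); last first.
    apply/funext => x /=; rewrite -[(_ + _) x]/(Complex a b * f x + g x).
    by case: (f x) (g x) => ? ? [].
  apply: measurable_funD => //; apply: measurable_funD => //;
  exact: measurable_funM.
Qed.

Lemma measurable_normcX2 f : cmeasurable f ->
  measurable_fun [set: T] (fun x => (normc (f x) ^+ 2)%:E).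
Proof.
move=> [mR mI]; apply/measurable_EFinP; under eq_fun do rewrite normcX2E.
by apply: measurable_funD; exact: measurable_funX.
Qed.

Lemma sqintegrable_linear (a : R[i]) f g :
  sqintegrable f -> sqintegrable g -> sqintegrable (a *: f + g).
Proof.
move=> [mf if2] [mg ig2]; have mfg := cmeasurable_linear a mf mg.
split => //.
pose c := (2 * normc a ^+ 2)%R.
have c0 : 0 <= c by rewrite mulr_ge0 ?sqr_ge0.
have mf2 := measurable_normcX2 mf; have mg2 := measurable_normcX2 mg.
apply: (@le_lt_trans _ _ (\int[mu]_x (c%:E * (normc (f x) ^+ 2)%:E +
    2%:E * (normc (g x) ^+ 2)%:E))%E).
  apply: ge0_le_integral => //.
  - by move=> x _; rewrite lee_fin sqr_ge0.
  - exact: measurable_normcX2.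
  - by apply: emeasurable_funD; exact: measurable_funeM.
  - move=> x _; rewrite -!EFinM -EFinD lee_fin.
    rewrite -[(_ + _) x]/(a * f x + g x).
    have := le_normcD (a * f x) (g x); rewrite normcM => h.
    have n0 (z : R[i]) : 0 <= normc z by case: z => ? ?; exact: sqrtr_ge0.
    rewrite (le_trans (lerXn2r 2 _ _ h)) ?nnegrE ?addr_ge0 ?mulr_ge0//.
    rewrite /c -subr_ge0 (_ : _ - _ = (normc a * normc (f x) - normc (g x)) ^+ 2).
      exact: sqr_ge0.
    by ring.
rewrite ge0_integralD//=; last 4 first.
- by move=> x _; rewrite mule_ge0// lee_fin ?sqr_ge0.
- exact: measurable_funeM.
- by move=> x _; rewrite mule_ge0// lee_fin ?sqr_ge0.
- exact: measurable_funeM.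
rewrite !ge0_integralZl_EFin//; first last.
- by move=> x _; rewrite lee_fin sqr_ge0.
- by move=> x _; rewrite lee_fin sqr_ge0.
by rewrite lte_add_pinfty// lte_mul_pinfty// lee_fin.
Qed.

Definition L2pred : {pred T -> R[i]} := fun f => `[< sqintegrable f >].

Lemma L2pred_submod_closed : GRing.submod_closed L2pred.
Proof.
split; first by apply/asboolP; exact: sqintegrable0.
move=> a f g /asboolP fL2 /asboolP gL2; apply/asboolP.
exact: sqintegrable_linear.
Qed.

HB.instance Definition _ :=
  GRing.isSubmodClosed.Build R[i] (T -> R[i]) L2pred L2pred_submod_closed.

Record L2fun := MkL2fun { L2val :> T -> R[i]; L2valP : L2val \in L2pred }.

HB.instance Definition _ := [isSub for L2val].
HB.instance Definition _ := [Choice of L2fun by <:].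
HB.instance Definition _ := [SubChoice_isSubLmodule of L2fun by <:].

Definition L2null : {pred L2fun} :=
  fun u => `[< {ae mu, forall x, L2val u x = 0} >].

Lemma L2null_submod_closed : GRing.submod_closed L2null.
Proof.
split; first by apply/asboolP; apply: aeW => x.
move=> a f g /asboolP f0 /asboolP g0; apply/asboolP.
move: f0 g0; apply: filterS2 => x fx gx.
by rewrite /= -[(_ + _) x]/(a * L2val f x + L2val g x) fx gx mulr0 addr0.
Qed.

HB.instance Definition _ :=
  GRing.isSubmodClosed.Build R[i] L2fun L2null L2null_submod_closed.

(* Square-integrable complex functions modulo equality almost everywhere. *)
Definition L2 : Type := Quotient.quot L2null.

HB.instance Definition _ := GRing.Zmodule.on L2.
HB.instance Definition _ := EqQuotient.on L2.

End ComplexIntegral.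

Section L2Module.
Context d (T : measurableType d) (R : realType).
Variable mu : {measure set T -> \bar R}.
Local Open Scope quotient_scope.
Implicit Types (a : R[i]) (u v : L2 mu).

Definition L2scale a : L2 mu -> L2 mu := lift_op1 (L2 mu) ( *:%R a).

Lemma pi_L2scale a : {morph \pi_(L2 mu) : f / a *: f >-> L2scale a f}.
Proof.
move=> f; unlock L2scale; apply/eqP; rewrite -Quotient.idealrBE -scalerBr.
by apply: rpredZ; rewrite Quotient.idealrBE reprK.
Qed.

Lemma L2scaleA a b u : L2scale a (L2scale b u) = L2scale (a * b) u.
Proof. by rewrite -[u]reprK -!pi_L2scale scalerA. Qed.

Lemma L2scale1 : left_id 1 L2scale.
Proof. by move=> u; rewrite -[u]reprK -pi_L2scale scale1r. Qed.

Lemma L2scaleDr : right_distributive L2scale +%R.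
Proof.
move=> a u v; rewrite -[u]reprK -[v]reprK -!pi_L2scale.
have piD (x y : L2fun mu) : \pi_(L2 mu) (x + y) = \pi x + \pi y.
  exact: Quotient.pi_add.
by rewrite -piD -!pi_L2scale -piD scalerDr.
Qed.

Lemma L2scaleDl u : {morph L2scale^~ u : a b / a + b}.
Proof.
move=> a b; rewrite -[u]reprK -!pi_L2scale scalerDl.
exact: Quotient.pi_add.
Qed.

HB.instance Definition _ := GRing.Zmodule_isLmodule.Build R[i] (L2 mu)
  L2scaleA L2scale1 L2scaleDr L2scaleDl.

(* The class of f; 0 (junk) when f is not square integrable. *)
Definition L2class (f : T -> R[i]) : L2 mu :=
  \pi_(L2 mu) (insubd (0 : L2fun mu) f).

Lemma L2class_eq (f g : T -> R[i]) : sqintegrable mu f -> sqintegrable mu g ->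
  L2class f = L2class g <-> {ae mu, forall x, f x = g x}.
Proof.
move=> fL2 gL2.
have insubE h : sqintegrable mu h -> L2val (insubd (0 : L2fun mu) h) = h.
  by move=> hL2; rewrite [LHS]insubdK//; exact/asboolP.
rewrite /L2class; split=> [/eqP|fg].
  rewrite -Quotient.idealrBE => /asboolP; apply: filterS => x.
  rewrite -[L2val _ x]/(L2val (insubd 0 f) x - L2val (insubd 0 g) x).
  by rewrite !insubE// => /eqP; rewrite subr_eq0 => /eqP.
apply/eqP; rewrite -Quotient.idealrBE; apply/asboolP; move: fg.
apply: filterS => x fg.
rewrite -[L2val _ x]/(L2val (insubd 0 f) x - L2val (insubd 0 g) x).
by rewrite !insubE// fg subrr.
Qed.

(* Linear in the first argument. *)
Definition dotL2 u v : R[i] :=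
  cintegral mu (fun x => repr u x * conjc (repr v x)).

Definition normL2 u : R := Num.sqrt (\int[mu]_x (normc (repr u x) ^+ 2)).

End L2Module.

Section Operators.
Context d (T : measurableType d) (R : realType).
Variable mu : {measure set T -> \bar R}.
Implicit Types (P : L2 mu -> L2 mu) (B : set (L2 mu)).

Definition bounded_op P : Prop :=
  exists M : R, forall u, normL2 (P u) <= M * normL2 u.

Definition opnorm P : R :=
  sup [set normL2 (P u) | u in [set u | normL2 u <= 1]].

(* The order of R[i] only compares numbers with equal imaginary parts, so this
   says that <Pu, u> is real and nonnegative. *)
Definition positive_op P : Prop := forall u, 0 <= dotL2 (P u) u.

Definition orthonormal_basis B : Prop :=
  (forall e e', B e -> B e' -> dotL2 e e' = (e == e')%:R) /\
  (forall u, (forall e, B e -> dotL2 u e = 0) -> u = 0).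

(* A fixed orthonormal basis; the trace of a positive operator does not depend
   on it. *)
Definition onb : set (L2 mu) := xget set0 [set B | orthonormal_basis B].

(* [esum] is a sum of nonnegative terms, so this is the trace for positive P
   only. *)
Definition optrace P : \bar R :=
  (\esum_(e in onb) (complex.Re (dotL2 (P e) e))%:E)%E.

(* A positive operator is trace class iff its trace is finite. *)
Definition is_state (rho : {linear L2 mu -> L2 mu}) : Prop :=
  [/\ bounded_op rho, positive_op rho & (optrace rho < +oo)%E].

(* Meaningful for measurable Omega only. *)
Definition chi (Omega : set T) (u : L2 mu) : L2 mu :=
  L2class mu (fun x => (\1_Omega x)%:C%C * repr u x).

(* nu_P(Omega) = tr (chi_Omega P chi_Omega), a finite measure on the measurable
   sets when P is a state. *)
Definition nu_op P (Omega : set T) : \bar R :=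
  optrace (chi Omega \o P \o chi Omega).

End Operators.

Section Entropy.
Context d (T : measurableType d) (R : realType).
Variable mu : {sigma_finite_measure set T -> \bar R}.
Implicit Type P : L2 mu -> L2 mu.
Local Open Scope charge_scope.

(* Bundles nu, restricted to the measurable sets, as a charge, which is what the
   library's Radon-Nikodym derivative takes. *)
Definition charge_of_setfun (nu : set T -> \bar R) :
    {charge set T -> \bar R} :=
  chooseor (czero : {charge set T -> \bar R})
    (fun c => forall A, measurable A -> c A = nu A).

Definition density P : T -> \bar R := 'd (charge_of_setfun (nu_op P)) '/d mu.

(* - int ln (d nu_P / d mu) d nu_P. Here [lne 0] is -oo, but the density vanishes
   only on a nu_P-null set, which gives the convention 0 ln 0 = 0. *)
Definition entropy P : \bar R := (- \int[nu_op P]_x lne (density P x))%E.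

(* The integrals against nu_P of the positive and negative parts of
   - ln (d nu_P / d mu). *)
Definition entropy_pos P : \bar R :=
  (\int[nu_op P]_x ((fun y => - lne (density P y)) ^\+ x))%E.

Definition entropy_neg P : \bar R :=
  (\int[nu_op P]_x ((fun y => - lne (density P y)) ^\- x))%E.

End Entropy.

Section Fourier.
Context (R : realType) (n : nat).

Lemma expr_twopiV_ge0 : 0 <= (2 * pi : R) ^- n.
Proof. by rewrite invr_ge0 exprn_ge0// mulr_ge0// pi_ge0. Qed.

(* d^*xi = (2 pi)^-n d xi *)
Definition dual_lebesgue : set (n.-tuple R) -> \bar R :=
  mscale (NngNum expr_twopiV_ge0) (lebesgue n).

HB.instance Definition _ := Measure.on dual_lebesgue.

Lemma dual_lebesgue_sigma_finite : sigma_finite setT dual_lebesgue.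
Proof.
have [F FT Foo] := sigma_finiteT (@lebesgue R n).
exists F => // k; have [mF Fk] := Foo k; split => //.
by rewrite /dual_lebesgue /mscale /= lte_mul_pinfty// lee_fin expr_twopiV_ge0.
Qed.

HB.instance Definition _ := Measure_isSigmaFinite.Build _ _ _ dual_lebesgue
  dual_lebesgue_sigma_finite.

Local Notation L2x := (L2 (@lebesgue R n)).
Local Notation L2xi := (L2 dual_lebesgue).

Definition dotRn (x xi : n.-tuple R) : R := \sum_(i < n) tnth x i * tnth xi i.

(* The integral of e^(-i <x, xi>) f(x) dx. *)
Definition fourier_integral (f : n.-tuple R -> R[i]) (xi : n.-tuple R) : R[i] :=
  cintegral (lebesgue n)
    (fun x => Complex (cos (dotRn x xi)) (- sin (dotRn x xi)) * f x).

(* Plancherel: the unitary map that extends the Fourier integral from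
   L^1 /\ L^2; it is unique by density. *)
Definition is_fourier (F : {linear L2x -> L2xi}) : Prop :=
  [/\ forall f, sqintegrable (lebesgue n) f -> cintegrable (lebesgue n) f ->
        F (L2class _ f) = L2class _ (fourier_integral f),
      forall u v, dotL2 (F u) (F v) = dotL2 u v &
      forall w, exists u, F u = w].

Definition fourier : {linear L2x -> L2xi} :=
  chooseor (\0 : {linear L2x -> L2xi}) is_fourier.

End Fourier.

Arguments dual_lebesgue {R} n.
Arguments fourier {R n}.

(* Main.v *)
(** Write [rho = sum_k |g_k><g_k|], so that the two densities are
    [sum_k |g_k|^2] and [sum_k |F g_k|^2].  Following Hirschman, fix finite
    measurable partitions [A_i], [B_j] with real weights [a_i], [b_j], and let
    [c_ij = sum_k <F chi_(A_i) g_k, chi_(B_j) F g_k>].  The function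
    [z |-> sum_ij c_ij exp (z (a_i + b_j) / 2)] takes the value [tr rho] at [0]
    and, by Cauchy-Schwarz, is bounded by [tr rho] on [Re z = 0].  On [Re z = 1]
    the bound [|<g, w e_xi>| <= |g| |w|], uniform in the frequency [xi], yields
    [(sum_i exp a_i |A_i| * sum_j exp b_j |B_j| * |rho| tr rho)^(1/2)].  Comparing
    derivatives at [0] in the three lines theorem gives
    [sum_i a_i nu(A_i) + sum_j b_j nu^(B_j) <= 2 tr rho ln (bound / tr rho)],
        and the
    theorem follows by letting [a] and [b] approach the logarithms of the densities.
    The regions of small density, of infinite measure, get weight [0]; their
    contribution on [Re z = 1] is controlled by their small [nu]-mass.

    Plancherel's theorem reduces to indicators of boxes, whose transforms are
    explicit, through the integral of [(1 - cos (u t)) / t^2], which is [pi |u|]. *)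

Require Import Defs.
From HB Require Import structures.
From mathcomp Require Import all_boot all_order all_algebra.
From mathcomp Require Import generic_quotient ring_quotient.
From mathcomp Require Import all_classical all_reals all_analysis.
From mathcomp Require Import measurable_realfun complex ring lra.

Set Implicit Arguments.
Unset Strict Implicit.
Unset Printing Implicit Defensive.
Import Order.TTheory GRing.Theory Num.Theory.
Import numFieldNormedType.Exports.
Import Normc.

Local Open Scope classical_set_scope.
Local Open Scope ring_scope.

(** The sum over [k] stays inside the modulus: estimating each rank one term alone would lose the
    operator norm, which enters only because [sum_kl |<g_k, g_l>|^2], the squared Hilbert-Schmidt
    norm of [rho], is at most [|rho| tr rho]. No orthogonality of the [g_k] is involved, so Cholesky
    elimination along an orthonormal basis can stand in for the spectral theorem. With finitely many
    weights the analytic function is a finite exponential sum, and its maximum principle follows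
    from a four-point mean inequality, without holomorphy.

    Densities may be unbounded and their logarithms not integrable, hence cutoffs above at [M], [M']
    and below at [e], [e']. The error on [Re z = 1] contains the mass below the lower cutoff of one
    side times the upper cutoff of the other, so [M] and [M'] are fixed before [e] and [e']. When
    only one positive part is known to be finite, the other side is cut below at [1], where the
    error is bounded rather than small; this crude form of the inequality already shows that the
    negative part on that side is finite. *)

Local Notation Re := complex.Re.
Local Notation Im := complex.Im.

(** * The three lines theorem for exponential sums *)

Section ThreeLines.
Context {R : realType}.
Implicit Types x y t s h : R.

Lemma abs_sin_le x : `|sin x| <= `|x|.
Proof.
wlog x0 : x / 0 <= x => [H|].
  have [/H//|/ltW x0] := leP 0 x; rewrite -normrN -sinN -(normrN x).
  by apply: H; rewrite oppr_ge0.
have [c _] := @MVT_segment R sin cos 0 x x0 (fun z _ => is_derive_sin z)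
  (continuous_subspaceT (@continuous_sin R)).
by rewrite sin0 !subr0 => ->; rewrite normrM ler_piMl// cos_max.
Qed.

Lemma one_sub_cos x : 1 - cos x = 2 * sin (x / 2) ^+ 2.
Proof.
have -> : cos x = cos ((x / 2) *+ 2) by rewrite -mulr_natr divfK.
by rewrite cos_mulr2n cos2sin2; ring.
Qed.

Lemma one_sub_cos_le x : 1 - cos x <= x ^+ 2 / 2.
Proof.
rewrite one_sub_cos; have := abs_sin_le (x / 2).
rewrite -ler_sqr ?nnegrE// !real_normK ?num_real// => ?; nra.
Qed.

Lemma abs_sin_sub_le x : `|sin x - x| <= `|x| ^+ 3 / 2.
Proof.
wlog x0 : x / 0 <= x => [H|].
  have [/H//|/ltW x0] := leP 0 x.
  by have := H (- x); rewrite oppr_ge0 sinN normrN -opprD normrN => /(_ x0).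
have [c] := @MVT_segment R sin cos 0 x x0 (fun z _ => is_derive_sin z)
  (continuous_subspaceT (@continuous_sin R)).
rewrite in_itv/= => /andP[c0 cx].
rewrite sin0 !subr0 => ->; rewrite -{2}(mul1r x) -mulrBl normrM.
rewrite (ger0_norm x0) distrC ger0_norm ?subr_ge0 ?cos_le1//.
rewrite exprSr mulrAC ler_wpM2r// (le_trans (one_sub_cos_le c))//.
by rewrite ler_pM2r// lerXn2r// ?nnegrE// (le_trans c0).
Qed.

(** The tangent inequality [1 + y <= expR y] suffices: at [y = - x] it gives
    [expR x * (1 - x) <= 1], which bounds [expR x] from above to second order. *)
Lemma expR_taylor2 x : `|x| <= 1 / 2 -> `|expR x - 1 - x| <= 2 * x ^+ 2.
Proof.
rewrite ler_norml => /andP[x1 x2].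
have h1 := expR_ge1Dx x; rewrite ger0_norm; last by lra.
have h2 := expR_ge1Dx (- x).
have h3 : expR x * expR (- x) = 1 by exact: expRxMexpNx_1.
have h4 : expR x * (1 - x) <= 1.
  by rewrite -[leRHS]h3 ler_wpM2l ?expR_ge0.
have h0 := expR_gt0 x.
suff : expR x <= 1 + x + 2 * x ^+ 2 by lra.
rewrite -(@ler_pM2r _ (1 - x)); last by lra.
apply: (le_trans h4); nra.
Qed.

(* The four-point discrete Laplacian of [Re (exp (s z))] at [0] is [O(s^3)]. *)
Lemma cosh_cos_le s : `|s| <= 1 ->
  `|expR s + expR (- s) + 2 * cos s - 4| <= 5 * `|s| ^+ 3.
Proof.
move=> s1; pose h := s / 2.
have h1 : `|h| <= 1 / 2 by rewrite normrM (gtr0_norm (x := 2^-1)) //; lra.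
pose A := expR h - expR (- h); pose B := 2 * sin h.
(* At half the argument the Laplacian is [A ^ 2 - B ^ 2]. Both [A] and [B] equal [2 h] up to second
   order, so one factor is [O(h^2)] and the other [O(h)]. *)
have -> : expR s + expR (- s) + 2 * cos s - 4 = (A - B) * (A + B).
  have -> : expR s = expR h ^+ 2 by rewrite -expRM_natl; congr expR;
      rewrite /h; lra.
  have -> : expR (- s) = expR (- h) ^+ 2.
    by rewrite -expRM_natl; congr expR; rewrite /h; lra.
  have -> : cos s = 1 - 2 * sin h ^+ 2 by rewrite -one_sub_cos; lra.
  rewrite /A /B; have := expRxMexpNx_1 h; nra.
have := expR_taylor2 h1.
have h1' : `|- h| <= 1 / 2 by rewrite normrN.
have := expR_taylor2 h1'.
have := abs_sin_sub_le h.
have -> : `|s| = 2 * `|h| by rewrite /h normrM (gtr0_norm (x := 2^-1)) //; lra.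
have hh : h ^+ 2 = `|h| ^+ 2 by rewrite real_normK ?num_real.
rewrite sqrrN hh => a1 a2 a3.
have n0 := normr_ge0 h.
have b1 : `|A - 2 * h| <= 4 * `|h| ^+ 2.
  have -> : A - 2 * h = (expR h - 1 - h) - (expR (- h) - 1 - - h).
    by rewrite /A; ring.
  by rewrite (le_trans (ler_normB _ _))//; lra.
have b2 : `|B - 2 * h| <= `|h| ^+ 3.
  have -> : B - 2 * h = 2 * (sin h - h) by rewrite /B; ring.
  by rewrite normrM (gtr0_norm (x := 2))//; lra.
have b3 : `|A - B| <= 5 * `|h| ^+ 2.
  have -> : A - B = (A - 2 * h) - (B - 2 * h) by ring.
  rewrite (le_trans (ler_normB _ _))//; nra.
have n3 : `|h| ^+ 3 <= `|h| / 4 by rewrite exprS; nra.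
have b4 : `|A + B| <= 7 * `|h|.
  have -> : A + B = (A - 2 * h) + (B - 2 * h) + 4 * h by ring.
  have : `|4 * h| = 4 * `|h| by rewrite normrM (gtr0_norm (x := 4)).
  move=> e; have := ler_normD ((A - 2 * h) + (B - 2 * h)) (4 * h).
  have := ler_normD (A - 2 * h) (B - 2 * h); nra.
rewrite normrM (le_trans (ler_pM _ _ b3 b4))//.
rewrite (_ : 5 * _ * _ = 35 * `|h| ^+ 3); last by ring.
have := exprn_ge0 3 n0; nra.
Qed.

(* A function that at every interior point is smaller than the mean of its four
   neighbours at some arbitrarily small distance has no interior maximum. *)
Lemma rectangle_max_principle (f : R -> R -> R) (Y M : R) : 0 < Y ->
  continuous (fun p : R * R => f p.1 p.2) ->
  (forall x y e, 0 < e -> exists2 t, 0 < t < e &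
     4 * f x y < f (x + t) y + f (x - t) y + f x (y + t) + f x (y - t)) ->
  (forall y, f 0 y <= M /\ f 1 y <= M) ->
  (forall x, 0 <= x <= 1 -> f x Y <= M /\ f x (- Y) <= M) ->
  forall x y, 0 <= x <= 1 -> - Y <= y <= Y -> f x y <= M.
Proof.
move=> Y0 cf mean bv bh x y x01 yY.
pose A : set (R * R) := `[0, 1] `*` `[- Y, Y].
have A0 : A !=set0 by exists (0, 0); split; rewrite /= in_itv/=; lra.
have cA : compact A by apply: compact_setX; exact: segment_compact.
have [[a b]] := compact_EVT_max A0 cA (continuous_subspaceT cf).
rewrite inE => -[]; rewrite /= !in_itv/= => /andP[a0 a1] /andP[b0 b1] mx.
have mx' x' y' : 0 <= x' <= 1 -> - Y <= y' <= Y -> f x' y' <= f a b.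
  by move=> ? ?; apply: (mx (x', y')); rewrite inE; split; rewrite /= in_itv.
apply: (le_trans (mx' _ _ x01 yY)).
have [->|aN0] := eqVneq a 0; first by have [] := bv b.
have [->|aN1] := eqVneq a 1; first by have [] := bv b.
have [->|bNY] := eqVneq b Y; first by have [] := bh a; rewrite ?a0.
have [->|bNNY] := eqVneq b (- Y); first by have [] := bh a; rewrite ?a0.
exfalso.
have {}a0 : 0 < a by rewrite lt_neqAle eq_sym aN0.
have {}a1 : a < 1 by rewrite lt_neqAle aN1.
have {}b0 : - Y < b by rewrite lt_neqAle eq_sym bNNY.
have {}b1 : b < Y by rewrite lt_neqAle bNY.
(* The distance from the maximum point to the sides: any smaller step keeps the four neighbours in
   the rectangle. *)
pose e := Num.min (Num.min a (1 - a)) (Num.min (b + Y) (Y - b)).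
have e0 : 0 < e by rewrite !lt_min; lra.
have [t /andP[t0]] := mean a b e e0.
rewrite !lt_min => /andP[/andP[t1 t2] /andP[t3 t4]].
have f1 : f (a + t) b <= f a b by apply: mx'; lra.
have f2 : f (a - t) b <= f a b by apply: mx'; lra.
have f3 : f a (b + t) <= f a b by apply: mx'; lra.
have f4 : f a (b - t) <= f a b by apply: mx'; lra.
by lra.
Qed.

Section ExpSum.
Context (K : finType) (c d : K -> R).
Implicit Type l : K -> R.

(** Real part of [sum_k (c k + i d k) exp (l k z)] at [z = x + i y]. Then [expsum_im] is its
    imaginary part and [expsum_sq] its squared modulus, so that everything is a function of two real
    variables. *)
Definition expsum_re l x y := \sum_k expR (l k * x) *
  (c k * cos (l k * y) - d k * sin (l k * y)).
Definition expsum_im l x y := \sum_k expR (l k * x) *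
  (c k * sin (l k * y) + d k * cos (l k * y)).
Definition expsum_sq l x y := expsum_re l x y ^+ 2 + expsum_im l x y ^+ 2.

(** Opposite shifts cancel the odd parts, so each exponential is an eigenfunction of the discrete
    Laplacian with a real eigenvalue; the same factor therefore serves the real and the imaginary
    part. *)
Lemma expsum_re_mean l x y t :
  expsum_re l (x + t) y + expsum_re l (x - t) y +
  expsum_re l x (y + t) + expsum_re l x (y - t) =
  4 * expsum_re l x y + \sum_k expR (l k * x) *
  (c k * cos (l k * y) - d k * sin (l k * y)) *
  (expR (l k * t) + expR (- (l k * t)) + 2 * cos (l k * t) - 4).
Proof.
rewrite /expsum_re mulr_sumr -!big_split/=; apply: eq_bigr => k _.
rewrite !(mulrDr (l k)) mulrN !expRD cosB sinB cosD sinD.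
set E := expR _; set C := cos (l k * y); set S := sin (l k * y).
set C' := cos _; set S' := sin _; set E1 := expR _; set E2 := expR _; by ring.
Qed.

Lemma expsum_im_mean l x y t :
  expsum_im l (x + t) y + expsum_im l (x - t) y +
  expsum_im l x (y + t) + expsum_im l x (y - t) =
  4 * expsum_im l x y + \sum_k expR (l k * x) *
  (c k * sin (l k * y) + d k * cos (l k * y)) *
  (expR (l k * t) + expR (- (l k * t)) + 2 * cos (l k * t) - 4).
Proof.
rewrite /expsum_im mulr_sumr -!big_split/=; apply: eq_bigr => k _.
rewrite !(mulrDr (l k)) mulrN !expRD cosB sinB cosD sinD.
set E := expR _; set C := cos (l k * y); set S := sin (l k * y).
set C' := cos _; set S' := sin _; set E1 := expR _; set E2 := expR _; by ring.
Qed.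

Lemma sum_cosh_cos_le l (a : K -> R) : exists2 B, 0 <= B &
  forall t, 0 < t -> (forall k, `|l k| * t <= 1) ->
  `|\sum_k a k * (expR (l k * t) + expR (- (l k * t)) + 2 * cos (l k * t) - 4)|
   <= B * t ^+ 3.
Proof.
exists (\sum_k `|a k| * (5 * `|l k| ^+ 3)).
  by apply: sumr_ge0 => k _; rewrite !mulr_ge0// exprn_ge0.
move=> t t0 lt; rewrite (le_trans (ler_norm_sum _ _ _))// mulr_suml.
apply: ler_sum => k _; rewrite normrM -mulrA ler_wpM2l// -mulrA -exprMn.
have -> : `|l k| * t = `|l k * t| by rewrite normrM (gtr0_norm t0).
by rewrite cosh_cos_le// normrM (gtr0_norm t0) lt.
Qed.

(** Subharmonicity of a squared modulus in discrete form. The defect from harmonicity of both parts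
    is [O(t^3)], which [eps * t ^ 2] beats for small [t]. *)
Lemma expsum_sq_mean l x y eps e : 0 < eps -> 0 < e ->
  exists2 t, 0 < t < e &
  4 * expsum_sq l x y - eps * t ^+ 2 <
  expsum_sq l (x + t) y + expsum_sq l (x - t) y +
  expsum_sq l x (y + t) + expsum_sq l x (y - t).
Proof.
move=> eps0 e0.
have [B1 B10 HB1] := sum_cosh_cos_le l (fun k => expR (l k * x) *
  (c k * cos (l k * y) - d k * sin (l k * y))).
have [B2 B20 HB2] := sum_cosh_cos_le l (fun k => expR (l k * x) *
  (c k * sin (l k * y) + d k * cos (l k * y))).
pose D := 2 * (`|expsum_re l x y| * B1 + `|expsum_im l x y| * B2) + 1.
have D0 : 0 < D by rewrite ltr_wpDl// mulr_ge0// addr_ge0// mulr_ge0.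
pose L := 1 + \sum_k `|l k|.
have L0 : 0 < L by rewrite ltr_wpDr// sumr_ge0.
(* The three bounds keep [t] below [e], keep every [l k * t] in the range of [cosh_cos_le], and make
   [D * t] at most half of [eps]. *)
pose t := Num.min (e / 2) (Num.min (L^-1) (eps / (2 * D))).
have t0 : 0 < t by rewrite !lt_min invr_gt0 L0 !divr_gt0// mulr_gt0.
have te : t <= e / 2 by rewrite ge_min lexx.
have tL : t <= L^-1 by rewrite !ge_min lexx ?orbT.
have tD : t <= eps / (2 * D) by rewrite !ge_min lexx ?orbT.
have lt k : `|l k| * t <= 1.
  rewrite -(@mulfV _ L) ?gt_eqF// ler_pM// ?(ltW t0)//.
  by rewrite /L (bigD1 k)//= addrCA lerDl addr_ge0// sumr_ge0.
exists t; first by rewrite t0/=; lra.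
have := HB1 t t0 lt; have := HB2 t t0 lt.
have := expsum_re_mean l x y t; have := expsum_im_mean l x y t.
set E2 := \sum_k _; set E1 := \sum_k _.
rewrite /expsum_sq.
set p1 := expsum_re l (x + t) y; set p2 := expsum_re l (x - t) y.
set p3 := expsum_re l x (y + t); set p4 := expsum_re l x (y - t).
set q1 := expsum_im l (x + t) y; set q2 := expsum_im l (x - t) y.
set q3 := expsum_im l x (y + t); set q4 := expsum_im l x (y - t).
set p := expsum_re l x y; set q := expsum_im l x y => qE pE b2 b1.
(* Convexity of the square: four times the sum of four squares is at least the square of the sum. *)
have key (a1 a2 a3 a4 a E : R) : a1 + a2 + a3 + a4 = 4 * a + E ->
    4 * a ^+ 2 - 2 * (`|a| * `|E|) <= a1 ^+ 2 + a2 ^+ 2 + a3 ^+ 2 + a4 ^+ 2.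
  move=> aE; rewrite -normrM.
  have h : 4 * (a1 ^+ 2 + a2 ^+ 2 + a3 ^+ 2 + a4 ^+ 2) >= (4 * a + E) ^+ 2.
    rewrite -aE; have := sqr_ge0 (a1 - a2); have := sqr_ge0 (a1 - a3).
    have := sqr_ge0 (a1 - a4); have := sqr_ge0 (a2 - a3).
    have := sqr_ge0 (a2 - a4); have := sqr_ge0 (a3 - a4); nra.
  have h2 : - `|a * E| <= a * E by rewrite lerNnormlW.
  have := sqr_ge0 E; nra.
have k1 := key _ _ _ _ _ _ pE; have k2 := key _ _ _ _ _ _ qE.
have r1 : `|p| * `|E1| <= `|p| * B1 * t ^+ 3 by rewrite -mulrA ler_wpM2l.
have r2 : `|q| * `|E2| <= `|q| * B2 * t ^+ 3 by rewrite -mulrA ler_wpM2l.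
have r3 : D * t ^+ 3 <= eps / 2 * t ^+ 2.
  rewrite exprSr mulrCA mulrC ler_wpM2r ?exprn_ge0 ?(ltW t0)//.
  rewrite mulrC -ler_pdivlMr// (le_trans tD)//.
  by rewrite le_eqVlt; apply/orP; left; apply/eqP; field; rewrite gt_eqF.
have r4 : 0 < t ^+ 2 by rewrite exprn_gt0.
have r5 : 0 < t ^+ 3 by rewrite exprn_gt0.
rewrite /D in r3; nra.
Qed.

Lemma expsum_sq_bounded l : exists B, forall x y, 0 <= x <= 1 ->
  expsum_sq l x y <= B.
Proof.
pose B := \sum_k expR `|l k| * (`|c k| + `|d k|).
exists (2 * B ^+ 2) => x y /andP[x0 x1].
have E k : expR (l k * x) <= expR `|l k|.
  rewrite ler_expR (le_trans (ler_norm _))// normrM ler_piMr//.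
  by rewrite ger0_norm.
have sq a : `|a| <= B -> a ^+ 2 <= B ^+ 2.
  by move=> aB; rewrite -real_normK ?num_real// lerXn2r// ?nnegrE// (le_trans _ aB).
have tr (u v w : R) : `|v| <= 1 -> `|w| <= 1 -> forall a b,
    `|a * v + b * w| <= `|a| + `|b|.
  move=> v1 w1 a b; rewrite (le_trans (ler_normD _ _))// !normrM.
  by rewrite lerD// ler_piMr.
rewrite /expsum_sq; suff: expsum_re l x y ^+ 2 <= B ^+ 2 /\ expsum_im l x y ^+
    2 <= B ^+ 2.
  by case; lra.
split; apply: sq; rewrite (le_trans (ler_norm_sum _ _ _))//; apply: ler_sum => k _;
  rewrite normrM (ger0_norm (expR_ge0 _)) ler_pM ?expR_ge0//.
- by rewrite -mulNr (le_trans (tr 0 _ _ _ _ _ _)) ?cos_max ?sin_max// normrN.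
- by rewrite (le_trans (tr 0 _ _ _ _ _ _)) ?cos_max ?sin_max.
Qed.

Lemma continuous_expsum_sq l :
  continuous (fun p : R * R => expsum_sq l p.1 p.2).
Proof.
have cf : continuous (fst : R * R -> R) by move=> p; exact: cvg_fst.
have cs : continuous (snd : R * R -> R) by move=> p; exact: cvg_snd.
have ce k : continuous (fun p : R * R => expR (l k * p.1)).
  move=> p; apply: (@continuous_comp _ _ _ (fun p : R * R => l k * p.1) expR).
    by apply: cvgM; [exact: cvg_cst|exact: cf].
  exact: continuous_expR.
have cc k : continuous (fun p : R * R => cos (l k * p.2)).
  move=> p; apply: (@continuous_comp _ _ _ (fun p : R * R => l k * p.2) cos).
    by apply: cvgM; [exact: cvg_cst|exact: cs].
  exact: continuous_cos.
have csn k : continuous (fun p : R * R => sin (l k * p.2)).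
  move=> p; apply: (@continuous_comp _ _ _ (fun p : R * R => l k * p.2) sin).
    by apply: cvgM; [exact: cvg_cst|exact: cs].
  exact: continuous_sin.
have csum := @continuous_big R K +%R 0 xpredT (@add_continuous R^o) (R *
    R)%type (index_enum K).
have cre : continuous (fun p : R * R => expsum_re l p.1 p.2).
  apply: csum => k _ p; apply: cvgM; first exact: ce.
  by apply: cvgB; apply: cvgM; [exact: cvg_cst|exact: cc|exact: cvg_cst|exact: csn].
have cim : continuous (fun p : R * R => expsum_im l p.1 p.2).
  apply: csum => k _ p; apply: cvgM; first exact: ce.
  by apply: cvgD; apply: cvgM; [exact: cvg_cst|exact: csn|exact: cvg_cst|exact: cc].
by move=> p; apply: cvgD; apply: cvgM; by [exact: cre|exact: cim].
Qed.

(** The strip is unbounded, so a Phragmen-Lindelof correction [2 dl x^2 - dl y^2] is added. Its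
    discrete Laplacian is [2 dl t^2], more than the defect [dl t^2] allowed in [expsum_sq_mean], and
    at height [Y] it pushes the bounded function below [M]. Then [dl] tends to [0]. *)
Lemma expsum_strip_max l (M : R) :
  (forall y, expsum_sq l 0 y <= M /\ expsum_sq l 1 y <= M) ->
  forall x, 0 <= x <= 1 -> expsum_sq l x 0 <= M.
Proof.
move=> bv x x01.
suff H dl : 0 < dl -> expsum_sq l x 0 <= M + 2 * dl.
  apply/ler_addgt0Pr => e e0; have := H (e / 2); rewrite divr_gt0// => /(_ isT).
  by lra.
move=> dl0.
have [B HB] := expsum_sq_bounded l.
pose v x y := expsum_sq l x y + 2 * dl * x ^+ 2 - dl * y ^+ 2.
pose Y := 1 + `|B - M| / dl.
have Y1 : 1 <= Y by rewrite lerDl divr_ge0// ltW.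
have Y0 : 0 < Y by lra.
have YB : B - M <= dl * Y ^+ 2.
  rewrite (le_trans (ler_norm _))// mulrC -ler_pdivrMr//.
  by rewrite expr2 (le_trans (y := Y))// ?lerDr// ler_peMr// ltW.
suff : v x 0 <= M + 2 * dl.
  rewrite /v expr0n/= mulr0 subr0; apply: le_trans; rewrite lerDl.
  by rewrite mulr_ge0 ?sqr_ge0// mulr_ge0// ltW.
apply: (@rectangle_max_principle v Y) => //; last by lra.
- move=> p; apply: cvgB; [apply: cvgD; [exact: continuous_expsum_sq|]|];
  (apply: cvgM; [exact: cvg_cst|]); apply: cvgM; by [exact: cvg_fst|exact: cvg_snd].
- move=> a b e e0.
  have [t /andP[t0 te] ht] := expsum_sq_mean l a b dl0 e0.
  exists t; first by rewrite t0.
  rewrite /v; have : 0 < t ^+ 2 by rewrite exprn_gt0.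
  have := mulr_gt0 dl0 (exprn_gt0 2 t0); nra.
- move=> y; have [b1 b2] := bv y; have := mulr_ge0 (ltW dl0) (sqr_ge0 y).
  by rewrite /v expr0n/= expr1n; lra.
- move=> z z01; have := HB z Y z01; have := HB z (- Y) z01; rewrite /v sqrrN.
  have : dl * z ^+ 2 <= dl by rewrite ler_piMr ?(ltW dl0)// expr_le1//; lra.
  by lra.
Qed.

(** Lowering all exponents by [mu] multiplies the sum by [exp (- mu z)]; this is how the bounds on
    the two boundary lines are made equal. *)
Lemma expsum_shift l (mu : R) x y :
  expsum_sq (fun k => l k - mu) x y = expR (- (2 * mu * x)) * expsum_sq l x y.
Proof.
set e := expR (- (mu * x)).
set C := cos (mu * y); set S := sin (mu * y).
have re : expsum_re (fun k => l k - mu) x y =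
    e * (expsum_re l x y * C + expsum_im l x y * S).
  rewrite /expsum_re /expsum_im mulrDr !mulr_suml !mulr_sumr -big_split/=.
  apply: eq_bigr => k _; rewrite !mulrBl expRD cosB sinB.
  by rewrite -/e -/C -/S; ring.
have im : expsum_im (fun k => l k - mu) x y =
    e * (expsum_im l x y * C - expsum_re l x y * S).
  rewrite /expsum_re /expsum_im mulrBr !mulr_suml !mulr_sumr -sumrB/=.
  apply: eq_bigr => k _; rewrite !mulrBl expRD cosB sinB.
  by rewrite -/e -/C -/S; ring.
rewrite /expsum_sq re im.
have -> : expR (- (2 * mu * x)) = e ^+ 2 by rewrite -expRM_natl; congr expR; ring.
have : C ^+ 2 + S ^+ 2 = 1 by exact: cos2Dsin2.
by move=> h; rewrite -(mulr1 (e ^+ 2 * _)) -h; ring.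
Qed.

(* The three lines theorem bounds [sum_k (c k + i d k) exp (l k z)] on [Re z = x]
   by [m0^(1-x) m1^x]; there is equality at [0], so the derivatives compare. *)
Lemma expsum_derivative_le l (m0 m1 : R) : 0 < m0 -> 0 < m1 ->
  (forall y, expsum_sq l 0 y <= m0 ^+ 2) ->
  (forall y, expsum_sq l 1 y <= m1 ^+ 2) ->
  \sum_k c k = m0 ->
  \sum_k c k * l k <= m0 * ln (m1 / m0).
Proof.
move=> m00 m10 b0 b1 cm; pose mu := ln (m1 / m0).
have emu : expR mu = m1 / m0 by rewrite lnK// posrE divr_gt0.
(* With this [mu] the shifted sum is bounded by [m0] on both lines, so the maximum principle applies
   with one constant. *)
have B x : 0 <= x <= 1 -> \sum_k c k * expR (l k * x) <= m0 * expR (mu * x).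
  move=> x01; have := @expsum_strip_max (fun k => l k - mu) (m0 ^+ 2) _ x x01.
  rewrite expsum_shift => /(_ _)/wrap[].
    move=> y; rewrite !expsum_shift mulr0 oppr0 expR0 mul1r; split=> //.
    rewrite mulr1 expRN expRM_natl emu mulrC ler_pdivrMr ?exprn_gt0 ?divr_gt0//.
    rewrite (le_trans (b1 y))// exprMn mulrCA -exprMn mulfV ?gt_eqF//.
    by rewrite expr1n mulr1.
  rewrite expRN mulrC ler_pdivrMr ?expR_gt0// -mulrA expRM_natl -exprMn => h.
  rewrite (_ : \sum_k _ = expsum_re l x 0); last first.
    rewrite /expsum_re; apply: eq_bigr => k _.
    by rewrite mulr0 cos0 sin0 mulr0 subr0 mulr1 mulrC.
  rewrite (le_trans (ler_norm _))// -ler_sqr ?nnegrE ?mulr_ge0 ?expR_ge0 ?(ltW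
      m00)//.
  rewrite real_normK ?num_real// (le_trans _ h)// /expsum_sq lerDl sqr_ge0//.
rewrite leNgt; apply/negP => lt0.
(* If the derivative were too large, the linear terms would decide at small [x]: [D] collects the
   quadratic remainders of both sides, and [L] keeps every exponent within the range of
   [expR_taylor2]. *)
pose D := \sum_k `|c k| * (2 * l k ^+ 2) + m0 * (2 * mu ^+ 2) + 1.
have D0 : 0 < D.
  rewrite ltr_wpDl// addr_ge0//; last by apply: mulr_ge0;
      [exact: ltW|rewrite mulr_ge0 ?sqr_ge0].
  by apply: sumr_ge0 => k _; apply: mulr_ge0 => //; rewrite mulr_ge0 ?sqr_ge0.
pose L := 2 + 2 * (`|mu| + \sum_k `|l k|).
have L0 : 2 <= L by rewrite lerDl mulr_ge0// addr_ge0// sumr_ge0.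
set g := \sum_k _ in lt0.
pose x := Num.min L^-1 ((g - m0 * mu) / (2 * D)).
have x0 : 0 < x by rewrite lt_min invr_gt0 (lt_le_trans _ L0)//= divr_gt0
    ?subr_gt0 ?mulr_gt0.
have xL : x <= L^-1 by rewrite ge_min lexx.
have xD : x <= (g - m0 * mu) / (2 * D) by rewrite ge_min lexx orbT.
have xL' : x * L <= 1 by rewrite -ler_pdivlMr ?mul1r// (lt_le_trans _ L0).
have x1 : x <= 1 by rewrite (le_trans xL)// invf_le1 ?(lt_le_trans _ L0)//; lra.
have small (a : R) : `|a| <= `|mu| + \sum_k `|l k| -> `|a * x| <= 1 / 2.
  move=> ha; rewrite normrM (gtr0_norm x0) mulrC.
  have : x * `|a| <= x * (`|mu| + \sum_k `|l k|) by rewrite ler_wpM2l// ltW.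
  by rewrite /L in xL'; nra.
have smu : `|mu * x| <= 1 / 2 by apply: small; rewrite lerDl sumr_ge0.
have sl k : `|l k * x| <= 1 / 2.
  by apply: small; rewrite (bigD1 k)//= addrCA lerDl addr_ge0// sumr_ge0.
have up : m0 * expR (mu * x) <= m0 + m0 * mu * x + m0 * (2 * mu ^+ 2) * x ^+ 2.
  have := expR_taylor2 smu; rewrite ler_norml => /andP[_].
  rewrite exprMn => h.
  have {}h : expR (mu * x) <= 1 + mu * x + 2 * mu ^+ 2 * x ^+ 2 by lra.
  by have := ler_wpM2l (ltW m00) h; rewrite !mulrDr; set e := expR _; lra.
have lo : m0 + g * x - (\sum_k `|c k| * (2 * l k ^+ 2)) * x ^+ 2 <=
    \sum_k c k * expR (l k * x).
  rewrite -cm /g !mulr_suml -big_split/= -sumrB; apply: ler_sum => k _.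
  have := expR_taylor2 (sl k); move=> h.
  have h2 : `|c k * (expR (l k * x) - 1 - l k * x)| <= `|c k| * (2 * (l k * x)
      ^+ 2).
    by rewrite normrM ler_wpM2l.
  by move: h2; rewrite ler_norml exprMn => /andP[+ _]; lra.
have x01 : 0 <= x <= 1 by rewrite (ltW x0).
have h := le_trans lo (le_trans (B x x01) up).
have h1 : x * (g - m0 * mu) <= D * x ^+ 2.
  rewrite /D; have : 0 <= x ^+ 2 by rewrite sqr_ge0.
  by nra.
have h2 : g - m0 * mu <= D * x.
  by rewrite -(ler_pM2l x0); apply: (le_trans h1); rewrite expr2 mulrCA.
have h3 : D * x <= (g - m0 * mu) / 2.
  rewrite mulrC -ler_pdivlMr// (le_trans xD)// le_eqVlt; apply/orP; left.
  by apply/eqP; field; rewrite gt_eqF.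
have : 0 < g - m0 * mu by rewrite subr_gt0.
by lra.
Qed.

End ExpSum.

End ThreeLines.

(** * Complex square integrable functions *)

Section ComplexFacts.
Context {R : rcfType}.
Implicit Types z w : R[i].

Lemma complexP z w : Re z = Re w -> Im z = Im w -> z = w.
Proof. by case: z w => a b [c d] /= -> ->. Qed.

Lemma ReD z w : Re (z + w) = Re z + Re w. Proof. by case: z w => ? ? []. Qed.
Lemma ImD z w : Im (z + w) = Im z + Im w. Proof. by case: z w => ? ? []. Qed.
Lemma ReN z : Re (- z) = - Re z. Proof. by case: z. Qed.
Lemma ImN z : Im (- z) = - Im z. Proof. by case: z. Qed.
Lemma ReM z w : Re (z * w) = Re z * Re w - Im z * Im w.
Proof. by case: z w => ? ? []. Qed.
Lemma ImM z w : Im (z * w) = Re z * Im w + Im z * Re w.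
Proof. by case: z w => ? ? []. Qed.
Lemma Re_conjc z : Re (conjc z) = Re z. Proof. by case: z. Qed.
Lemma Im_conjc z : Im (conjc z) = - Im z. Proof. by case: z. Qed.
Lemma conjcM z w : conjc (z * w) = conjc z * conjc w.
Proof. by case: z w => a b [c d]; apply: complexP => /=; ring. Qed.
Lemma conjcD z w : conjc (z + w) = conjc z + conjc w.
Proof. by case: z w => a b [c d]; apply: complexP => /=; ring. Qed.
Definition reimE := (ReD, ImD, ReN, ImN, ReM, ImM, Re_conjc, Im_conjc).

Lemma Re_sum (I : Type) (r : seq I) (P : pred I) (F : I -> R[i]) :
  Re (\sum_(i <- r | P i) F i) = \sum_(i <- r | P i) Re (F i).
Proof. by apply: (big_morph _ ReD). Qed.

Lemma Im_sum (I : Type) (r : seq I) (P : pred I) (F : I -> R[i]) :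
  Im (\sum_(i <- r | P i) F i) = \sum_(i <- r | P i) Im (F i).
Proof. by apply: (big_morph _ ImD). Qed.

Lemma normc_ge0 z : 0 <= normc z.
Proof. by case: z => ? ?; exact: sqrtr_ge0. Qed.

Lemma normc_sq z : normc z ^+ 2 = Re z ^+ 2 + Im z ^+ 2.
Proof. by case: z => a b /=; rewrite sqr_sqrtr// addr_ge0// sqr_ge0. Qed.

Lemma normc_sqM z w : normc (z * w) ^+ 2 = normc z ^+ 2 * normc w ^+ 2.
Proof. by rewrite normcM exprMn. Qed.

Lemma normc_conjc z : normc (conjc z) = normc z.
Proof. by case: z => a b /=; rewrite sqrrN. Qed.

Lemma normr_Re_le z : `|Re z| <= normc z.
Proof.
rewrite -ler_sqr ?nnegrE ?normc_ge0// real_normK ?num_real// normc_sq.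
by rewrite lerDl sqr_ge0.
Qed.

Lemma normr_Im_le z : `|Im z| <= normc z.
Proof.
rewrite -ler_sqr ?nnegrE ?normc_ge0// real_normK ?num_real// normc_sq.
by rewrite lerDr sqr_ge0.
Qed.

Lemma mulc_conjc z : z * conjc z = (normc z ^+ 2)%:C%C.
Proof. by apply: complexP; rewrite !reimE/= ?normc_sq; ring. Qed.

Lemma ge0_complex z : 0 <= z <-> 0 <= Re z /\ Im z = 0.
Proof.
rewrite lecE /=; split=> [/andP[/eqP -> ->]//|[-> ->]].
by rewrite eqxx.
Qed.

End ComplexFacts.

(** * Positive semidefinite sesquilinear forms *)

Section PsdForm.
Context {R : rcfType} {H : lmodType R[i]} (B : H -> H -> R[i]).
Hypothesis Bl : forall a u v w, B (a *: u + v) w = a * B u w + B v w.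
Hypothesis Bpos : forall u, 0 <= B u u.

Hypothesis Br : forall a u v w, B w (a *: u + v) = conjc a * B w u + B w v.

(** Positivity includes being real on the diagonal. Expanding at [u + v] and at [i u + v] makes two
    imaginary parts vanish, which are the two components of the identity. *)
Lemma psd_hermitian u v : B v u = conjc (B u v).
Proof.
have BD a : B (a *: u + v) (a *: u + v) =
    a * conjc a * B u u + a * B u v + conjc a * B v u + B v v.
  by rewrite Bl !Br; ring.
have [_ i0] := (ge0_complex _).1 (Bpos u).
have [_ j0] := (ge0_complex _).1 (Bpos v).
have [_] := (ge0_complex _).1 (Bpos (1 *: u + v)).
have [_] := (ge0_complex _).1 (Bpos ('i%C *: u + v)).
rewrite !BD !reimE /= i0 j0 => h1 h2.
by apply: complexP; rewrite !reimE; lra.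
Qed.

(** Testing with [u - t b v], where [b = B u v], absorbs the phase and leaves a real parameter [t].
    As the form may be degenerate, [B v v = 0] is treated apart: there a large [t] forces
    [b = 0]. *)
Lemma psd_cauchy_schwarz u v :
  normc (B u v) ^+ 2 <= Re (B u u) * Re (B v v).
Proof.
pose b := B u v; pose n := normc b ^+ 2.
have [u0 iu] := (ge0_complex _).1 (Bpos u).
have [v0 iv] := (ge0_complex _).1 (Bpos v).
have key (t : R) : 0 <= Re (B u u) - 2 * t * n + t ^+ 2 * n * Re (B v v).
  have [+ _] := (ge0_complex _).1 (Bpos ((- t%:C%C * b) *: v + u)).
  rewrite Bl !Br (psd_hermitian u v) -/b !reimE/= iv /n normc_sq.
  by rewrite (_ : _ + _ = Re (B u u) - 2 * t * (Re b ^+ 2 + Im b ^+ 2) +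
    t ^+ 2 * (Re b ^+ 2 + Im b ^+ 2) * Re (B v v))//; ring.
rewrite -/b -/n; have n0 : 0 <= n by exact: sqr_ge0.
have [v00|vN0] := eqVneq (Re (B v v)) 0.
  have [->|nN0] := eqVneq n 0; first by rewrite mulr_ge0.
  have np : 0 < n by rewrite lt_neqAle eq_sym nN0.
  have := key ((Re (B u u) + 1) / (2 * n)); rewrite v00 mulr0 addr0.
  rewrite (_ : 2 * _ * n = Re (B u u) + 1); last by field.
  by lra.
have vp : 0 < Re (B v v) by rewrite lt_neqAle eq_sym vN0.
have := key (Re (B v v))^-1; set x := Re (B v v) => h.
have : 0 <= Re (B u u) - n / x.
  apply: le_trans h _; rewrite le_eqVlt; apply/orP; left; apply/eqP.
  by field.
by rewrite subr_ge0 ler_pdivrMr.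
Qed.

End PsdForm.

Section ComplexIntegralFacts.
Context d (T : measurableType d) (R : realType) (mu : {measure set T -> \bar R}).
Implicit Types f g h : T -> R[i].

Lemma sqintegrableP f : sqintegrable mu f <->
  cmeasurable f /\ mu.-integrable setT (fun x => (normc (f x) ^+ 2)%:E).
Proof.
split=> [[mf fi]|[mf fi]]; split => //.
  apply/integrableP; split; first exact: measurable_normcX2.
  by under eq_integral do rewrite gee0_abs ?lee_fin ?sqr_ge0//.
move/integrableP : fi => [_]; under eq_integral do rewrite gee0_abs ?lee_fin
    ?sqr_ge0//.
by [].
Qed.

Lemma cmeasurableM f g : cmeasurable f -> cmeasurable g ->
  cmeasurable (fun x => f x * g x).
Proof.
move=> [f1 f2] [g1 g2]; split.
- under eq_fun do rewrite ReM.
  by apply: measurable_funB; exact: measurable_funM.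
- under eq_fun do rewrite ImM.
  by apply: measurable_funD; exact: measurable_funM.
Qed.

Lemma cmeasurable_conjc f : cmeasurable f -> cmeasurable (fun x => conjc (f x)).
Proof.
move=> [f1 f2]; split.
- by under eq_fun do rewrite Re_conjc.
- by under eq_fun do rewrite Im_conjc; exact: measurableT_comp.
Qed.

Lemma cmeasurable_cst (a : R[i]) : cmeasurable (fun _ : T => a).
Proof. by split; exact: measurable_cst. Qed.

Lemma cmeasurableD f g : cmeasurable f -> cmeasurable g ->
  cmeasurable (fun x => f x + g x).
Proof.
move=> [f1 f2] [g1 g2]; split.
- by under eq_fun do rewrite ReD; exact: measurable_funD.
- by under eq_fun do rewrite ImD; exact: measurable_funD.
Qed.

Lemma cmeasurableB f g : cmeasurable f -> cmeasurable g ->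
  cmeasurable (fun x => f x - g x).
Proof.
move=> [f1 f2] [g1 g2]; split.
- by under eq_fun do rewrite ReD ReN; exact: measurable_funB.
- by under eq_fun do rewrite ImD ImN; exact: measurable_funB.
Qed.

Lemma cmeasurable_sum (I : Type) (r : seq I) (F : I -> T -> R[i]) :
  (forall i, cmeasurable (F i)) -> cmeasurable (fun x => \sum_(i <- r) F i x).
Proof.
move=> mF; elim: r => [|a r IH].
  by under eq_fun do rewrite big_nil; exact: cmeasurable_cst.
by under eq_fun do rewrite big_cons; exact: cmeasurableD.
Qed.

Lemma cmeasurable_indic (A : set T) : measurable A ->
  cmeasurable (fun x => ((\1_A x : R)%:C)%C).
Proof.
move=> mA; split; first exact: measurable_indic.
exact: measurable_cst.
Qed.

Lemma cintegrable_bounded f (g : T -> R) : cmeasurable f ->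
  mu.-integrable setT (EFin \o g) -> (forall x, normc (f x) <= g x) ->
  cintegrable mu f.
Proof.
move=> [f1 f2] ig fg; have g0 x : 0 <= g x by rewrite (le_trans _ (fg x))//
    normc_ge0.
by split; apply: (le_integrable _ _ _ ig) => //=; try exact/measurable_EFinP;
  move=> x _; rewrite lee_fin (ger0_norm (g0 x)) (le_trans _ (fg x))//;
  [exact: normr_Re_le|exact: normr_Im_le].
Qed.

Lemma measurable_normc f : cmeasurable f ->
  measurable_fun setT (fun x => normc (f x)).
Proof.
move=> mf; have := measurable_normcX2 mf => /measurable_EFinP m2.
rewrite (_ : (fun x => _) = Num.sqrt \o (fun x => normc (f x) ^+ 2)).
  apply: (measurableT_comp _ m2); apply: continuous_measurable_fun.
  exact: sqrt_continuous.
by apply/funext => x /=; rewrite sqrtr_sqr ger0_norm ?normc_ge0.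
Qed.

Lemma cintegrable_normc f : cintegrable mu f ->
  mu.-integrable setT (fun x => (normc (f x))%:E).
Proof.
move=> [f1 f2]; have mf : cmeasurable f.
  by split; apply/measurable_EFinP; [case/integrableP : f1|case/integrableP : f2].
have := integrableD measurableT (integrable_abse f1) (integrable_abse f2).
apply: le_integrable => //; first exact/measurable_EFinP/measurable_normc.
move=> x _; rewrite /= lee_fin ger0_norm ?normc_ge0// ger0_norm ?addr_ge0//.
rewrite -ler_sqr ?nnegrE ?normc_ge0 ?addr_ge0// normc_sq sqrrD.
by rewrite !real_normK ?num_real// addrAC lerDl mulrn_wge0 ?mulr_ge0.
Qed.

Lemma cintegrableM f g : sqintegrable mu f -> sqintegrable mu g ->
  cintegrable mu (fun x => f x * g x).
Proof.
move=> /sqintegrableP[mf fi] /sqintegrableP[mg gi].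
apply: (@cintegrable_bounded _ (fun x => normc (f x) ^+ 2 + normc (g x) ^+ 2)).
- exact: cmeasurableM.
- exact: (integrableD measurableT fi gi).
- move=> x; rewrite normcM; have := sqr_ge0 (normc (f x) - normc (g x)).
  by have := normc_ge0 (f x); have := normc_ge0 (g x); nra.
Qed.

Lemma sqintegrable_conjc f : sqintegrable mu f ->
  sqintegrable mu (fun x => conjc (f x)).
Proof.
move=> [mf fi]; split; first exact: cmeasurable_conjc.
by under eq_integral do rewrite normc_conjc.
Qed.

Lemma cintegrable_lin (a : R[i]) f g : cintegrable mu f -> cintegrable mu g ->
  cintegrable mu (fun x => a * f x + g x).
Proof.
move=> [f1 f2] [g1 g2]; split.
- under eq_fun do rewrite ReD ReM EFinD EFinB !EFinM.
  apply: integrableD => //; apply: integrableB => //; exact: integrableZl.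
- under eq_fun do rewrite ImD ImM !EFinD !EFinM.
  apply: integrableD => //; apply: integrableD => //; exact: integrableZl.
Qed.

Lemma cintegral_lin (a : R[i]) f g : cintegrable mu f -> cintegrable mu g ->
  cintegral mu (fun x => a * f x + g x) = a * cintegral mu f + cintegral mu g.
Proof.
move=> [f1 f2] [g1 g2].
have Z (b : R) (h : T -> R) : mu.-integrable setT (EFin \o h) ->
  mu.-integrable setT (EFin \o (fun x => b * h x)).
  by move=> ih; have := integrableZl measurableT b ih.
apply: complexP; rewrite /cintegral !reimE/=.
- under eq_Rintegral do rewrite ReD ReM.
  rewrite RintegralD//; last first.
    by apply: (@integrableB _ _ _ _ _ measurableT _ _ (Z _ _ f1) (Z _ _ f2)).
  by rewrite RintegralB// ?RintegralZl//; exact: Z.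
- under eq_Rintegral do rewrite ImD ImM.
  rewrite RintegralD//; last first.
    by apply: (@integrableD _ _ _ _ _ measurableT _ _ (Z _ _ f2) (Z _ _ f1)).
  by rewrite RintegralD// ?RintegralZl//; exact: Z.
Qed.

Lemma cintegral_conjc f : cintegrable mu f ->
  cintegral mu (fun x => conjc (f x)) = conjc (cintegral mu f).
Proof.
move=> [f1 f2]; apply: complexP; rewrite /cintegral reimE/=.
- by apply: eq_Rintegral => x _; rewrite Re_conjc.
- rewrite -[RHS]mulN1r -RintegralZl//.
  by apply: eq_Rintegral => x _; rewrite Im_conjc mulN1r.
Qed.

Lemma ae_cintegral f g : cmeasurable f -> cmeasurable g ->
  {ae mu, forall x, f x = g x} -> cintegral mu f = cintegral mu g.
Proof.
move=> [f1 f2] [g1 g2] fg; apply: complexP; rewrite /cintegral/= /Rintegral.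
all: congr fine; apply: ae_eq_integral => //; try exact/measurable_EFinP.
all: by apply: filterS fg => x /= -> _.
Qed.

Lemma cintegral_sum (I : Type) (r : seq I) (F : I -> T -> R[i]) :
  (forall i, cintegrable mu (F i)) ->
  cintegrable mu (fun x => \sum_(i <- r) F i x) /\
  cintegral mu (fun x => \sum_(i <- r) F i x) = \sum_(i <- r) cintegral mu (F i).
Proof.
move=> iF; elim: r => [|a r [IH1 IH2]].
  under eq_fun do rewrite big_nil; split.
    by split; exact: integrable0.
  by rewrite big_nil; apply: complexP; rewrite /= /cintegral/= /Rintegral integral0.
have -> : (fun x => \sum_(i <- a :: r) F i x) =
    (fun x => 1 * F a x + \sum_(i <- r) F i x).
  by apply/funext => x; rewrite big_cons mul1r.
split; first exact: cintegrable_lin.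
by rewrite cintegral_lin// big_cons mul1r IH2.
Qed.

Lemma sqintegrable_lin (a : R[i]) f g : sqintegrable mu f -> sqintegrable mu g ->
  sqintegrable mu (fun x => a * f x + g x).
Proof. exact: sqintegrable_linear. Qed.

Lemma sqintegrable_le f g : cmeasurable f -> sqintegrable mu g ->
  (forall x, normc (f x) <= normc (g x)) -> sqintegrable mu f.
Proof.
move=> mf [mg gi] fg; split => //; apply: le_lt_trans gi.
apply: ge0_le_integral => //.
- by move=> x _; rewrite lee_fin sqr_ge0.
- exact: measurable_normcX2.
- exact: measurable_normcX2.
- by move=> x _; rewrite lee_fin lerXn2r// nnegrE normc_ge0.
Qed.

End ComplexIntegralFacts.

Section L2Facts.
Context d (T : measurableType d) (R : realType) (mu : {measure set T -> \bar R}).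
Implicit Types (f g : T -> R[i]) (u v w : L2 mu) (a : R[i]).

Lemma repr_sqintegrable u : sqintegrable mu (repr u).
Proof. by have /asboolP := L2valP (repr u). Qed.

Lemma repr_cmeasurable u : cmeasurable (repr u).
Proof. by case: (repr_sqintegrable u). Qed.

Lemma L2class_repr u : L2class mu (repr u) = u.
Proof.
rewrite -[RHS]reprK /L2class; congr (\pi_(_))%qT.
by apply: val_inj; rewrite [LHS]insubdK//; exact: L2valP.
Qed.

Lemma repr_L2class f : sqintegrable mu f ->
  {ae mu, forall x, repr (L2class mu f) x = f x}.
Proof.
by move=> sf; apply/(L2class_eq (repr_sqintegrable _) sf); exact: L2class_repr.
Qed.

Lemma L2eq u v : {ae mu, forall x, repr u x = repr v x} -> u = v.
Proof.
move=> uv; rewrite -(L2class_repr u) -(L2class_repr v).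
by apply/L2class_eq => //; exact: repr_sqintegrable.
Qed.

Lemma L2class_lin a f g : sqintegrable mu f -> sqintegrable mu g ->
  L2class mu (fun x => a * f x + g x) = a *: L2class mu f + L2class mu g.
Proof.
move=> sf sg.
have insubE h : sqintegrable mu h -> L2val (insubd (0 : L2fun mu) h) = h.
  by move=> hL2; rewrite [LHS]insubdK//; exact/asboolP.
rewrite {2 3}/L2class.
have -> : a *: (\pi_(L2 mu) (insubd (0 : L2fun mu) f))%qT =
    (\pi_(L2 mu) (a *: insubd (0 : L2fun mu) f))%qT.
  by rewrite pi_L2scale.
rewrite /L2class -[RHS](Quotient.pi_add (@L2null _ _ _ mu)); congr (\pi_(_))%qT.
apply: val_inj; rewrite [LHS]insubE; last exact: sqintegrable_lin.
by rewrite -[RHS]/(a *: L2val (insubd 0 f) + L2val (insubd 0 g)) !insubE.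
Qed.

Lemma repr_lin a u v :
  {ae mu, forall x, repr (a *: u + v) x = a * repr u x + repr v x}.
Proof.
have := L2class_lin a (repr_sqintegrable u) (repr_sqintegrable v).
rewrite !L2class_repr => <-.
by apply: repr_L2class; apply: sqintegrable_lin; exact: repr_sqintegrable.
Qed.

Lemma repr_sum (I : Type) (r : seq I) (c : I -> R[i]) (F : I -> L2 mu) :
  {ae mu, forall x, repr (\sum_(i <- r) c i *: F i) x =
                    \sum_(i <- r) c i * repr (F i) x}.
Proof.
elim: r => [|k r IH].
  have := repr_lin 1 0 (0 : L2 mu); rewrite scaler0 add0r big_nil.
  apply: filterS => x; rewrite big_nil mul1r => h.
  by apply/(addrI (repr (0 : L2 mu) x)); rewrite addr0 -h.
rewrite big_cons.
apply: filterS2 (repr_lin (c k) (F k) (\sum_(i <- r) c i *: F i)) IH.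
by move=> x -> ->; rewrite big_cons.
Qed.

Lemma cintegrable_dot u v :
  cintegrable mu (fun x => repr u x * conjc (repr v x)).
Proof.
apply: cintegrableM; first exact: repr_sqintegrable.
by apply: sqintegrable_conjc; exact: repr_sqintegrable.
Qed.

Lemma dotL2E f g : sqintegrable mu f -> sqintegrable mu g ->
  dotL2 (L2class mu f) (L2class mu g) = cintegral mu (fun x => f x * conjc (g x)).
Proof.
move=> sf sg; apply: ae_cintegral.
- by apply: cmeasurableM; [exact: repr_cmeasurable|
    apply: cmeasurable_conjc; exact: repr_cmeasurable].
- by apply: cmeasurableM; [exact: sf.1|apply: cmeasurable_conjc; exact: sg.1].
- by apply: filterS2 (repr_L2class sf) (repr_L2class sg) => x -> ->.
Qed.

Lemma dotL2_linl a u v w : dotL2 (a *: u + v) w = a * dotL2 u w + dotL2 v w.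
Proof.
rewrite /dotL2 -cintegral_lin; [|exact: cintegrable_dot..].
apply: ae_cintegral.
- by apply: cmeasurableM; [exact: repr_cmeasurable|
    apply: cmeasurable_conjc; exact: repr_cmeasurable].
- have [] := cintegrable_lin a (cintegrable_dot u w) (cintegrable_dot v w).
  by move=> /measurable_int/measurable_EFinP m1 /measurable_int/measurable_EFinP m2.
- by apply: filterS (repr_lin a u v) => x ->; ring.
Qed.

Lemma dotL2C u v : dotL2 v u = conjc (dotL2 u v).
Proof.
rewrite /dotL2 -cintegral_conjc; last exact: cintegrable_dot.
by congr (cintegral mu _); apply/funext => x; rewrite conjcM conjcK mulrC.
Qed.

Lemma dotL2_linr a u v w : dotL2 w (a *: u + v) = conjc a * dotL2 w u + dotL2 w v.
Proof. by rewrite dotL2C dotL2_linl conjcD conjcM -!dotL2C. Qed.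

Definition normsq u : R := \int[mu]_x (normc (repr u x) ^+ 2).

Lemma normsq_ge0 u : 0 <= normsq u.
Proof. by apply: Rintegral_ge0 => x _; exact: sqr_ge0. Qed.

Lemma normsqE u : (normsq u)%:E = (\int[mu]_x (normc (repr u x) ^+ 2)%:E)%E.
Proof.
have [_ ui] := repr_sqintegrable u.
rewrite fineK// ge0_fin_numE// integral_ge0// => x _.
by rewrite lee_fin sqr_ge0.
Qed.

Lemma normL2_sq u : normL2 u ^+ 2 = normsq u.
Proof. by rewrite sqr_sqrtr// normsq_ge0. Qed.

Lemma normL2_ge0 u : 0 <= normL2 u. Proof. exact: sqrtr_ge0. Qed.

Lemma dotL2_self u : dotL2 u u = (normsq u)%:C%C.
Proof.
apply: complexP; rewrite /dotL2 /cintegral /=.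
  by apply: eq_Rintegral => x _; rewrite mulc_conjc.
by under eq_Rintegral do rewrite mulc_conjc /=; rewrite /Rintegral integral0.
Qed.

Lemma normsq_class f : sqintegrable mu f ->
  (normsq (L2class mu f))%:E = (\int[mu]_x (normc (f x) ^+ 2)%:E)%E.
Proof.
move=> sf; rewrite normsqE; apply: ge0_ae_eq_integral => //.
- by apply: measurable_normcX2; exact: repr_cmeasurable.
- by apply: measurable_normcX2; exact: sf.1.
- by move=> x _; rewrite lee_fin sqr_ge0.
- by move=> x _; rewrite lee_fin sqr_ge0.
- by apply: filterS (repr_L2class sf) => x -> _.
Qed.

Lemma normsq_eq0 u : normsq u = 0 -> u = 0.
Proof.
move=> u0; apply: L2eq.
have := normsqE u; rewrite u0 => /esym.
have mu2 := measurable_normcX2 (repr_cmeasurable u).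
have := ae_eq_integral_abs mu measurableT mu2.
under eq_integral do rewrite gee0_abs ?lee_fin ?sqr_ge0//.
move=> [+ _] => /[apply] h.
(* The empty sum is a way to say that the chosen representative of [0] vanishes almost
   everywhere. *)
have z := repr_sum [::] (fun _ : unit => 0) (fun _ => 0 : L2 mu).
rewrite big_nil in z.
apply: filterS2 h z => x h ->; rewrite big_nil.
move: (h I) => [] /eqP; rewrite sqrf_eq0 => /eqP; exact: eq0_normc.
Qed.

End L2Facts.

Lemma conjcN (R : rcfType) (z : R[i]) : conjc (- z) = - conjc z.
Proof. by case: z. Qed.

Lemma nneseries_half_lty (R : realType) :
  (\sum_(k <oo) ((2^-1 : R) ^+ k)%:E < +oo)%E.
Proof.
apply: (@le_lt_trans _ _ 2%:E); last exact: ltry.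
apply: lime_le; first by apply: is_cvg_nneseries => k _ _;
    rewrite lee_fin exprn_ge0.
have sE n : \sum_(0 <= k < n) (2^-1 : R) ^+ k = 2 - 2 * (2^-1) ^+ n.
  elim: n => [|n IH]; first by rewrite big_geq// expr0; ring.
  by rewrite big_nat_recr//= IH exprS; field.
near=> n; rewrite sumEFin lee_fin sE.
by rewrite gerBl mulr_ge0// exprn_ge0.
Unshelve. all: by end_near. Qed.

(** * Hilbert space structure of L2 *)

Section L2Hilbert.
Context d (T : measurableType d) (R : realType) (mu : {measure set T -> \bar R}).
Implicit Types (u v w : L2 mu) (a : R[i]).

Lemma dotL2Dl u v w : dotL2 (u + v) w = dotL2 u w + dotL2 v w.
Proof. by rewrite -{1}(scale1r u) dotL2_linl mul1r. Qed.

Lemma dotL2Dr u v w : dotL2 w (u + v) = dotL2 w u + dotL2 w v.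
Proof. by rewrite dotL2C dotL2Dl conjcD -!dotL2C. Qed.

Lemma dotL20l w : dotL2 (0 : L2 mu) w = 0.
Proof. by apply/(addIr (dotL2 0 w)); rewrite -dotL2Dl !add0r. Qed.

Lemma dotL20r w : dotL2 w (0 : L2 mu) = 0.
Proof. by rewrite dotL2C dotL20l conjc0. Qed.

Lemma dotL2Zl a u w : dotL2 (a *: u) w = a * dotL2 u w.
Proof. by rewrite -(addr0 (a *: u)) dotL2_linl dotL20l addr0. Qed.

Lemma dotL2Zr a u w : dotL2 w (a *: u) = conjc a * dotL2 w u.
Proof. by rewrite dotL2C dotL2Zl conjcM -dotL2C. Qed.

Lemma dotL2Nl u w : dotL2 (- u) w = - dotL2 u w.
Proof. by rewrite -scaleN1r dotL2Zl mulN1r. Qed.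

Lemma dotL2Nr u w : dotL2 w (- u) = - dotL2 w u.
Proof. by rewrite dotL2C dotL2Nl conjcN -dotL2C. Qed.

Lemma dotL2Bl u v w : dotL2 (u - v) w = dotL2 u w - dotL2 v w.
Proof. by rewrite dotL2Dl dotL2Nl. Qed.

Lemma dotL2Br u v w : dotL2 w (u - v) = dotL2 w u - dotL2 w v.
Proof. by rewrite dotL2Dr dotL2Nr. Qed.

Lemma dotL2_suml (I : Type) (r : seq I) (F : I -> L2 mu) w :
  dotL2 (\sum_(i <- r) F i) w = \sum_(i <- r) dotL2 (F i) w.
Proof. by apply: (big_morph (fun u => dotL2 u w) (fun u v =>
    dotL2Dl u v w) (dotL20l w)). Qed.

Lemma dotL2_sumr (I : Type) (r : seq I) (F : I -> L2 mu) w :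
  dotL2 w (\sum_(i <- r) F i) = \sum_(i <- r) dotL2 w (F i).
Proof. by apply: (big_morph (fun u => dotL2 w u) (fun u v =>
    dotL2Dr u v w) (dotL20r w)). Qed.

Lemma normsqD u v : normsq (u + v) = normsq u + normsq v + 2 * Re (dotL2 u v).
Proof.
have := congr1 (@complex.Re R) (dotL2_self (u + v));
    rewrite dotL2Dl !dotL2Dr !dotL2_self.
by rewrite (dotL2C u v) !reimE/= => <-; ring.
Qed.

Lemma normsqZ a u : normsq (a *: u) = normc a ^+ 2 * normsq u.
Proof.
have := congr1 (@complex.Re R) (dotL2_self (a *: u)).
by rewrite dotL2Zl dotL2Zr dotL2_self mulrA mulc_conjc !reimE/= => <-; ring.
Qed.

Lemma normsqN u : normsq (- u) = normsq u.
Proof. by rewrite -scaleN1r normsqZ -[-1]/(-1)%C normcN normc1 expr1n mul1r. Qed.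

Lemma normsqB u v : normsq (u - v) = normsq u + normsq v - 2 * Re (dotL2 u v).
Proof. by rewrite normsqD normsqN dotL2Nr ReN; ring. Qed.

Lemma normsq0 : normsq (0 : L2 mu) = 0.
Proof. by rewrite -(scale0r 0) normsqZ normc0 expr0n mul0r. Qed.

Lemma parallelogram u v :
  normsq (u + v) + normsq (u - v) = 2 * normsq u + 2 * normsq v.
Proof. by rewrite normsqD normsqB; ring. Qed.

Lemma dotL2_ge0 u : 0 <= dotL2 u u.
Proof. by rewrite dotL2_self ler0c normsq_ge0. Qed.

Lemma dotL2_cauchy_schwarz u v : normc (dotL2 u v) <= normL2 u * normL2 v.
Proof.
rewrite -ler_sqr ?nnegrE ?normc_ge0 ?mulr_ge0 ?normL2_ge0//.
rewrite exprMn !normL2_sq.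
have := @psd_cauchy_schwarz R (L2 mu) (@dotL2 _ _ _ mu)
  (@dotL2_linl _ _ _ _) dotL2_ge0 (@dotL2_linr _ _ _ _) u v.
by rewrite !dotL2_self.
Qed.

Lemma normL2_triangle u v : normL2 (u + v) <= normL2 u + normL2 v.
Proof.
rewrite -ler_sqr ?nnegrE ?addr_ge0 ?normL2_ge0// sqrrD !normL2_sq normsqD.
have := le_trans (ler_norm _) (le_trans (normr_Re_le _) (dotL2_cauchy_schwarz u v)).
by move=> h; rewrite addrAC lerD2r lerD2l; lra.
Qed.

Lemma normL2N u : normL2 (- u) = normL2 u.
Proof. by rewrite /normL2 -!/(normsq _) normsqN. Qed.

Lemma normL2BC u v : normL2 (u - v) = normL2 (v - u).
Proof. by rewrite -normL2N opprB. Qed.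

Lemma normL20 : normL2 (0 : L2 mu) = 0.
Proof. by rewrite /normL2 -/(normsq _) normsq0 sqrtr0. Qed.

Lemma normL2_eq0 u : normL2 u = 0 -> u = 0.
Proof. by move=> u0; apply: normsq_eq0; rewrite -normL2_sq u0 expr0n. Qed.

Lemma normL2_dist u v w : normL2 (u - w) <= normL2 (u - v) + normL2 (v - w).
Proof. by have := normL2_triangle (u - v) (v - w); rewrite addrA subrK. Qed.

Lemma normL2Z a u : normL2 (a *: u) = normc a * normL2 u.
Proof.
apply/eqP; rewrite -(@eqrXn2 _ 2)// ?mulr_ge0 ?normL2_ge0 ?normc_ge0//.
by rewrite exprMn !normL2_sq normsqZ.
Qed.

Lemma repr_sub u v : {ae mu, forall x, repr (u - v) x = repr u x - repr v x}.
Proof.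
have := repr_lin (-1) v u; rewrite scaleN1r addrC.
by apply: filterS => x ->; rewrite mulN1r addrC.
Qed.

Lemma normsqB_integral u v :
  (normsq (u - v))%:E = (\int[mu]_x (normc (repr u x - repr v x) ^+ 2)%:E)%E.
Proof.
rewrite normsqE; apply: ge0_ae_eq_integral => //.
- exact/measurable_normcX2/repr_cmeasurable.
- apply: measurable_normcX2.
  by apply: cmeasurableB; exact: repr_cmeasurable.
- by move=> x _; rewrite lee_fin sqr_ge0.
- by move=> x _; rewrite lee_fin sqr_ge0.
- by apply: filterS (repr_sub u v) => x -> _.
Qed.

Lemma geometric_increments_cvg (x : nat -> R) (C : R) :
  (forall k, `|x k.+1 - x k| <= C * (2^-1) ^+ k) -> cvgn x.
Proof.
move=> xC; rewrite (_ : x = fun n => x 0%N + series (telescope x) n); last first.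
  by apply/funext => n; rewrite -eq_sum_telescope.
apply: is_cvgD; first exact: is_cvg_cst.
apply: normed_cvg; apply: (series_le_cvg _ _ xC).
- by move=> n; exact: normr_ge0.
- by move=> n; rewrite (le_trans _ (xC n)).
- by apply: is_cvg_geometric_series; rewrite ger0_norm//; lra.
Qed.

(** Riesz-Fischer. Along [phi] the squared increments have integrals at most [8^-k], so
    [sum_k 4^k |increment|^2] is integrable; where it is finite the increments are [O(2^-k)] and the
    subsequence converges pointwise. *)
Lemma L2_complete (u : nat -> L2 mu) :
  (forall e, 0 < e -> exists N, forall m n, (N <= m)%N -> (N <= n)%N ->
     normL2 (u m - u n) <= e) ->
  exists w, forall e, 0 < e -> exists N, forall n, (N <= n)%N ->
     normL2 (u n - w) <= e.
Proof.
move=> cau.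
have cau2 e : 0 < e -> exists N, forall m n, (N <= m)%N -> (N <= n)%N ->
    normsq (u m - u n) <= e.
  move=> e0; have [N HN] := cau (Num.sqrt e) (ltac:(by rewrite sqrtr_gt0)).
  exists N => m n Nm Nn; rewrite -normL2_sq -(sqr_sqrtr (ltW e0)).
  by rewrite lerXn2r// ?nnegrE ?normL2_ge0 ?sqrtr_ge0// HN.
have /choice[psi Hpsi] : forall k : nat, exists N, forall m n, (N <= m)%N ->
    (N <= n)%N -> normsq (u m - u n) <= (8^-1) ^+ k.
  by move=> k; apply: cau2; rewrite exprn_gt0.
(* The sum puts [phi k] beyond every earlier threshold; the summand [k] makes [phi] unbounded. *)
pose phi k := (k + \sum_(j < k.+1) psi j)%N.
have psiphi j k : (j <= k)%N -> (psi j <= phi k)%N.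
  move=> jk; rewrite /phi (bigD1 (Ordinal (jk : (j < k.+1)%N)))//=.
  by rewrite addnCA leq_addr.
pose f k x := repr (u (phi k)) x.
have mf k : cmeasurable (f k) by exact: repr_cmeasurable.
pose G k x := ((4 ^+ k) * normc (f k.+1 x - f k x) ^+ 2)%:E : \bar R.
have mG k : measurable_fun setT (G k).
  rewrite /G; under eq_fun do rewrite EFinM.
  by apply: measurable_funeM; apply: measurable_normcX2; exact: cmeasurableB.
have G0 k x : setT x -> (0 <= G k x)%E.
  by move=> _; rewrite lee_fin mulr_ge0 ?sqr_ge0// exprn_ge0.
have sG : (\int[mu]_x \sum_(k <oo) G k x < +oo)%E.
  rewrite integral_nneseries//.
  have le k : (\int[mu]_x G k x <= ((2^-1) ^+ k)%:E)%E.
    rewrite /G; under eq_integral do rewrite EFinM.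
    rewrite ge0_integralZl_EFin ?exprn_ge0//; first last.
    - by apply: measurable_normcX2; exact: cmeasurableB.
    - by move=> x _; rewrite lee_fin sqr_ge0.
    rewrite -normsqB_integral -EFinM lee_fin.
    have := Hpsi k (phi k.+1) (phi k) (psiphi _ _ (leqnSn k)) (psiphi _ _
        (leqnn k)).
    move=> /(ler_wpM2l (exprn_ge0 k (ler0n R 4))) /le_trans; apply.
    by rewrite -exprMn lerXn2r// ?nnegrE//; lra.
  apply: (@le_lt_trans _ _ (\sum_(k <oo) ((2^-1) ^+ k)%:E)%E).
    by apply: lee_nneseries => // k _ _; apply: integral_ge0 => x; exact: G0.
  exact: nneseries_half_lty.
pose SG x := (\sum_(k <oo) G k x)%E.
have mSG : measurable_fun setT SG.
  by apply: (ge0_emeasurable_sum (P := xpredT)) => // k x _ _; exact: G0.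
have SG0 x : (0 <= SG x)%E by apply: nneseries_ge0 => k _ _; exact: G0.
have iSG : mu.-integrable setT SG.
  apply/integrableP; split => //.
  by under eq_integral do rewrite gee0_abs ?SG0//.
have aefin := integrable_ae measurableT iSG.
pose E := SG @^-1` [set~ +oo%E].
have mE : measurable E.
  rewrite -[E]setTI; apply: mSG => //.
  by apply: measurableC; exact: emeasurable_set1.
(* Cutting off outside the set where the series is finite makes the sequence converge at every
   point, so the limit is measurable. *)
pose h k x := (((\1_E x : R)%:C)%C * f k x).
have mh k : cmeasurable (h k).
  by apply: cmeasurableM => //; exact: cmeasurable_indic.
have hcvg x : cvgn (fun k => Re (h k x)) /\ cvgn (fun k => Im (h k x)).
  have [Ex|NEx] := pselect (E x); last first.
    rewrite (_ : (fun k => _) = cst 0); last first.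
      apply/funext => k; rewrite /h indicE memNset// !reimE/=.
      by rewrite !mul0r subr0.
    rewrite (_ : (fun k => Im _) = cst 0); last first.
      apply/funext => k; rewrite /h indicE memNset// !reimE/=.
      by rewrite !mul0r addr0.
    by split; exact: is_cvg_cst.
  have hE k : h k x = f k x by rewrite /h indicE mem_set//= mul1r.
  have [r rE] : exists r, r%:E = SG x.
    exists (fine (SG x)); rewrite fineK// ge0_fin_numE// lt_neqAle leey andbT.
    exact/eqP.
  have dk k : normc (f k.+1 x - f k x) <= Num.sqrt r * (2^-1) ^+ k.
    have Gr : (G k x <= r%:E)%E.
      rewrite rE /SG (nneseriesD1 (n := k))//; last by move=> i _; exact: G0.
      by rewrite leeDl// nneseries_ge0// => i _ _; exact: G0.
    have r0 : 0 <= r.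
      by rewrite -lee_fin (le_trans _ Gr)// G0.
    rewrite -ler_sqr ?nnegrE ?normc_ge0 ?mulr_ge0 ?sqrtr_ge0 ?exprn_ge0//.
    rewrite exprMn sqr_sqrtr// -exprM mulnC exprM.
    move: Gr; rewrite lee_fin.
    rewrite -ler_pdivlMl ?exprn_gt0// => /le_trans; apply.
    rewrite mulrC ler_wpM2l// -exprVn lerXn2r// ?nnegrE ?invr_ge0//; lra.
  split; apply: (@geometric_increments_cvg _ (Num.sqrt r)) => k;
    rewrite !hE (le_trans _ (dk k))//.
    by rewrite -ReN -ReD normr_Re_le.
  by rewrite -ImN -ImD normr_Im_le.
pose g x := Complex (limn (fun k => Re (h k x))) (limn (fun k => Im (h k x))).
have mg : cmeasurable g.
  split; apply: measurable_fun_cvg.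
  - by move=> k; exact: (mh k).1.
  - by move=> x _; exact: (hcvg x).1.
  - by move=> k; exact: (mh k).2.
  - by move=> x _; exact: (hcvg x).2.
have hf : {ae mu, forall x, forall k, h k x = f k x}.
  apply: filterS aefin => x /(_ I) fx k; rewrite /h indicE mem_set ?mul1r//.
  by move=> SGx; rewrite SGx in fx.
(* Fatou carries a bound on the distances from [u n] to late terms over to the distance to [g]. This
   is used twice: for [g] to be square integrable, and for the convergence in norm. *)
have key n e : 0 <= e -> (exists K, forall k, (K <= k)%N ->
      normsq (u n - u (phi k)) <= e) ->
    (\int[mu]_x (normc (repr (u n) x - g x) ^+ 2)%:E <= e%:E)%E.
  move=> e0 [K HK].
  pose F k x := (normc (repr (u n) x - h k x) ^+ 2)%:E : \bar R.
  have mF k : measurable_fun setT (F k).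
    by apply: measurable_normcX2; apply: cmeasurableB => //;
        exact: repr_cmeasurable.
  have F0 k x : setT x -> (0 <= F k x)%E by move=> _; rewrite lee_fin sqr_ge0.
  have Fl x : F ^~ x @ \oo --> (normc (repr (u n) x - g x) ^+ 2)%:E.
    apply: cvg_EFin; first by near=> k.
    rewrite normc_sq.
    rewrite (_ : fine \o F ^~ x = fun k =>
      Re (repr (u n) x - h k x) ^+ 2 + Im (repr (u n) x - h k x) ^+ 2); last first.
      by apply/funext => k; rewrite /= normc_sq.
    apply: cvgD.
      under eq_fun do rewrite ReD ReN; rewrite ReD ReN.
      by apply: cvgM; (apply: cvgB; [exact: cvg_cst|exact: (hcvg x).1]).
    under eq_fun do rewrite ImD ImN; rewrite ImD ImN.
    by apply: cvgM; (apply: cvgB; [exact: cvg_cst|exact: (hcvg x).2]).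
  have := fatou mu measurableT mF F0.
  rewrite (_ : (fun x => limn_einf _) = fun x =>
    (normc (repr (u n) x - g x) ^+ 2)%:E); last first.
    by apply/funext => x; rewrite is_cvg_limn_einfE ?(cvg_lim _ (Fl x))//;
      apply/cvg_ex; eexists; exact: Fl.
  move=> /le_trans; apply.
  have FE k : (\int[mu]_x F k x)%E = (normsq (u n - u (phi k)))%:E.
    rewrite normsqB_integral; apply: ge0_ae_eq_integral => //.
    - by apply: measurable_normcX2; apply: cmeasurableB; exact: repr_cmeasurable.
    - by move=> x _; rewrite lee_fin sqr_ge0.
    - by move=> x _; rewrite lee_fin sqr_ge0.
    - by apply: filterS hf => x hx _; rewrite /F hx.
  rewrite limn_einf_lim; apply: lime_le; first exact: is_cvg_einfs.
  near=> k; rewrite (@le_trans _ _ (normsq (u n - u (phi k)))%:E)//.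
    by rewrite -FE; apply: ereal_inf_lbound; exists k => //=.
  by rewrite lee_fin HK//; near: k; exists K.
have gsq : sqintegrable mu g.
  have [K HK] := cau2 1 ltr01.
  have K1 : (\int[mu]_x (normc (repr (u K) x - g x) ^+ 2)%:E <= 1%:E)%E.
    apply: key => //; exists K => k Kk; apply: HK => //.
    by rewrite (leq_trans Kk)// /phi leq_addr.
  have sB : sqintegrable mu (fun x => repr (u K) x - g x).
    split; last exact: le_lt_trans K1 (ltry _).
    by apply: cmeasurableB => //; exact: repr_cmeasurable.
  have := sqintegrable_lin (-1) sB (repr_sqintegrable (u K)).
  by congr sqintegrable; apply/funext => x; ring.
exists (L2class mu g) => e e0.
have [N HN] := cau2 (e ^+ 2) (exprn_gt0 2 e0).
exists N => n Nn.
rewrite -ler_sqr ?nnegrE ?normL2_ge0 ?(ltW e0)// normL2_sq -lee_fin.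
rewrite normsqB_integral.
rewrite (_ : (\int[mu]_x _ = \int[mu]_x (normc (repr (u n) x - g x) ^+ 2)%:E)%E).
  apply: key; first exact: sqr_ge0.
  by exists N => k Nk; apply: HN => //; rewrite (leq_trans Nk)// /phi leq_addr.
apply: ge0_ae_eq_integral => //.
- by apply: measurable_normcX2; apply: cmeasurableB; exact: repr_cmeasurable.
- by apply: measurable_normcX2; apply: cmeasurableB => //; exact: repr_cmeasurable.
- by move=> x _; rewrite lee_fin sqr_ge0.
- by move=> x _; rewrite lee_fin sqr_ge0.
- by apply: filterS (repr_L2class gsq) => x -> _.
Unshelve. all: by end_near. Qed.

Definition comb (I : Type) (s : I -> L2 mu) (l : seq (R[i] * I)) : L2 mu :=
  \sum_(p <- l) p.1 *: s p.2.

Lemma comb_cat (I : Type) (s : I -> L2 mu) l1 l2 :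
  comb s (l1 ++ l2) = comb s l1 + comb s l2.
Proof. by rewrite /comb big_cat. Qed.

Lemma combZ (I : Type) (s : I -> L2 mu) a l :
  comb s [seq (a * p.1, p.2) | p <- l] = a *: comb s l.
Proof.
by rewrite /comb big_map scaler_sumr; apply: eq_bigr => p _; rewrite scalerA.
Qed.

Definition total_family (I : Type) (s : I -> L2 mu) :=
  forall u, (forall i, dotL2 u (s i) = 0) -> u = 0.

(** Moving [r] by [- t <r, v> v] lowers the norm to first order unless [<r, v> = 0]. The choice
    [t = 1 / (|v|^2 + 1)] is small enough and also covers [v = 0]. *)
Lemma minimizer_orthogonal r v :
  (forall a, normsq r <= normsq (r - a *: v)) -> dotL2 r v = 0.
Proof.
move=> rmin; pose n := normc (dotL2 r v) ^+ 2.
have n0 : 0 <= n by exact: sqr_ge0.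
have key (t : R) : 0 <= - (2 * t * n) + t ^+ 2 * n * normsq v.
  have := rmin (t%:C%C * dotL2 r v).
  rewrite normsqB dotL2Zr normsqZ normc_sqM !conjcM conjc_real -/n.
  rewrite -[t%:C%C * _ * _]mulrA [X in t%:C%C * X]mulrC mulc_conjc -/n normc_sq
      !reimE/= => h.
  by rewrite -(@lerD2l _ (normsq r)) addr0; apply: le_trans h _; nra.
have S0 := normsq_ge0 v; pose t := (normsq v + 1)^-1.
have St : t * (normsq v + 1) = 1 by rewrite mulVf// gt_eqF// ltr_wpDl.
have t0 : 0 < t by rewrite invr_gt0 ltr_wpDl.
have {}key := key t.
have : n * t <= 0.
  have -> : n * t = 2 * t * n - n * t by ring.
  have : t ^+ 2 * n * normsq v <= n * t.
    have -> : t ^+ 2 * n * normsq v = n * t * (t * (normsq v + 1)) - n * t ^+ 2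
        by ring.
    by rewrite St mulr1 gerBl mulr_ge0// sqr_ge0.
  by lra.
rewrite pmulr_lle0// => n00.
by apply: eq0_normc; apply/eqP; rewrite -sqrf_eq0 eq_le n00.
Qed.

(* Orthogonal projection onto the closed span: a minimizing sequence is Cauchy by
   the parallelogram law, and the residual of its limit is orthogonal to [s]. *)
Lemma total_family_dense (I : Type) (s : I -> L2 mu) u e :
  total_family s -> 0 < e -> exists l, normL2 (u - comb s l) <= e.
Proof.
move=> stot e0.
pose D := [set normsq (u - comb s l) | l in setT].
have D0 : has_inf D.
  split; first by exists (normsq (u - comb s [::])), [::].
  by exists 0 => _ [l _ <-]; exact: normsq_ge0.
have Dle l : inf D <= normsq (u - comb s l) by apply: ge_inf; [case: D0|exists l].
have /choice[l Hl] : forall n : nat, exists l,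
    normsq (u - comb s l) <= inf D + n.+1%:R^-1.
  move=> n; have n0 : 0 < n.+1%:R^-1 :> R by rewrite invr_gt0.
  have [_ [l _ <-] hl] := inf_adherent n0 D0.
  by exists l; exact: ltW.
have small (x : R) : 0 < x -> exists N, forall n, (N <= n)%N -> n.+1%:R^-1 <= x.
  move=> x0; exists (Num.truncn x^-1) => n Nn.
  rewrite -[leRHS]invrK lef_pV2 ?posrE ?invr_gt0//.
  rewrite (le_trans (ltW (truncnS_gt _)))// ler_nat ltnS//.
pose v n := comb s (l n).
have [w Hw] : exists w, forall e, 0 < e -> exists N, forall n, (N <= n)%N ->
     normL2 (v n - w) <= e.
  apply: L2_complete => x x0.
  have [N HN] := small (x ^+ 2 / 4) (divr_gt0 (exprn_gt0 2 x0) (ltr0n R 4)).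
  exists N => m n Nm Nn.
  rewrite -ler_sqr ?nnegrE ?normL2_ge0 ?(ltW x0)// normL2_sq.
  have := parallelogram (u - v n) (u - v m).
  rewrite (_ : u - v n - (u - v m) = v m - v n); last first.
    by rewrite opprB addrC addrA subrK.
  (* The midpoint of two combinations is again a combination, so the infimum bounds its distance to
     [u] from below. *)
  have -> : u - v n + (u - v m) =
      2 *: (u - comb s [seq (2^-1 * p.1, p.2) | p <- l m ++ l n]).
    rewrite combZ comb_cat scalerBr scalerA mulfV ?pnatr_eq0// scale1r.
    rewrite scaler_nat mulr2n addrACA -opprD; congr (_ - _).
    by rewrite addrC.
  rewrite normsqZ (_ : normc 2 ^+ 2 = 4); last first.
    by rewrite normc_sq /=; ring.
  have h1 := Dle [seq (2^-1 * p.1, p.2) | p <- l m ++ l n].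
  have h2 := le_trans (Hl m) (_ : _ <= inf D + x ^+ 2 / 4).
  have h3 := le_trans (Hl n) (_ : _ <= inf D + x ^+ 2 / 4).
  move: (h2 (ltac:(by rewrite lerD2l HN))) (h3 (ltac:(by rewrite lerD2l HN))).
  by rewrite -/(v m) -/(v n); lra.
have inf0 : 0 <= inf D.
  by apply: lb_le_inf => [|_ [k _ <-]]; [case: D0|exact: normsq_ge0].
pose dl := Num.sqrt (inf D); have dl2 : dl ^+ 2 = inf D by rewrite sqr_sqrtr.
have dl0 : 0 <= dl by exact: sqrtr_ge0.
have uw : u - w = 0.
  apply: stot => i; apply: minimizer_orthogonal => a.
  rewrite -!normL2_sq lerXn2r ?nnegrE ?normL2_ge0//.
  apply/ler_addgt0Pr => x x0; have x3 : 0 < x / 3 by rewrite divr_gt0.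
  have [N1 HN1] := Hw _ x3; have [N2 HN2] := small _ (exprn_gt0 2 x3).
  pose n := maxn N1 N2.
  have h1 : normL2 (v n - w) <= x / 3 by apply: HN1; exact: leq_maxl.
  have h2 : normL2 (u - v n) <= dl + x / 3.
    rewrite -ler_sqr ?nnegrE ?normL2_ge0 ?addr_ge0 ?(ltW x3)// normL2_sq.
    rewrite (le_trans (Hl n))// sqrrD dl2 addrAC.
    rewrite (le_trans (_ : _ <= inf D + (x / 3) ^+ 2)) ?lerD2l ?HN2 ?leq_maxr//.
    by rewrite lerDl mulrn_wge0// mulr_ge0// ltW.
  have h3 := normL2_dist u (v n) w.
  (* Appending the term [a *: s i] to the list gives one more competitor for the infimum. *)
  have h4 : dl <= normL2 (u - v n - a *: s i).
    rewrite -ler_sqr ?nnegrE ?normL2_ge0// dl2 normL2_sq -addrA -opprD.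
    have := Dle (rcons (l n) (a, i)); rewrite -cats1 comb_cat.
    by rewrite {2}/comb big_seq1.
  have h5 : normL2 (u - v n - a *: s i) <= normL2 (u - w - a *: s i) + normL2
      (v n - w).
    rewrite (_ : u - v n - a *: s i = u - w - a *: s i - (v n - w)); last first.
      by rewrite opprB [u - w - _]addrAC addrA subrK addrAC.
    by rewrite (le_trans (normL2_triangle _ _))// normL2N.
  by lra.
have [N HN] := Hw e e0; exists (l N).
have := HN N (leqnn N); rewrite normL2BC /v.
by move/eqP : uw; rewrite subr_eq0 => /eqP ->.
Qed.

(** * Orthonormal sets, Bessel and Parseval *)

Section Orthonormal.
Variable B : set (L2 mu).
Hypothesis Borth : forall e e', B e -> B e' -> dotL2 e e' = (e == e')%:R.

Definition orth_proj (s : seq (L2 mu)) u := \sum_(e <- s) dotL2 u e *: e.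

Lemma orth_proj_orthogonal s u e : uniq s -> {subset s <= B} -> e \in s ->
  dotL2 (u - orth_proj s u) e = 0.
Proof.
move=> us sB es; rewrite dotL2Bl /orth_proj dotL2_suml (bigD1_seq e)//=.
have Be : B e by exact/set_mem/sB.
rewrite dotL2Zl (Borth Be Be) eqxx mulr1.
rewrite big_seq_cond big1 ?addr0 ?subrr// => i /andP[si ie].
have Bi : B i by exact/set_mem/sB.
by rewrite dotL2Zl (Borth Bi Be) (negbTE ie) mulr0.
Qed.

Lemma normsq_sub_orth_proj s u : uniq s -> {subset s <= B} ->
  normsq (u - orth_proj s u) = normsq u - \sum_(e <- s) normc (dotL2 u e) ^+ 2.
Proof.
move=> us sB; set p := orth_proj s u.
have orth : dotL2 (u - p) p = 0.
  rewrite {2}/p /orth_proj dotL2_sumr big_seq big1// => e es.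
  by rewrite dotL2Zr orth_proj_orthogonal ?mulr0.
have up : dotL2 u p = (\sum_(e <- s) normc (dotL2 u e) ^+ 2)%:C%C.
  rewrite /p /orth_proj dotL2_sumr; apply: complexP.
    by rewrite Re_sum; apply: eq_bigr => e _; rewrite dotL2Zr mulrC mulc_conjc.
  by rewrite Im_sum big1// => e _; rewrite dotL2Zr mulrC mulc_conjc.
have : dotL2 (u - p) (u - p) = dotL2 u (u - p) - dotL2 p (u - p).
  by rewrite dotL2Bl.
have -> : dotL2 p (u - p) = 0 by rewrite dotL2C orth conjc0.
rewrite subr0 (dotL2Br u p u) up !dotL2_self => /(congr1 (@complex.Re R)).
by rewrite ReD ReN.
Qed.

Lemma bessel s u : uniq s -> {subset s <= B} ->
  \sum_(e <- s) normc (dotL2 u e) ^+ 2 <= normsq u.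
Proof.
by move=> us sB; rewrite -subr_ge0 -normsq_sub_orth_proj// normsq_ge0.
Qed.

Hypothesis Btot : forall u, (forall e, B e -> dotL2 u e = 0) -> u = 0.

(** By Pythagoras, the projection onto the basis vectors that occur in a good combination is at
    least as close to [u] as the combination itself. *)
Lemma orth_proj_approx u x : 0 < x ->
  exists s, [/\ uniq s, {subset s <= B} & normL2 (u - orth_proj s u) <= x].
Proof.
move=> x0.
(* Outside [B] the family takes the value [0], so that it is indexed by all vectors. *)
have stot : total_family (fun e => if `[< B e >] then e else 0).
  by move=> v v0; apply: Btot => e Be; have := v0 e; rewrite asboolT.
have [l Hl] := total_family_dense u stot x0.
pose s := undup [seq e <- map snd l | `[< B e >]]; exists s.
have us : uniq s by exact: undup_uniq.
have sB : {subset s <= B}.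
  by move=> e; rewrite mem_undup mem_filter => /andP[/asboolP ? _]; rewrite inE.
split => //; apply: le_trans Hl.
set p := orth_proj s u; set c := comb _ l.
have pc : dotL2 (u - p) (p - c) = 0.
  rewrite dotL2Br {2}/p /orth_proj dotL2_sumr big_seq big1 ?sub0r; last first.
    by move=> e es; rewrite dotL2Zr orth_proj_orthogonal ?mulr0.
  rewrite /c /comb dotL2_sumr big_seq big1 ?oppr0// => -[a e] il.
  rewrite dotL2Zr /=; case: asboolP => Be; last by rewrite dotL20r mulr0.
  rewrite orth_proj_orthogonal ?mulr0// mem_undup mem_filter asboolT//=.
  by apply/mapP; exists (a, e).
have := normsqD (u - p) (p - c); rewrite pc mulr0 addr0 addrA subrK => h.
rewrite -ler_sqr ?nnegrE ?normL2_ge0// !normL2_sq h lerDl normsq_ge0//.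
Qed.

Lemma parseval u : (\esum_(e in B) (normc (dotL2 u e) ^+ 2)%:E = (normsq u)%:E)%E.
Proof.
apply/eqP; rewrite eq_le; apply/andP; split.
  apply: ge_ereal_sup => _ /= [A [finA AB] <-].
  rewrite fsbig_finite//= sumEFin lee_fin bessel ?finmap.fset_uniq//.
  by move=> e; rewrite in_fset_set// inE => /AB; rewrite inE.
apply/lee_addgt0Pr => x x0.
have sx0 : 0 < Num.sqrt x by rewrite sqrtr_gt0.
have [s [us sB h]] := orth_proj_approx u sx0.
have {}h : normsq u <= x + \sum_(e <- s) normc (dotL2 u e) ^+ 2.
  rewrite -lerBlDr -normsq_sub_orth_proj// -(sqr_sqrtr (ltW x0)) -normL2_sq.
  by rewrite lerXn2r ?nnegrE ?normL2_ge0 ?sqrtr_ge0.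
apply: (@le_trans _ _ (x + \sum_(e <- s) normc (dotL2 u e) ^+ 2)%:E).
  by rewrite lee_fin.
rewrite EFinD addeC leeD2r// -sumEFin; apply: esum_ge.
exists [set` s]; last by rewrite fsbig_seq.
by split; [exact: finite_seq|move=> e /sB; rewrite inE].
Qed.

End Orthonormal.

(** A maximal orthonormal set exists by Zorn's lemma and is total, since a nonzero vector orthogonal
    to it could be normalized and added. Hence [onb] is not its default value. *)
Lemma onb_orthonormal_basis : orthonormal_basis (@onb _ _ _ mu).
Proof.
rewrite /onb; suff [B hB] : exists B : set (L2 mu), orthonormal_basis B.
  exact: (@xgetPex _ set0 [set B | orthonormal_basis B] (ex_intro _ B hB)).
pose P := [set B : set (L2 mu) | forall e e', B e -> B e' ->
  dotL2 e e' = (e == e')%:R].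
have [|B [PB Bmax]] := @Zorn_bigcup _ P.
  move=> F FP Ftot e e' [X FX Xe] [Y FY Ye'].
  have [XY|YX] := Ftot X Y FX FY.
    by apply: (FP Y FY) => //; exact: XY.
  by apply: (FP X FX) => //; exact: YX.
exists B; split => // u u0; apply: contrapT => uN0.
have n0 : normL2 u != 0 by apply/eqP => /normL2_eq0.
pose e := ((normL2 u)^-1)%:C%C *: u.
have e0 f : B f -> dotL2 e f = 0 by move=> Bf; rewrite dotL2Zl u0 ?mulr0.
have ee : dotL2 e e = 1.
  rewrite dotL2_self normsqZ normc_sq /= -normL2_sq expr0n addr0 exprVn.
  by rewrite mulVf// expf_neq0.
have NBe : ~ B e by move=> Be; have := e0 e Be; rewrite ee => /eqP;
    rewrite oner_eq0.
apply: (Bmax (B `|` [set e])).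
  split; first by move=> x; left.
  by move=> /(_ e); apply: contra_not NBe => h; apply: h; right.
move=> x y [Bx|->] [By|->].
- exact: PB.
- rewrite dotL2C e0// conjc0; case: eqP => // xe.
  by rewrite xe in Bx.
- by rewrite e0//; case: eqP => // ey; rewrite -ey in By.
- by rewrite eqxx.
Qed.

End L2Hilbert.

Lemma normc_real_sq (R : rcfType) (x : R) : normc x%:C%C ^+ 2 = x ^+ 2.
Proof. by rewrite normc_sq /= expr0n addr0. Qed.

(** * Positive operators as sums of rank one operators *)

Section PsdOperators.
Context d (T : measurableType d) (R : realType) (mu : {measure set T -> \bar R}).
Implicit Types (u v w : L2 mu) (a : R[i]) (P : L2 mu -> L2 mu).

(** Linearity is a clause rather than a bundled structure, because the elimination below produces
    operators as plain functions. *)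
Definition psd_op P := [/\ (forall a u v, P (a *: u + v) = a *: P u + P v),
  bounded_op P & positive_op P].

Definition qform P u : R := Re (dotL2 (P u) u).

Lemma qform_ge0 P u : psd_op P -> 0 <= qform P u.
Proof. by case=> _ _ /(_ u)/ge0_complex[]. Qed.

Section PsdFacts.
Variable P : L2 mu -> L2 mu.
Hypothesis psdP : psd_op P.

Let Bl a u v w : dotL2 (P (a *: u + v)) w = a * dotL2 (P u) w + dotL2 (P v) w.
Proof. by case: psdP => -> _ _; rewrite dotL2_linl. Qed.
Let Br a u v w : dotL2 (P w) (a *: u + v) = conjc a * dotL2 (P w) u + dotL2 (P w) v.
Proof. by rewrite dotL2_linr. Qed.
Let Bpos u : 0 <= dotL2 (P u) u. Proof. by case: psdP. Qed.

Lemma psd_op_hermitian u v : dotL2 (P v) u = conjc (dotL2 (P u) v).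
Proof. exact: (psd_hermitian (B := fun u v => dotL2 (P u) v) Bl Bpos Br). Qed.

Lemma psd_op_sym u v : dotL2 (P v) u = dotL2 v (P u).
Proof. by rewrite psd_op_hermitian -dotL2C. Qed.

Lemma psd_op_cauchy_schwarz u v :
  normc (dotL2 (P u) v) ^+ 2 <= qform P u * qform P v.
Proof. exact: (psd_cauchy_schwarz (B := fun u v => dotL2 (P u) v) Bl Bpos Br). Qed.

Lemma psd_op_self u : dotL2 (P u) u = (qform P u)%:C%C.
Proof. by apply: complexP => //=; have /ge0_complex[] := Bpos u. Qed.

Lemma psd_op0 : P 0 = 0.
Proof.
case: psdP => lin _ _; have := lin 1 0 0.
by rewrite !scale1r addr0 => /eqP; rewrite -subr_eq0 opprD addNKr oppr_eq0 => /eqP.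
Qed.

(** Cauchy-Schwarz for the form of [P], with [P u] as second vector. *)
Lemma psd_op_eq0 u : qform P u = 0 -> P u = 0.
Proof.
move=> u0; apply: normsq_eq0; have := psd_op_cauchy_schwarz u (P u).
rewrite u0 mul0r dotL2_self normc_sq /= expr0n addr0 => h.
by apply/eqP; rewrite -sqrf_eq0 eq_le h sqr_ge0.
Qed.

Lemma sqrt_qformD u v :
  Num.sqrt (qform P (u + v)) <= Num.sqrt (qform P u) + Num.sqrt (qform P v).
Proof.
have u0 := qform_ge0 u psdP; have v0 := qform_ge0 v psdP.
rewrite -ler_sqr ?nnegrE ?addr_ge0 ?sqrtr_ge0// sqrrD !sqr_sqrtr//;
    last exact: qform_ge0.
have E : qform P (u + v) = qform P u + qform P v + 2 * Re (dotL2 (P u) v).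
  rewrite /qform -{1}(scale1r u) Bl dotL2Dr dotL2Dr mul1r (psd_op_hermitian u v).
  by rewrite !reimE; ring.
suff : Re (dotL2 (P u) v) <= Num.sqrt (qform P u) * Num.sqrt (qform P v).
  by rewrite E; lra.
rewrite -sqrtrM// (le_trans (ler_norm _))// (le_trans (normr_Re_le _))//.
rewrite -(ger0_norm (normc_ge0 _)) -sqrtr_sqr ler_sqrt ?mulr_ge0//.
exact: psd_op_cauchy_schwarz.
Qed.

Lemma sqrt_qformZ a u :
  Num.sqrt (qform P (a *: u)) = normc a * Num.sqrt (qform P u).
Proof.
have -> : qform P (a *: u) = normc a ^+ 2 * qform P u.
  case: psdP => lin _ _; rewrite /qform.
  have -> : P (a *: u) = a *: P u by have := lin a u 0; rewrite psd_op0 !addr0.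
  by rewrite dotL2Zl dotL2Zr mulrA mulc_conjc !reimE/=; ring.
by rewrite sqrtrM ?sqr_ge0// sqrtr_sqr ger0_norm ?normc_ge0.
Qed.

Lemma qform_bounded : exists2 M, 0 <= M & forall u, qform P u <= M * normsq u.
Proof.
case: psdP => _ [M HM] _; exists `|M| => // u.
rewrite (le_trans (ler_norm _))// (le_trans (normr_Re_le _))//.
rewrite (le_trans (dotL2_cauchy_schwarz _ _))// -normL2_sq expr2 mulrA.
rewrite ler_wpM2r ?normL2_ge0// (le_trans (HM u))// ler_wpM2r ?normL2_ge0//.
exact: ler_norm.
Qed.

End PsdFacts.

Lemma sum_cauchy_schwarz (I : Type) (r : seq I) (x y : I -> R) :
  (\sum_(i <- r) x i * y i) ^+ 2 <= (\sum_(i <- r) x i ^+ 2) * \sum_(i <- r) y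
      i ^+ 2.
Proof.
elim: r => [|i r IH]; first by rewrite !big_nil expr0n mulr0.
rewrite !big_cons; set s := \sum_(j <- r) _ in IH *.
set A := \sum_(j <- r) x j ^+ 2 in IH *; set B := \sum_(j <- r) y j ^+ 2 in IH *.
have A0 : 0 <= A by apply: sumr_ge0 => j _; exact: sqr_ge0.
have B0 : 0 <= B by apply: sumr_ge0 => j _; exact: sqr_ge0.
set a := x i; set b := y i.
suff h : 2 * s * (a * b) <= A * b ^+ 2 + B * a ^+ 2.
  have -> : (a * b + s) ^+ 2 = a ^+ 2 * b ^+ 2 + 2 * s * (a * b) + s ^+ 2 by ring.
  have -> : (a ^+ 2 + A) * (b ^+ 2 + B) = a ^+ 2 * b ^+ 2 + (A * b ^+ 2 + B * a
      ^+ 2) + A * B.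
    by ring.
  by rewrite lerD// lerD2l.
have r0 : 0 <= A * b ^+ 2 + B * a ^+ 2 by rewrite addr_ge0//;
    apply: mulr_ge0 => //; exact: sqr_ge0.
rewrite (le_trans (ler_norm _))// -(ger0_norm r0) -ler_sqr ?nnegrE//.
rewrite !real_normK ?num_real//.
have -> : (2 * s * (a * b)) ^+ 2 = 4 * (a ^+ 2 * b ^+ 2) * s ^+ 2 by ring.
apply: (@le_trans _ _ (4 * (a ^+ 2 * b ^+ 2) * (A * B))).
  by rewrite ler_wpM2l//; do 2?apply: mulr_ge0 => //; exact: sqr_ge0.
have := sqr_ge0 (A * b ^+ 2 - B * a ^+ 2); nra.
Qed.

(** The seminorm [Num.sqrt (qform P u)] of a finite expansion of [u] is bounded through
    Cauchy-Schwarz, by the trace and Bessel; the boundedness of [P] disposes of the remainder. It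
    turns a small trace into a uniformly small form. *)
Lemma qform_le_trace P u (t : R) : psd_op P -> (optrace P <= t%:E)%E ->
  qform P u <= t * normsq u.
Proof.
move=> psdP trt; have [Borth Btot] := @onb_orthonormal_basis _ T R mu.
have t0 : 0 <= t.
  rewrite -lee_fin (le_trans _ trt)// esum_ge0// => e _.
  by rewrite lee_fin; exact: qform_ge0.
have [M M0 HM] := qform_bounded psdP.
have sM : 0 <= Num.sqrt M by exact: sqrtr_ge0.
suff h : Num.sqrt (qform P u) <= Num.sqrt t * normL2 u.
  rewrite -(sqr_sqrtr (qform_ge0 u psdP)) -(sqr_sqrtr t0) -normL2_sq -exprMn.
  by rewrite lerXn2r// nnegrE ?mulr_ge0 ?sqrtr_ge0 ?normL2_ge0.
apply/ler_addgt0Pr => x x0.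
have x1 : 0 < x / (Num.sqrt M + 1) by rewrite divr_gt0// ltr_wpDl.
have [s [us sB Hs]] := orth_proj_approx Borth Btot u x1.
set p := orth_proj s u in Hs.
rewrite -{1}(subrK p u) addrC (le_trans (sqrt_qformD psdP _ _))// lerD//.
- have hp : Num.sqrt (qform P p) <=
      \sum_(e <- s) normc (dotL2 u e) * Num.sqrt (qform P e).
    rewrite /p /orth_proj; elim: (s) => [|e r IH].
      rewrite !big_nil /qform psd_op0// dotL20l sqrtr0//.
    rewrite !big_cons (le_trans (sqrt_qformD psdP _ _))// lerD//.
    by rewrite sqrt_qformZ.
  rewrite (le_trans hp)// -ler_sqr ?nnegrE ?mulr_ge0 ?sqrtr_ge0 ?normL2_ge0//;
      last first.
    by apply: sumr_ge0 => e _; rewrite mulr_ge0 ?normc_ge0 ?sqrtr_ge0.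
  apply: (le_trans (sum_cauchy_schwarz _ _ _)).
  rewrite exprMn (sqr_sqrtr t0) (normL2_sq u) mulrC.
  rewrite ler_pM//.
  + by apply: sumr_ge0 => e _; exact: sqr_ge0.
  + by apply: sumr_ge0 => e _; exact: sqr_ge0.
  + under eq_bigr do rewrite sqr_sqrtr ?qform_ge0//.
    rewrite -lee_fin (le_trans _ trt)// -sumEFin; apply: esum_ge.
    exists [set` s]; last by rewrite fsbig_seq.
    by split; [exact: finite_seq|move=> e /sB; rewrite inE].
  + exact: (bessel Borth).
- apply: (@le_trans _ _ (Num.sqrt M * normL2 (u - p))).
    rewrite /normL2 -/(normsq _) -sqrtrM// ler_sqrt ?HM// mulr_ge0 ?normsq_ge0//.
  apply: (@le_trans _ _ (Num.sqrt M * (x / (Num.sqrt M + 1))));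
      first exact: ler_wpM2l.
  rewrite mulrCA ler_piMr ?(ltW x0)// ler_pdivrMr ?ltr_wpDl// mul1r lerDl//.
Qed.

(** The column removed by one step of Cholesky elimination with pivot [e]. If [qform P e = 0], the
    inverse is [0] by convention, and [P e = 0] as well for a positive [P], so that nothing is
    removed. *)
Definition chol_vec P e : L2 mu := ((Num.sqrt (qform P e))^-1)%:C%C *: P e.

Definition chol_step P e u : L2 mu := P u - dotL2 u (chol_vec P e) *: chol_vec P e.

Lemma qform_chol_step P e u :
  qform (chol_step P e) u = qform P u - normc (dotL2 u (chol_vec P e)) ^+ 2.
Proof.
rewrite /qform /chol_step dotL2Bl dotL2Zl (dotL2C u (chol_vec _ _)) mulc_conjc.
by rewrite ReD ReN.
Qed.

(** Cauchy-Schwarz for the form of [P]. It is what keeps the Schur complement [chol_step P e]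
    positive. *)
Lemma dot_chol_vec_le P e u : psd_op P ->
  normc (dotL2 u (chol_vec P e)) ^+ 2 <= qform P u.
Proof.
move=> psdP; rewrite /chol_vec dotL2Zr conjc_real normc_sqM normc_real_sq.
have [q0|qN0] := eqVneq (qform P e) 0.
  by rewrite q0 sqrtr0 invr0 expr0n mul0r qform_ge0.
have qp : 0 < qform P e by rewrite lt_neqAle eq_sym qN0 qform_ge0.
have -> : (Num.sqrt (qform P e))^-1 ^+ 2 = (qform P e)^-1.
  by rewrite exprVn sqr_sqrtr// ltW.
rewrite mulrC ler_pdivrMr// mulrC dotL2C normc_conjc.
exact: psd_op_cauchy_schwarz.
Qed.

Lemma chol_step_psd P e : psd_op P -> psd_op (chol_step P e).
Proof.
move=> psdP; have [lin [M HM] pos] := psdP; split.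
- move=> a u v; rewrite /chol_step lin dotL2_linl scalerDl -scalerA scalerBr.
  by rewrite opprD addrACA.
- set g := chol_vec P e; exists (M + normL2 g ^+ 2) => u.
  rewrite /chol_step (le_trans (normL2_triangle _ _))// normL2N normL2Z mulrDl.
  rewrite lerD// expr2 [leRHS]mulrAC ler_wpM2r ?normL2_ge0//.
  by rewrite mulrC dotL2_cauchy_schwarz.
- move=> u; apply/ge0_complex; split.
    by rewrite -/(qform _ _) qform_chol_step subr_ge0 dot_chol_vec_le.
  rewrite /chol_step dotL2Bl dotL2Zl (dotL2C u (chol_vec _ _)) mulc_conjc.
  by rewrite psd_op_self// ImD ImN/= subrr.
Qed.

Lemma chol_step_kill P e : psd_op P -> chol_step P e e = 0.
Proof.
move=> psdP; rewrite /chol_step /chol_vec.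
have [q0|qN0] := eqVneq (qform P e) 0.
  by rewrite (psd_op_eq0 psdP q0) !scaler0 subrr.
have qp : 0 < qform P e by rewrite lt_neqAle eq_sym qN0 qform_ge0.
rewrite dotL2Zr conjc_real -psd_op_sym// psd_op_self// scalerA.
rewrite (_ : _ * _ = 1) ?scale1r ?subrr//.
rewrite -!rmorphM mulrAC -expr2 exprVn sqr_sqrtr ?ltW// mulVf// rmorph1.
Qed.

(** By symmetry [<f, P e> = <P f, e> = 0], so later pivots do not disturb the vectors already
    eliminated. *)
Lemma chol_step_kill_old P e f : psd_op P -> P f = 0 -> chol_step P e f = 0.
Proof.
move=> psdP f0; rewrite /chol_step f0 /chol_vec dotL2Zr -psd_op_sym//.
by rewrite f0 dotL20l mulr0 scale0r subrr.
Qed.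

Fixpoint chol_residual P (e : nat -> L2 mu) n : L2 mu -> L2 mu :=
  if n is k.+1 then chol_step (chol_residual P e k) (e k) else P.

Definition chol P (e : nat -> L2 mu) n : L2 mu :=
    chol_vec (chol_residual P e n) (e n).

Lemma chol_residual_psd P e n : psd_op P -> psd_op (chol_residual P e n).
Proof. by move=> ?; elim: n => //= n; exact: chol_step_psd. Qed.

Lemma qform_chol_residual P e n u : qform (chol_residual P e n) u =
  qform P u - \sum_(0 <= k < n) normc (dotL2 u (chol P e k)) ^+ 2.
Proof.
elim: n => [|n IH] /=; first by rewrite big_geq// subr0.
by rewrite qform_chol_step IH big_nat_recr//= opprD addrA.
Qed.

Lemma chol_residual_kill P e n k : psd_op P -> (k < n)%N ->
  chol_residual P e n (e k) = 0.
Proof.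
move=> psdP; elim: n => // n IH; rewrite ltnS leq_eqVlt => /predU1P[->|kn] /=.
  exact/chol_step_kill/chol_residual_psd.
by apply: chol_step_kill_old; [exact: chol_residual_psd|exact: IH].
Qed.

(* [e] enumerates a countable part of [onb] carrying the whole trace. *)
Lemma trace_enumeration P (t : R) : psd_op P -> optrace P = t%:E ->
  exists e : nat -> L2 mu, forall x, 0 < x -> exists N,
    forall n, (N <= n)%N -> (optrace (chol_residual P e n) <= x%:E)%E.
Proof.
move=> psdP trP.
have q0 e : (0 <= (qform P e)%:E)%E by rewrite lee_fin qform_ge0.
have /choice[A HA] : forall m : nat, exists A : set (L2 mu), [/\ finite_set A,
    A `<=` @onb _ _ _ mu & ((t - m.+1%:R^-1)%:E < \sum_(i \in A) (qform P i)%:E)%E].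
  move=> m; have m0 : 0 < m.+1%:R^-1 :> R by rewrite invr_gt0.
  have : ((t - m.+1%:R^-1)%:E < optrace P)%E by rewrite trP lte_fin ltrBlDr ltrDl.
  by move=> /ereal_sup_gt[_ [B [finB BS] <-] ltB]; exists B.
have cA : countable (\bigcup_m A m).
  apply: bigcup_countable => // m _; apply: finite_set_countable.
  by case: (HA m).
have /countable_injP[f finj] := cA.
(* Numbers not attained by [f] receive the pivot [0], along which elimination changes nothing. *)
pose e n := xget 0 [set b | (\bigcup_m A m) b /\ f b = n].
have ef b : (\bigcup_m A m) b -> e (f b) = b.
  move=> Ab; rewrite /e; case: xgetP => [c _ [Ac fc]|/(_ b)].
    by apply: finj => //; rewrite inE.
  by move=> /= /not_andP[].
exists e => x x0.
have [m Hm] : exists m : nat, m.+1%:R^-1 <= x.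
  exists (Num.truncn x^-1); rewrite -[leRHS]invrK lef_pV2 ?posrE ?invr_gt0//.
  exact: (ltW (truncnS_gt _)).
have [finA AB ltA] := HA m.
pose N := (\max_(b <- finmap.enum_fset (fset_set (A m))) f b).+1%N.
exists N => n Nn; pose Q := chol_residual P e n.
have psdQ : psd_op Q by exact: chol_residual_psd.
have QA b : A m b -> Q b = 0.
  move=> Ab; rewrite /Q -(ef b); last by exists m.
  apply: chol_residual_kill => //; apply: leq_trans Nn; rewrite ltnS.
  rewrite (bigD1_seq b)//= ?leq_maxl ?finmap.fset_uniq//.
  by rewrite in_fset_set// inE.
have Q0 b : (0 <= (qform Q b)%:E)%E by rewrite lee_fin qform_ge0.
(* The residual vanishes on [A m] and lies below [P] elsewhere, so its trace is at most the tail of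
   the trace of [P] outside [A m]. *)
rewrite /optrace (esumID (A m))//.
rewrite esum1 ?add0e; last first.
  by move=> b [_ Ab]; rewrite -/(Q b) QA// dotL20l.
apply: (@le_trans _ _ (\esum_(b in @onb _ _ _ mu `&` ~` A m) (qform P b)%:E)%E).
  apply: le_esum => b _; rewrite lee_fin -/(qform Q b) /Q qform_chol_residual.
  by rewrite gerBl sumr_ge0// => k _; exact: sqr_ge0.
have := trP; rewrite /optrace (esumID (A m))//.
rewrite (_ : _ `&` A m = A m); last by apply/setIidr.
have -> : (\esum_(i in A m) (Re (dotL2 (P i) i))%:E = (\sum_(i \in A m) qform P
    i)%:E)%E.
  by rewrite esum_fset ?fsumEFin// => i _; exact: q0.
move: ltA; rewrite fsumEFin// lte_fin => ltA.
set r := esum _ _; case: r => [r| |]//=; rewrite -EFinD => -[tE].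
  move: tE ltA Hm; rewrite lee_fin.
  move=> <- h kx; rewrite (le_trans _ kx)// ltW//.
  by move: h; rewrite ltrBlDr ltrD2l.
- by move=> i _; exact: q0.
- by move=> i _; exact: Q0.
Qed.

(** Residuals are positive, so partial sums stay below [qform P u]; their traces tend to [0], and by
    [qform_le_trace] so do their forms. The vectors obtained need not be orthogonal. *)
Lemma chol_form_sum P (t : R) : psd_op P -> optrace P = t%:E ->
  exists g : nat -> L2 mu, forall u,
    (qform P u)%:E = (\sum_(k <oo) (normc (dotL2 u (g k)) ^+ 2)%:E)%E.
Proof.
move=> psdP trP; have [e He] := trace_enumeration psdP trP.
exists (chol P e) => u.
have q0 k : (0 <= (normc (dotL2 u (chol P e k)) ^+ 2)%:E)%E.
  by rewrite lee_fin sqr_ge0.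
apply/eqP; rewrite eq_le; apply/andP; split; last first.
  apply: lime_le; first by apply: is_cvg_nneseries => k _ _; exact: q0.
  near=> n; rewrite sumEFin lee_fin -subr_ge0 -qform_chol_residual.
  exact/qform_ge0/chol_residual_psd.
apply/lee_addgt0Pr => x x0.
have x1 : 0 < x / (normsq u + 1) by rewrite divr_gt0// ltr_wpDl ?normsq_ge0.
have [N HN] := He _ x1.
have := qform_le_trace u (chol_residual_psd e N psdP) (HN N (leqnn N)).
rewrite qform_chol_residual lerBlDl => h.
apply: (@le_trans _ _ ((\sum_(0 <= k < N) normc (dotL2 u (chol P e k)) ^+ 2) +
    x)%:E).
  rewrite lee_fin (le_trans h)// lerD2l mulrAC ler_pdivrMr ?ltr_wpDl ?normsq_ge0//.
  by rewrite ler_wpM2l ?ltW// ltrDl.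
rewrite EFinD leeD2r// -sumEFin.
exact: nneseries_lim_ge.
Unshelve. all: by end_near. Qed.

(** Tonelli for the sums over the basis and over [k], then Parseval for each [g k]. The right side
    no longer mentions the basis. *)
Lemma optrace_form_sum P (g : nat -> L2 mu) :
  (forall u, (qform P u)%:E = (\sum_(k <oo) (normc (dotL2 u (g k)) ^+ 2)%:E)%E) ->
  optrace P = (\sum_(k <oo) (normsq (g k))%:E)%E.
Proof.
move=> Pg; have [Borth Btot] := @onb_orthonormal_basis _ T R mu.
have q0 b k : (0 <= (normc (dotL2 b (g k)) ^+ 2)%:E)%E by rewrite lee_fin sqr_ge0.
rewrite /optrace; under eq_esum do rewrite -/(qform P _) Pg.
have n0 k : (0 <= (normsq (g k))%:E)%E by rewrite lee_fin normsq_ge0.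
have gE k : (\esum_(b in @onb _ _ _ mu) (normc (dotL2 b (g k)) ^+ 2)%:E =
    (normsq (g k))%:E)%E.
  rewrite -(parseval Borth Btot); apply: eq_esum => b _.
  by rewrite dotL2C normc_conjc.
apply/eqP; rewrite eq_le; apply/andP; split.
  apply: ge_ereal_sup => _ /= [A [finA AB] <-].
  rewrite fsbig_finite//= -nneseries_sum//.
  apply: lee_nneseries => [k _ _|k _]; first exact: sume_ge0.
  rewrite -gE; apply: esum_ge; exists A => //.
  by rewrite fsbig_finite.
apply: lime_le; first by apply: is_cvg_nneseries.
near=> n; under eq_bigr do rewrite -gE.
rewrite -esum_sum//; apply: le_esum => b _.
exact: nneseries_lim_ge.
Unshelve. all: by end_near. Qed.

End PsdOperators.

(** * The measure of a state and its density *)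

Section IndicatorOperator.
Context d (T : measurableType d) (R : realType) (mu : {measure set T -> \bar R}).
Implicit Types (u v w : L2 mu) (a : R[i]) (P : L2 mu -> L2 mu) (A : set T).

Lemma sqintegrable_mul (h f : T -> R[i]) (M : R) : cmeasurable h ->
  (forall x, normc (h x) <= M) -> sqintegrable mu f ->
  sqintegrable mu (fun x => h x * f x).
Proof.
move=> mh hM sf.
have sM : sqintegrable mu (fun x => M%:C%C * f x).
  have := sqintegrable_lin M%:C%C sf (@sqintegrable0 _ _ _ mu).
  by congr sqintegrable; apply/funext => x; rewrite addr0.
apply: (sqintegrable_le _ sM); first by apply: cmeasurableM => //; exact: sf.1.
move=> x; rewrite !normcM ler_wpM2r ?normc_ge0// (le_trans (hM x))//.
by rewrite /= expr0n addr0 sqrtr_sqr ler_norm.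
Qed.

Lemma normc_indic A x : normc ((\1_A x : R)%:C)%C <= 1.
Proof.
rewrite /= expr0n addr0 sqrtr_sqr indicE; case: (x \in A) => /=.
  by rewrite normr1.
by rewrite normr0.
Qed.

Lemma sqintegrable_indic_repr A u : measurable A ->
  sqintegrable mu (fun x => ((\1_A x : R)%:C)%C * repr u x).
Proof.
move=> mA; apply: (@sqintegrable_mul (fun x => ((\1_A x : R)%:C)%C) _ 1).
- exact: cmeasurable_indic.
- exact: normc_indic.
- exact: repr_sqintegrable.
Qed.

Lemma repr_chi A u : measurable A ->
  {ae mu, forall x, repr (chi A u) x = ((\1_A x : R)%:C)%C * repr u x}.
Proof. by move=> mA; apply: repr_L2class; exact: sqintegrable_indic_repr. Qed.

Lemma chiI A B u : measurable A -> measurable B ->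
  chi A (chi B u) = chi (A `&` B) u.
Proof.
move=> mA mB; have mAB : measurable (A `&` B) by exact: measurableI.
apply: L2eq; apply: filterS2 (filterI (repr_chi (chi B u) mA) (repr_chi u mB))
  (repr_chi u mAB).
move=> x [-> ->] ->; rewrite mulrA indicI; congr (_ * _).
by apply: complexP; rewrite !reimE/=; ring.
Qed.

Lemma dot_chi A u v : measurable A -> dotL2 (chi A u) v = dotL2 u (chi A v).
Proof.
move=> mA; apply: ae_cintegral.
- by apply: cmeasurableM; [|apply: cmeasurable_conjc]; exact: repr_cmeasurable.
- by apply: cmeasurableM; [|apply: cmeasurable_conjc]; exact: repr_cmeasurable.
apply: filterS2 (repr_chi u mA) (repr_chi v mA) => x -> ->.
by rewrite conjcM conjc_real; ring.
Qed.

Lemma normsq_chi A u : measurable A ->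
  (normsq (chi A u))%:E = (\int[mu]_(x in A) (normc (repr u x) ^+ 2)%:E)%E.
Proof.
move=> mA; rewrite normsq_class; last exact: sqintegrable_indic_repr.
rewrite [RHS]integral_mkcond; apply: eq_integral => x _.
rewrite patchE indicE; case: (x \in A) => /=; first by rewrite mul1r.
by rewrite mul0r normc0 expr0n.
Qed.

(** Multiplication by an indicator is self-adjoint, so the compressed operator is the sum of the
    rank one operators of the vectors [chi A (g k)]. *)
Lemma nu_op_form_sum P (g : nat -> L2 mu) A : measurable A ->
  (forall u, (qform P u)%:E = (\sum_(k <oo) (normc (dotL2 u (g k)) ^+ 2)%:E)%E) ->
  nu_op P A = (\sum_(k <oo) (normsq (chi A (g k)))%:E)%E.
Proof.
move=> mA Pg; apply: optrace_form_sum => u.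
rewrite /qform -[(chi A \o P \o chi A) u]/(chi A (P (chi A u))) dot_chi//
    -/(qform P _) Pg.
by apply: eq_eseriesr => k _; rewrite dot_chi.
Qed.

End IndicatorOperator.

Section IntegralSetFunction.
Import HBNNSimple.
Context d (T : measurableType d) (R : realType).

(* [nu_op P] is a measure on the measurable sets only, and so not a measure. *)
Lemma eq_setfun_integral (m1 m2 : set T -> \bar R) (f : T -> \bar R) :
  (forall A, measurable A -> m1 A = m2 A) ->
  (\int[m1]_x f x = \int[m2]_x f x)%E.
Proof.
move=> m12; rewrite /integral.
congr (_ - _)%E; congr ereal_sup; apply/seteqP; split=> _ [g gh <-];
  exists g => //; rewrite /sintegral; apply: eq_fsbigr => x _;
  rewrite m12// -[X in measurable X]setTI; exact: (@measurable_funP _ _ _ _ g).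
Qed.

End IntegralSetFunction.

Lemma measurable_lne (R : realType) : measurable_fun setT (@lne R).
Proof.
have -> : @lne R = fun x => if x == +oo%E then +oo%E else
    if (x <= 0)%E then -oo%E else (ln (fine x))%:E.
  by apply/funext => -[r| |] //=; rewrite ?lee_fin ?leNye.
apply: measurable_fun_ifT => //=.
  apply: (measurable_fun_bool true).
  rewrite setTI (_ : _ @^-1` _ = [set +oo%E])//.
  by apply/seteqP; split=> x /=; [move/eqP|move=> ->].
apply: measurable_fun_ifT => //=.
  apply: (measurable_fun_bool true).
  rewrite setTI (_ : _ @^-1` _ = [set x | x <= 0]%E)//.
  rewrite (_ : [set x | _] = [set` `]-oo, (0 : \bar R)]]).
    exact: emeasurable_itv.
  by apply/seteqP; split=> x; rewrite /= in_itv.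
apply/measurable_EFinP; apply: (measurableT_comp (@measurable_ln R)).
exact: fine_measurable.
Qed.

Section Density.
Context d (T : measurableType d) (R : realType).
Variables (mu : {sigma_finite_measure set T -> \bar R}) (P : L2 mu -> L2 mu).
Local Open Scope charge_scope.

Variable g : nat -> L2 mu.
Hypothesis Pg : forall u,
  (qform P u)%:E = (\sum_(k <oo) (normc (dotL2 u (g k)) ^+ 2)%:E)%E.
Hypothesis gfin : (\sum_(k <oo) (normsq (g k))%:E < +oo)%E.

Let p0 x : \bar R := (\sum_(k <oo) (normc (repr (g k) x) ^+ 2)%:E)%E.

Let p0_ge0 x : (0 <= p0 x)%E.
Proof. by apply: nneseries_ge0 => k _ _; rewrite lee_fin sqr_ge0. Qed.

Let mp0 : measurable_fun setT p0.
Proof.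
apply: (ge0_emeasurable_sum (P := xpredT)).
  by move=> k x _ _; rewrite lee_fin sqr_ge0.
by move=> k _; apply: measurable_normcX2; exact: repr_cmeasurable.
Qed.

Lemma nu_op_integral A : measurable A -> nu_op P A = (\int[mu]_(x in A) p0 x)%E.
Proof.
move=> mA; rewrite (nu_op_form_sum mA Pg) integral_nneseries//.
- by apply: eq_eseriesr => k _; rewrite normsq_chi.
- move=> k; apply: measurable_funTS; apply: measurable_normcX2.
  exact: repr_cmeasurable.
- by move=> k x _; rewrite lee_fin sqr_ge0.
Qed.

Let ip0 : mu.-integrable setT p0.
Proof.
apply/integrableP; split=> //.
under eq_integral do rewrite gee0_abs ?p0_ge0//.
rewrite integral_nneseries//.
- by under eq_eseriesr do rewrite -normsqE.
- by move=> k; apply: measurable_normcX2; exact: repr_cmeasurable.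
- by move=> k x _; rewrite lee_fin sqr_ge0.
Qed.

(** The charge with density [p0] agrees with [nu_op P] on measurable sets, so the choice in
    [charge_of_setfun] does not fall back on the zero charge. *)
Lemma charge_of_nu_op A : measurable A -> charge_of_setfun (nu_op P) A = nu_op P A.
Proof.
rewrite /charge_of_setfun /chooseor; case: pselect => [h|]; last first.
  case; exists (induced_charge ip0) => B mB; rewrite nu_op_integral//.
by move=> mA; case: (cid h) => c /= ->.
Qed.

Lemma density_dominates : charge_of_setfun (nu_op P) `<< mu.
Proof.
apply/null_content_dominatesP => A mA A0.
by rewrite charge_of_nu_op// nu_op_integral// null_set_integral//;
    exact: measurable_funTS.
Qed.

Lemma density_ae : ae_eq mu setT (density P) p0.
Proof.
have dom := density_dominates.
apply: integral_ae_eq => //; first exact: Radon_Nikodym_integrable.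
move=> E _ mE; rewrite -nu_op_integral// -charge_of_nu_op//.
by rewrite /density -Radon_Nikodym_integral.
Qed.

(** A finite valued version of the density: [fine] replaces the value [+oo], taken only on a null
    set, by [0]. *)
Definition rdensity x : R := fine (p0 x).

Lemma rdensity_ge0 x : 0 <= rdensity x.
Proof. exact: fine_ge0. Qed.

Lemma measurable_rdensity : measurable_fun setT rdensity.
Proof. by apply: (measurableT_comp _ mp0); exact: fine_measurable. Qed.

Lemma rdensity_ae : ae_eq mu setT (EFin \o rdensity) p0.
Proof.
have := integrable_ae measurableT ip0.
by apply: filterS => x h /h pf; rewrite /= /rdensity fineK.
Qed.

Lemma integral_rdensity A : measurable A ->
  nu_op P A = (\int[mu]_(x in A) (rdensity x)%:E)%E.
Proof.
move=> mA; rewrite nu_op_integral//; apply: ge0_ae_eq_integral => //.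
- exact: measurable_funTS.
- by apply: measurable_funTS; apply/measurable_EFinP; exact: measurable_rdensity.
- by move=> x _; rewrite lee_fin rdensity_ge0.
- by apply: filterS rdensity_ae => x h _; rewrite -(h I).
Qed.

(** The induced charge is packed as a finite measure [m] that agrees with [nu_op P] on measurable
    sets. Change of variables applies to [m], and its Radon-Nikodym derivative is [p0] almost
    everywhere. *)
Lemma integral_nu_op (h : T -> \bar R) : measurable_fun setT h ->
  (forall x, 0 <= h x)%E ->
  (\int[nu_op P]_x h x = \int[mu]_x (h x * p0 x))%E.
Proof.
move=> mh h0.
have nu0 A : (0 <= induced_charge ip0 A)%E by apply: integral_ge0 => x _.
pose m0 := measure_of_charge (induced_charge ip0) nu0.
have m0fin : fin_num_fun m0.
  by move=> A mA; rewrite /m0 /measure_of_charge; exact: fin_num_measure.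
pose mfin := Measure_isFinite.Build _ _ _ m0 m0fin.
pose m : {finite_measure set T -> \bar R} := HB.pack (measure_of_charge
    (induced_charge ip0) nu0) mfin.
have mdom : m `<< mu.
  apply/null_content_dominatesP => A mA A0.
  by rewrite /m /= /m0 /measure_of_charge /induced_charge null_set_integral//;
      exact: measurable_funTS.
rewrite (@eq_setfun_integral _ _ _ _ m); last first.
  by move=> A mA; rewrite nu_op_integral.
rewrite -(Radon_Nikodym_SigmaFinite.change_of_variables mdom h0 measurableT mh).
apply: ae_eq_integral => //.
- apply: emeasurable_funM => //.
  exact: measurable_int (Radon_Nikodym_SigmaFinite.f_integrable mdom).
- exact: emeasurable_funM.
apply: ae_eqe_mul2l; apply: integral_ae_eq => //.
  exact: (Radon_Nikodym_SigmaFinite.f_integrable mdom).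
by move=> E _ mE; rewrite -Radon_Nikodym_SigmaFinite.f_integral.
Qed.

Let mlne : measurable_fun setT (fun x => lne (density P x)).
Proof.
apply: (measurableT_comp (@measurable_lne R)).
by apply: measurable_int; exact: (Radon_Nikodym_integrable density_dominates).
Qed.

Lemma entropy_posE : entropy_pos P =
  (\int[mu]_x (rdensity x * Num.max 0 (- ln (rdensity x)))%:E)%E.
Proof.
rewrite /entropy_pos integral_nu_op; last 2 first.
- by apply: measurable_funepos; apply: measurableT_comp.
- by move=> x; exact: funepos_ge0.
apply: ae_eq_integral => //.
- apply: emeasurable_funM => //.
  by apply: measurable_funepos; apply: measurableT_comp.
- apply/measurable_EFinP; apply: measurable_funM; first exact: measurable_rdensity.
  apply: measurable_maxr => //; apply: measurable_funN.
  by apply: (measurableT_comp (@measurable_ln R)); exact: measurable_rdensity.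
apply: filterS2 density_ae rdensity_ae => x dx rx _.
rewrite funeposE (dx I) -(rx I) /=; have := rdensity_ge0 x.
(* The convention [0 ln 0 = 0]: where the density vanishes, the infinite value of the logarithm is
   multiplied by [0]. *)
rewrite le_eqVlt => /predU1P[<-|r0]; first by rewrite mul0r mule0.
by rewrite leNgt r0 /= -EFin_max -EFinM mulrC maxC.
Qed.

Lemma entropy_negE : entropy_neg P =
  (\int[mu]_x (rdensity x * Num.max 0 (ln (rdensity x)))%:E)%E.
Proof.
rewrite /entropy_neg integral_nu_op; last 2 first.
- by apply: measurable_funeneg; apply: measurableT_comp.
- by move=> x; exact: funeneg_ge0.
apply: ae_eq_integral => //.
- apply: emeasurable_funM => //.
  by apply: measurable_funeneg; apply: measurableT_comp.
- apply/measurable_EFinP; apply: measurable_funM; first exact: measurable_rdensity.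
  apply: measurable_maxr => //.
  by apply: (measurableT_comp (@measurable_ln R)); exact: measurable_rdensity.
apply: filterS2 density_ae rdensity_ae => x dx rx _.
rewrite funenegE (dx I) -(rx I) /= oppeK; have := rdensity_ge0 x.
rewrite le_eqVlt => /predU1P[<-|r0]; first by rewrite mul0r mule0.
by rewrite leNgt r0 /= -EFin_max -EFinM mulrC maxC.
Qed.

Lemma entropyE : entropy P = (- (entropy_neg P - entropy_pos P))%E.
Proof.
have nu0 A : (0 <= induced_charge ip0 A)%E by apply: integral_ge0 => x _.
pose m := measure_of_charge (induced_charge ip0) nu0.
have mE A : measurable A -> nu_op P A = m A by exact: nu_op_integral.
rewrite /entropy /entropy_neg /entropy_pos !(eq_setfun_integral _ mE) integralE.
congr (- (_ - _))%E.
  by congr (integral _ _ _); apply/funext => x; rewrite funeposE funenegE oppeK.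
by congr (integral _ _ _); apply/funext => x; rewrite funeposE funenegE.
Qed.

End Density.

(** * Dirichlet integrals *)

Section DirichletIntegral.
Context {R : realType}.
Local Notation leb := (@lebesgue_measure R).
Implicit Types (s t u c x : R).

Lemma integral_FTCy (f F : R -> R) (l : R) :
  (forall x, is_derive x 1 F (f x)) -> (forall x, 0 <= x -> 0 <= f x) ->
  continuous f -> F x @[x --> +oo] --> l ->
  (\int[leb]_(x in `[0%R, +oo[) (f x)%:E = (l - F 0)%:E)%E.
Proof.
move=> dF f0 cf Fl; rewrite EFinB; apply: ge0_continuous_FTC2y => //.
- exact: continuous_subspaceT.
- apply: cvg_at_right_filter.
  by apply: differentiable_continuous; apply/derivable1_diffP.
- by move=> x _; rewrite derive1E derive_val.
Qed.

Lemma is_derive_scale c x : is_derive x 1 (fun y => c * y) c.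
Proof.
rewrite (_ : (fun y => c * y) = c \*: id)//.
by apply: is_derive_eq; rewrite /GRing.scale/= mulr1.
Qed.

Lemma is_derive_expR_scale c x :
  is_derive x 1 (fun y => expR (c * y)) (c * expR (c * x)).
Proof.
have := @is_derive1_comp _ expR (fun y => c * y) x _ _ (is_derive_expR (c * x))
  (is_derive_scale c x).
by rewrite mulrC.
Qed.

Lemma is_derive_cos_scale c x :
  is_derive x 1 (fun y => cos (c * y)) (- (c * sin (c * x))).
Proof.
have := @is_derive1_comp _ cos (fun y => c * y) x _ _ (is_derive_cos (c * x))
  (is_derive_scale c x).
by rewrite mulNr mulrC.
Qed.

Lemma is_derive_sin_scale c x :
  is_derive x 1 (fun y => sin (c * y)) (c * cos (c * x)).
Proof.
have := @is_derive1_comp _ sin (fun y => c * y) x _ _ (is_derive_sin (c * x))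
  (is_derive_scale c x).
by rewrite mulrC.
Qed.

Lemma continuous_scale c : continuous (fun y : R => c * y).
Proof. by move=> x; apply: cvgM; [exact: cvg_cst|exact: cvg_id]. Qed.

Lemma continuous_expR_scale c : continuous (fun y : R => expR (c * y)).
Proof.
move=> x; apply: (continuous_comp (@continuous_scale c x)).
exact: continuous_expR.
Qed.

Lemma continuous_cos_scale c : continuous (fun y : R => cos (c * y)).
Proof.
move=> x; apply: (continuous_comp (@continuous_scale c x)).
exact: continuous_cos.
Qed.

Lemma continuous_sin_scale c : continuous (fun y : R => sin (c * y)).
Proof.
move=> x; apply: (continuous_comp (@continuous_scale c x)).
exact: continuous_sin.
Qed.

(** Since [expR (t x)] is at least [(t x)^2 / 2], linear growth is beaten with a factor [1 / x] to
    spare. *)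
Lemma cvg_bounded_expR (f : R -> R) (M t : R) : 0 < t ->
  (forall x, 0 <= x -> `|f x| <= M + M * x) ->
  f x * expR (- t * x) @[x --> +oo] --> 0.
Proof.
move=> t0 fM; have M0 : 0 <= M.
  by have := fM 0 (lexx 0); rewrite mulr0 addr0; apply: le_trans.
have key x : 1 <= x -> `|f x * expR (- t * x)| <= 4 * M / t ^+ 2 * x^-1.
  move=> x1; have x0 : 0 < x by lra.
  rewrite normrM (ger0_norm (expR_ge0 _)) mulNr expRN.
  have e2 := @expR_ge1Dxn R (t * x) 1 (mulr_ge0 (ltW t0) (ltW x0)).
  have fx : `|f x| <= 2 * M * x by apply: (le_trans (fM x (ltW x0))); nra.
  have e3 : (t * x) ^+ 2 / 2 <= expR (t * x).
    by apply: le_trans e2; rewrite (_ : 2`! = 2)%N// lerDr.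
  have tx0 : 0 < (t * x) ^+ 2 / 2 by rewrite divr_gt0// exprn_gt0// mulr_gt0.
  apply: (@le_trans _ _ (2 * M * x / ((t * x) ^+ 2 / 2))).
    apply: ler_pM => //.
    by rewrite lef_pV2// posrE expR_gt0.
  rewrite le_eqVlt; apply/orP; left; apply/eqP; field.
  by rewrite !gt_eqF.
have iv : x^-1 @[x --> +oo] --> (0 : R).
  apply/(gtr0_cvgV0 (f := id)); last exact: cvg_id.
  exact: nbhs_pinfty_gt.
apply: (@squeeze_cvgr _ _ _ _ (fun x => - (4 * M / t ^+ 2 * x^-1))
   (fun x => 4 * M / t ^+ 2 * x^-1)).
- by near=> x; rewrite -ler_norml; apply: key; near: x; exact: nbhs_pinfty_ge.
- rewrite -oppr0; apply: cvgN; rewrite -(mulr0 (4 * M / t ^+ 2)).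
  by apply: cvgM; [exact: cvg_cst|exact: iv].
- rewrite -(mulr0 (4 * M / t ^+ 2)).
  by apply: cvgM; [exact: cvg_cst|exact: iv].
Unshelve. all: by end_near. Qed.

Lemma integral_id_expR t : 0 < t ->
  (\int[leb]_(s in `[0%R, +oo[) (s * expR (- t * s))%:E = (t ^- 2)%:E)%E.
Proof.
move=> t0; have tN0 : t != 0 by rewrite gt_eqF.
pose F s := - (s / t + t ^- 2) * expR (- t * s).
have dF : forall x, is_derive x 1 F (x * expR (- t * x)).
  move=> x.
  have d1 : is_derive x 1 (fun s => - (s / t + t ^- 2)) (- t^-1).
    rewrite (_ : (fun s => _) = (fun s => - t^-1 * s) + cst (- t ^- 2)); last first.
      by apply/funext => y; rewrite /= -[RHS]/(- t^-1 * y - t ^- 2) opprD mulNr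
          (mulrC y).
    have := is_deriveD (is_derive_scale (- t^-1) x) (is_derive_cst (- t ^- 2) x 1).
    by rewrite addr0.
  apply: is_derive_eq (is_deriveM d1 (is_derive_expR_scale (- t) x)) _.
  rewrite /GRing.scale/=; field; exact: tN0.
have f0 : forall x, 0 <= x -> 0 <= x * expR (- t * x).
  by move=> x x0; rewrite mulr_ge0// expR_ge0.
have cf : continuous (fun x : R => x * expR (- t * x)).
  move=> x; apply: cvgM; first exact: cvg_id.
  exact: continuous_expR_scale.
have Fl : F x @[x --> +oo] --> (0 : R).
  apply: (@cvg_bounded_expR _ (t^-1 + t ^- 2)) => // x x0.
  have t2 : 0 <= t ^- 2 by rewrite invr_ge0 exprn_ge0// ltW.
  have t1 : 0 <= t^-1 by rewrite invr_ge0 ltW.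
  rewrite normrN ger0_norm ?addr_ge0 ?divr_ge0 ?(ltW t0)//.
  by have := mulr_ge0 t2 x0; rewrite mulrDl (mulrC x); lra.
rewrite (integral_FTCy dF f0 cf Fl).
by rewrite /F mul0r add0r mulr0 expR0 mulr1 opprK add0r.
Qed.

Lemma integral_one_sub_cos_expR u s : 0 < s ->
  (\int[leb]_(t in `[0%R, +oo[) ((1 - cos (u * t)) * expR (- s * t))%:E =
   (u ^+ 2 / (s * (s ^+ 2 + u ^+ 2)))%:E)%E.
Proof.
move=> s0; have sN0 : s != 0 by rewrite gt_eqF.
have su0 : s ^+ 2 + u ^+ 2 != 0.
  by rewrite gt_eqF// ltr_pwDl ?sqr_ge0// exprn_gt0.
pose G t := - s^-1 + (s ^+ 2 + u ^+ 2)^-1 * (s * cos (u * t) - u * sin (u * t)).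
pose F t := G t * expR (- s * t).
have dF : forall x, is_derive x 1 F ((1 - cos (u * x)) * expR (- s * x)).
  move=> x.
  have d1 : is_derive x 1 G ((s ^+ 2 + u ^+ 2)^-1 *
      (s * (- (u * sin (u * x))) - u * (u * cos (u * x)))).
    rewrite (_ : G = cst (- s^-1) + (s ^+ 2 + u ^+ 2)^-1 \*:
      (s \*: (fun t => cos (u * t)) - u \*: (fun t => sin (u * t))))//.
    have dc := is_deriveZ s (is_derive_cos_scale u x).
    have ds := is_deriveZ u (is_derive_sin_scale u x).
    have dz := is_deriveZ (s ^+ 2 + u ^+ 2)^-1 (is_deriveB dc ds).
    have := is_deriveD (is_derive_cst (- s^-1) x 1) dz.
    by rewrite add0r.
  apply: is_derive_eq (is_deriveM d1 (is_derive_expR_scale (- s) x)) _.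
  rewrite /GRing.scale/= /G; field.
  by rewrite sN0 su0.
have f0 : forall x, 0 <= x -> 0 <= (1 - cos (u * x)) * expR (- s * x).
  by move=> x x0; rewrite mulr_ge0 ?expR_ge0// subr_ge0 cos_le1.
have cf : continuous (fun x : R => (1 - cos (u * x)) * expR (- s * x)).
  move=> x; apply: cvgM; last exact: continuous_expR_scale.
  by apply: cvgB; [exact: cvg_cst|exact: continuous_cos_scale].
have Fl : F x @[x --> +oo] --> (0 : R).
  pose M := s^-1 + (s ^+ 2 + u ^+ 2)^-1 * (s + `|u|).
  have d0 : 0 <= (s ^+ 2 + u ^+ 2)^-1.
    by rewrite invr_ge0 addr_ge0 ?sqr_ge0.
  have s1 : 0 <= s^-1 by rewrite invr_ge0 ltW.
  have M0 : 0 <= M by rewrite addr_ge0// mulr_ge0// addr_ge0// ltW.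
  apply: (@cvg_bounded_expR _ M) => // x x0.
  apply: (@le_trans _ _ M); last by rewrite lerDl mulr_ge0.
  rewrite /G (le_trans (ler_normD _ _))// normrN ger0_norm// lerD2l.
  rewrite normrM (ger0_norm d0) ler_wpM2l// (le_trans (ler_normB _ _))//.
  by rewrite !normrM (gtr0_norm s0) lerD// ler_piMr ?(ltW s0)// ?cos_max ?sin_max.
rewrite (integral_FTCy dF f0 cf Fl).
congr EFin; rewrite /F /G !mulr0 cos0 sin0 expR0; field.
by rewrite sN0 su0.
Qed.

Lemma integral_Lorentz u : 0 < u ->
  (\int[leb]_(s in `[0%R, +oo[) (u ^+ 2 / (s ^+ 2 + u ^+ 2))%:E =
   (u * (pi / 2))%:E)%E.
Proof.
move=> u0; have uN0 : u != 0 by rewrite gt_eqF.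
have su0 s : s ^+ 2 + u ^+ 2 != 0.
  by rewrite gt_eqF// ltr_wpDl ?sqr_ge0// exprn_gt0.
pose F s := u * atan (u^-1 * s).
have dF : forall x, is_derive x 1 F (u ^+ 2 / (x ^+ 2 + u ^+ 2)).
  move=> x; rewrite (_ : F = u \*: (fun s => atan (u^-1 * s)))//.
  have dc := @is_derive1_comp _ atan (fun y => u^-1 * y) x _ _
    (is_derive1_atan (u^-1 * x)) (is_derive_scale u^-1 x).
  apply: is_derive_eq (is_deriveZ u dc) _.
  rewrite /GRing.scale/=; field.
  by rewrite su0 uN0.
have f0 : forall x, 0 <= x -> 0 <= u ^+ 2 / (x ^+ 2 + u ^+ 2).
  by move=> x x0; rewrite divr_ge0 ?addr_ge0 ?sqr_ge0.
have cf : continuous (fun x : R => u ^+ 2 / (x ^+ 2 + u ^+ 2)).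
  move=> x; apply: cvgM; first exact: cvg_cst.
  apply: cvgV => //; apply: cvgD; last exact: cvg_cst.
  exact: exprn_continuous.
have Fl : F x @[x --> +oo] --> (u * (pi / 2) : R).
  apply: cvgM; first exact: cvg_cst.
  apply: (@cvg_comp _ _ _ (fun s => u^-1 * s) atan _ (pinfty_nbhs R));
      last exact: cvgy_atan.
  by apply: gt0_cvgMry; [rewrite invr_gt0|exact: cvg_id].
rewrite (integral_FTCy dF f0 cf Fl).
by rewrite /F mulr0 atan0 mulr0 subr0.
Qed.

(* Write [1/t^2] as the integral of [s exp(-s|t|)] over [s > 0] and swap. *)
Lemma integral_one_sub_cos u :
  (\int[leb]_t ((1 - cos (u * t)) / t ^+ 2)%:E = (pi * `|u|)%:E)%E.
Proof.
have [->|uN0] := eqVneq u 0.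
  rewrite normr0 mulr0; apply: integral0_eq => t _.
  by rewrite mul0r cos0 subrr mul0r.
have u0 : 0 < `|u| by rewrite normr_gt0.
pose A : set R := `]0%R, +oo[%classic.
have mA : measurable A by exact: measurable_itv.
pose k (p : R * R) := \1_A p.1 *
  (p.1 * ((1 - cos (u * p.2)) * expR (- p.1 * `|p.2|))).
have Apos (s : R) : 0 <= (\1_A s : R) * s.
  rewrite indicE; have [As|As] := boolP (s \in A); last by rewrite mul0r.
  by move: As; rewrite inE /A/= in_itv/= andbT mul1r => /ltW.
have k0 p : (0 <= (k p)%:E)%E.
  rewrite lee_fin /k mulrA; apply: mulr_ge0; first exact: Apos.
  by rewrite mulr_ge0 ?expR_ge0// subr_ge0 cos_le1.
have mk : measurable_fun setT (EFin \o k).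
  apply/measurable_EFinP; apply: measurable_funM.
    apply: (measurableT_comp (measurable_indic _)) => //.
  apply: measurable_funM => //; apply: measurable_funM.
    apply: measurable_funB => //.
    apply: (measurableT_comp (continuous_measurable_fun (@continuous_cos_scale u))).
    exact: measurable_snd.
  apply: measurableT_comp; first exact: measurable_expR.
  apply: measurable_funM.
    by apply: measurableT_comp => //.
  by apply: measurableT_comp => //.
have := fubini_tonelli (m1 := leb) (m2 := leb) (EFin \o k) mk k0.
have -> : (\int[leb]_s \int[leb]_t (EFin \o k) (s, t) = (pi * `|u|)%:E)%E.
  (* The factor [2] comes from the evenness in [t]: the elementary integral is known on the
     half-line only. *)
  transitivity (\int[leb]_(s in A) (2 * (u ^+ 2 / (s ^+ 2 + u ^+ 2)))%:E)%E.
    rewrite [RHS]integral_mkcond; apply: eq_integral => s _.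
    rewrite patchE; have [As|As] := boolP (s \in A); last first.
      by apply: integral0_eq => t _; rewrite /k/= indicE (negbTE As) mul0r.
    have s0 : 0 < s by move: As; rewrite inE /A/= in_itv/= andbT.
    transitivity (\int[leb]_t (s%:E * ((1 - cos (u * t)) * expR (- s *
        `|t|))%:E))%E.
      by apply: eq_integral => t _; rewrite /k/= indicE As mul1r EFinM.
    have ce : continuous (fun t : R => (1 - cos (u * t)) * expR (- s * `|t|)).
      move=> t; apply: cvgM.
        by apply: cvgB; [exact: cvg_cst|exact: continuous_cos_scale].
      apply: (@continuous_comp _ _ _ (@Num.norm R R) (fun x => expR (- s * x))).
        exact: norm_continuous.
      exact: continuous_expR_scale.
    have me := continuous_measurable_fun ce; have /measurable_EFinP me' := me.
    have e0 t : setT t -> (0 <= ((1 - cos (u * t)) * expR (- s * `|t|))%:E)%E.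
      by move=> _; rewrite lee_fin mulr_ge0 ?expR_ge0// subr_ge0 cos_le1.
    rewrite ge0_integralZl_EFin ?(ltW s0)//.
    have e1 t : 0 <= (1 - cos (u * t)) * expR (- s * `|t|).
      by rewrite mulr_ge0 ?expR_ge0// subr_ge0 cos_le1.
    have e2 : (fun t => (1 - cos (u * t)) * expR (- s * `|t|)) =1
        (fun t => (1 - cos (u * t)) * expR (- s * `|t|)) \o -%R.
      by move=> t; rewrite /= mulrN cosN normrN.
    rewrite (ge0_symfun_integralT e1 ce e2).
    rewrite -set_itvcy.
    have -> : (\int[leb]_(x in `[0%R, +oo[)
        ((1 - cos (u * x)) * expR (- s * `|x|))%:E =
        (u ^+ 2 / (s * (s ^+ 2 + u ^+ 2)))%:E)%E.
      rewrite -(integral_one_sub_cos_expR u s0); apply: eq_integral => t.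
      by rewrite inE/= in_itv/= andbT => t0; rewrite ger0_norm.
    rewrite -!EFinM; congr EFin; field.
    by rewrite !gt_eqF ?ltr_pwDl ?sqr_ge0// exprn_gt0.
  rewrite /A integral_itv_obnd_cbnd; last first.
    apply/measurable_EFinP; apply: measurable_funM => //.
    apply: measurable_funM => //; apply: measurable_funTS.
    apply: continuous_measurable_fun => x.
    apply: cvgV; first by rewrite gt_eqF// ltr_wpDl ?sqr_ge0// exprn_even_gt0.
    by apply: cvgD; [exact: exprn_continuous|exact: cvg_cst].
  under eq_integral do rewrite EFinM -(real_normK (num_real u)).
  have mL : measurable_fun (`[0%R, +oo[%classic : set R)
      (fun s : R => (`|u| ^+ 2 / (s ^+ 2 + `|u| ^+ 2))%:E).
    apply/measurable_EFinP; apply: measurable_funM => //; apply: measurable_funTS.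
    apply: continuous_measurable_fun => x.
    apply: cvgV; first by rewrite gt_eqF// ltr_wpDl ?sqr_ge0// exprn_gt0.
    by apply: cvgD; [exact: exprn_continuous|exact: cvg_cst].
  rewrite ge0_integralZl_EFin//; last first.
    by move=> x _; rewrite lee_fin divr_ge0 ?addr_ge0 ?sqr_ge0.
  by rewrite integral_Lorentz// -EFinM; congr EFin; field.
move=> ->; apply: eq_integral => t _.
have [->|tN0] := eqVneq t 0.
  rewrite expr0n/= invr0 mulr0; apply/esym/integral0_eq => s _.
  by rewrite /k/= mulr0 cos0 subrr mul0r !mulr0.
have t0 : 0 < `|t| by rewrite normr_gt0.
have ct : 0 <= 1 - cos (u * t) by rewrite subr_ge0 cos_le1.
transitivity (\int[leb]_(s in A)
  ((1 - cos (u * t))%:E * (s * expR (- `|t| * s))%:E))%E; last first.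
  rewrite integral_mkcond; apply: eq_integral => s _.
  rewrite patchE /k/= indicE; case: (s \in A) => /=; last by rewrite mul0r.
  by rewrite -EFinM mul1r mulrCA !mulNr (mulrC s `|t|).
have mF (D : set R) : measurable_fun D (fun s : R => (s * expR (- `|t| * s))%:E).
  apply/measurable_EFinP; apply: measurable_funTS.
  apply: measurable_funM => //; apply: continuous_measurable_fun.
  exact: continuous_expR_scale.
rewrite ge0_integralZl_EFin//; last 2 first.
- move=> s; rewrite /A/= in_itv/= andbT => s0.
  by rewrite lee_fin mulr_ge0 ?expR_ge0// ltW.
- exact: mF.
rewrite /A integral_itv_obnd_cbnd; last exact: mF.
by rewrite integral_id_expR// -EFinM real_normK ?num_real.
Qed.

(** Reflection preserves Lebesgue measure, so the integral equals its opposite. It removes the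
    imaginary part in [dirichlet_dot]. *)
Lemma integral_odd (f : R -> R) : leb.-integrable setT (EFin \o f) ->
  (forall x, f (- x) = - f x) -> \int[leb]_x f x = 0.
Proof.
move=> fi fN.
have mf : measurable_fun setT (EFin \o f) by exact: measurable_int fi.
have mN : measurable_fun [set: measurableTypeR R] (-%R : _ -> measurableTypeR R).
  exact: measurable_funN.
have fiN : leb.-integrable setT (EFin \o f \o (-%R : _ -> measurableTypeR R)).
  rewrite (_ : EFin \o f \o _ = \- (EFin \o f))%E; first exact: integrableN.
  by apply/funext => x; rewrite /= fN EFinN.
have e : (\int[leb]_x (f x)%:E = \int[leb]_x (f (- x))%:E)%E.
  have := @integral_pushforward _ _ _ _ R _ mN leb setT (EFin \o f) mf fiN
      measurableT.
  rewrite preimage_setT => <-; apply: eq_measure_integral => A mA _.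
  by rewrite -[LHS]lebesgue_measureN.
have : \int[leb]_x f x = - \int[leb]_x f x.
  rewrite {1}/Rintegral e; under eq_integral do rewrite fN.
  by rewrite -mulN1r -RintegralZl//; congr fine; apply: eq_integral => x _;
      rewrite mulN1r.
by set I := Rintegral _ _ _; move: I => I h; lra.
Qed.

Section IntervalTransform.
Variables (a b : R).
Hypothesis ab : a <= b.

Lemma Rintegral_FTC (f F : R -> R) : (forall x, is_derive x 1 F (f x)) ->
  continuous f -> \int[leb]_(x in `]a, b]) f x = F b - F a.
Proof.
move=> dF cf; rewrite Rintegral_itv_obnd_cbnd; last first.
  have fi : leb.-integrable `[a, b] (EFin \o f).
    apply: continuous_compact_integrable; first exact: segment_compact.
    exact: continuous_subspaceT.
  by apply: (integrableS _ _ _ fi) => //; exact: subset_itv_oc_cc.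
move: ab; rewrite le_eqVlt => /predU1P[->|ab'].
  by rewrite set_itv1 Rintegral_set1 subrr.
have cF : continuous F.
  by move=> x; apply: differentiable_continuous; apply/derivable1_diffP.
rewrite /Rintegral (@continuous_FTC2 _ f F)//.
- exact: continuous_subspaceT.
- split=> [x _| |]; [exact: ex_derive| |].
  + by apply: cvg_at_right_filter; exact: cF.
  + by apply: cvg_at_left_filter; exact: cF.
- by move=> x _; rewrite derive1E derive_val.
Qed.

Lemma Rintegral_cos t : t != 0 ->
  \int[leb]_(x in `]a, b]) cos (t * x) = (sin (t * b) - sin (t * a)) / t.
Proof.
move=> t0; have dF x : is_derive x 1 (t^-1 \*: (fun x =>
    sin (t * x))) (cos (t * x)).
  apply: is_derive_eq (is_deriveZ t^-1 (is_derive_sin_scale t x)) _.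
  by rewrite /GRing.scale/= mulrA mulVf// mul1r.
rewrite (Rintegral_FTC dF (@continuous_cos_scale t)).
by rewrite mulrBl /GRing.scale/= ![_ / t]mulrC.
Qed.

Lemma Rintegral_sin t : t != 0 ->
  \int[leb]_(x in `]a, b]) sin (t * x) = (cos (t * a) - cos (t * b)) / t.
Proof.
move=> t0; have dF x : is_derive x 1 (- t^-1 \*: (fun x =>
    cos (t * x))) (sin (t * x)).
  apply: is_derive_eq (is_deriveZ (- t^-1) (is_derive_cos_scale t x)) _.
  by rewrite /GRing.scale/= mulrNN mulrA mulVf// mul1r.
rewrite (Rintegral_FTC dF (@continuous_sin_scale t)).
by rewrite -[LHS]/(- t^-1 * cos (t * b) - - t^-1 * cos (t * a)); ring.
Qed.

End IntervalTransform.

End DirichletIntegral.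

(** * Fubini and tensor products for complex valued functions *)

Section ComplexFubini.
Context d1 d2 (T1 : measurableType d1) (T2 : measurableType d2) (R : realType).
Variable m1 : {sigma_finite_measure set T1 -> \bar R}.
Variable m2 : {sigma_finite_measure set T2 -> \bar R}.

Lemma Rintegral_prod12 (h : T1 * T2 -> R) :
  (m1 \x m2)%E.-integrable setT (EFin \o h) ->
  (forall x, m2.-integrable setT (fun y => (h (x, y))%:E)) ->
  \int[m1]_x \int[m2]_y h (x, y) = \int[(m1 \x m2)%E]_p h p.
Proof.
move=> hi hx; rewrite /Rintegral -(integral12_prod_meas1 hi); congr fine.
apply: eq_integral => x _; rewrite fineK//.
exact: (integrable_fin_num measurableT (hx x)).
Qed.

Lemma Rintegral_prod21 (h : T1 * T2 -> R) :
  (m1 \x m2)%E.-integrable setT (EFin \o h) ->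
  (forall y, m1.-integrable setT (fun x => (h (x, y))%:E)) ->
  \int[m2]_y \int[m1]_x h (x, y) = \int[(m1 \x m2)%E]_p h p.
Proof.
move=> hi hy; rewrite /Rintegral -(integral21_prod_meas1 hi); congr fine.
apply: eq_integral => y _; rewrite fineK//.
exact: (integrable_fin_num measurableT (hy y)).
Qed.

Lemma cintegral_prod12 (h : T1 * T2 -> R[i]) : cintegrable (m1 \x m2)%E h ->
  (forall x, cintegrable m2 (fun y => h (x, y))) ->
  cintegral m1 (fun x => cintegral m2 (fun y => h (x, y))) =
  cintegral (m1 \x m2)%E h.
Proof.
move=> [h1 h2] hx; rewrite /cintegral/=; congr Complex.
- by rewrite -(Rintegral_prod12 h1)// => x; case: (hx x).
- by rewrite -(Rintegral_prod12 h2)// => x; case: (hx x).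
Qed.

Lemma cintegral_prod21 (h : T1 * T2 -> R[i]) : cintegrable (m1 \x m2)%E h ->
  (forall y, cintegrable m1 (fun x => h (x, y))) ->
  cintegral m2 (fun y => cintegral m1 (fun x => h (x, y))) =
  cintegral (m1 \x m2)%E h.
Proof.
move=> [h1 h2] hx; rewrite /cintegral/=; congr Complex.
- by rewrite -(Rintegral_prod21 h1)// => x; case: (hx x).
- by rewrite -(Rintegral_prod21 h2)// => x; case: (hx x).
Qed.

Lemma integrable_tensor (a : T1 -> R) (b : T2 -> R) :
  (forall x, 0 <= a x) -> (forall y, 0 <= b y) ->
  m1.-integrable setT (EFin \o a) -> m2.-integrable setT (EFin \o b) ->
  (m1 \x m2)%E.-integrable setT (fun p => (a p.1 * b p.2)%:E).
Proof.
move=> a0 b0 ia ib.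
have ma : measurable_fun setT a by exact/measurable_EFinP/(measurable_int _ ia).
have mb : measurable_fun setT b by exact/measurable_EFinP/(measurable_int _ ib).
apply/integrable12ltyP.
  apply/measurable_EFinP; apply: measurable_funM.
    exact: (measurableT_comp ma measurable_fst).
  exact: (measurableT_comp mb measurable_snd).
have E x : (\int[m2]_y `|(a x * b y)%:E| = (a x)%:E * \int[m2]_y (b y)%:E)%E.
  rewrite -ge0_integralZl_EFin//; last first.
  - exact/measurable_EFinP.
  - by move=> y _; rewrite lee_fin.
  by apply: eq_integral => y _; rewrite gee0_abs ?lee_fin ?mulr_ge0// EFinM.
rewrite /=; under eq_integral do rewrite E.
have fb := integrable_fin_num measurableT ib.
rewrite -(fineK fb) ge0_integralZr//.
- rewrite -(fineK (integrable_fin_num measurableT ia)) -EFinM ltry//.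
- exact/measurable_EFinP.
- by move=> x _; rewrite lee_fin.
- by rewrite lee_fin fine_ge0// integral_ge0// => y _; rewrite lee_fin.
Qed.

Lemma cintegrable_tensor (f : T1 -> R[i]) (g : T2 -> R[i]) :
  cintegrable m1 f -> cintegrable m2 g ->
  cintegrable (m1 \x m2)%E (fun p => f p.1 * g p.2).
Proof.
move=> fi gi; have nf := cintegrable_normc fi; have ng := cintegrable_normc gi.
apply: (cintegrable_bounded _ (integrable_tensor _ _ nf ng)).
- case: fi => /measurable_int/measurable_EFinP f1
    /measurable_int/measurable_EFinP f2.
  case: gi => /measurable_int/measurable_EFinP g1
      /measurable_int/measurable_EFinP g2.
  apply: cmeasurableM; split.
  + exact: (measurableT_comp f1 measurable_fst).
  + exact: (measurableT_comp f2 measurable_fst).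
  + exact: (measurableT_comp g1 measurable_snd).
  + exact: (measurableT_comp g2 measurable_snd).
- by move=> x; exact: normc_ge0.
- by move=> x; exact: normc_ge0.
- by move=> p; rewrite normcM.
Qed.

Lemma cintegrableZ d (T : measurableType d) (mu : {measure set T -> \bar R})
    (z : R[i]) (f : T -> R[i]) :
  cintegrable mu f -> cintegrable mu (fun x => z * f x).
Proof.
move=> fi; have z0 : cintegrable mu (fun _ : T => 0) by split; exact: integrable0.
by have := cintegrable_lin z fi z0; congr cintegrable; apply/funext => x;
    rewrite addr0.
Qed.

Lemma cintegralZ d (T : measurableType d) (mu : {measure set T -> \bar R})
    (z : R[i]) (f : T -> R[i]) :
  cintegrable mu f -> cintegral mu (fun x => z * f x) = z * cintegral mu f.
Proof.
move=> fi; have z0 : cintegrable mu (fun _ : T => 0) by split; exact: integrable0.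
have := cintegral_lin z fi z0.
rewrite (_ : cintegral mu (fun _ => 0) = 0) ?addr0; last first.
  by apply: complexP; rewrite /= /cintegral/= /Rintegral integral0.
by move=> <-; congr cintegral; apply/funext => x; rewrite addr0.
Qed.

Lemma cintegral_tensor (f : T1 -> R[i]) (g : T2 -> R[i]) :
  cintegrable m1 f -> cintegrable m2 g ->
  cintegral (m1 \x m2)%E (fun p => f p.1 * g p.2) = cintegral m1 f * cintegral m2 g.
Proof.
move=> fi gi; rewrite -cintegral_prod12/=.
- rewrite [RHS]mulrC -cintegralZ//; congr cintegral; apply/funext => x.
  by rewrite cintegralZ// mulrC.
- exact: cintegrable_tensor.
- by move=> x; exact: cintegrableZ.
Qed.

Lemma measurable_Rintegral_section (h : T1 * T2 -> R) : measurable_fun setT h ->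
  measurable_fun setT (fun y => \int[m1]_x h (x, y)).
Proof.
move=> mh; apply: measurableT_comp; first exact: fine_measurable.
have mE : measurable_fun setT (EFin \o h) by exact/measurable_EFinP.
rewrite (_ : (fun y => _) = fun y =>
  (\int[m1]_x (EFin \o h)^\+ (x, y) - \int[m1]_x (EFin \o h)^\- (x, y))%E).
  apply: emeasurable_funB.
  - apply: (measurable_fun_fubini_tonelli_G (m1 := m1)) => //.
    exact: measurable_funepos.
  - apply: (measurable_fun_fubini_tonelli_G (m1 := m1)) => //.
    exact: measurable_funeneg.
apply/funext => y; rewrite integralE; congr (_ - _)%E.
- by apply: eq_integral => x _; rewrite !funeposE.
- by apply: eq_integral => x _; rewrite !funenegE.
Qed.

Lemma cmeasurable_cintegral_section (h : T1 * T2 -> R[i]) : cmeasurable h ->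
  cmeasurable (fun y => cintegral m1 (fun x => h (x, y))).
Proof.
move=> [h1 h2]; split.
- exact: (measurable_Rintegral_section (h := fun p => Re (h p))).
- exact: (measurable_Rintegral_section (h := fun p => Im (h p))).
Qed.

End ComplexFubini.

(** * Fourier transforms of boxes *)

Section Mscale.
Context d (T : measurableType d) (R : realType) (m : {measure set T -> \bar R}).
Variable k : {nonneg R}.

Lemma integrable_mscale (f : T -> \bar R) :
  m.-integrable setT f -> (mscale k m).-integrable setT f.
Proof.
move=> /integrableP[mf fi]; apply/integrableP; split => //.
rewrite ge0_integral_mscale//; last exact: measurableT_comp.
by rewrite lte_mul_pinfty// lee_fin.
Qed.

Lemma Rintegral_mscale (f : T -> R) : m.-integrable setT (EFin \o f) ->
  \int[mscale k m]_x f x = k%:num * \int[m]_x f x.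
Proof.
move=> fi; have mf := measurable_int _ fi.
rewrite /Rintegral integralE [in RHS]integralE !ge0_integral_mscale//; last 2 first.
- exact: measurable_funeneg.
- exact: measurable_funepos.
rewrite -muleBr//; first by rewrite fineM// -integralE;
    exact: integrable_fin_num fi.
have h1 := integrable_fin_num measurableT (integrable_funepos measurableT fi).
by rewrite fin_num_adde_defr.
Qed.

Lemma cintegrable_mscale (f : T -> R[i]) :
  cintegrable m f -> cintegrable (mscale k m) f.
Proof. by move=> [f1 f2]; split; exact: integrable_mscale. Qed.

Lemma cintegral_mscale (f : T -> R[i]) : cintegrable m f ->
  cintegral (mscale k m) f = (k%:num)%:C%C * cintegral m f.
Proof.
move=> [f1 f2]; apply: complexP; rewrite !reimE /cintegral/= Rintegral_mscale//.
  by rewrite mul0r subr0.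
by rewrite mul0r addr0.
Qed.

Lemma sqintegrable_mscale (f : T -> R[i]) :
  sqintegrable m f -> sqintegrable (mscale k m) f.
Proof.
move=> [mf fi]; split => //.
rewrite ge0_integral_mscale//; first by rewrite lte_mul_pinfty// lee_fin.
  exact: measurable_normcX2.
by move=> x _; rewrite lee_fin sqr_ge0.
Qed.

End Mscale.

Section TupleProduct.
Context {R : realType}.
Local Notation leb := (@lebesgue_measure R).

Lemma cmeasurable_comp d1 d2 (T1 : measurableType d1) (T2 : measurableType d2)
    (f : T2 -> R[i]) (h : T1 -> T2) :
  measurable_fun setT h -> cmeasurable f -> cmeasurable (f \o h).
Proof.
by move=> mh [f1 f2]; split; [exact: (measurableT_comp f1 mh)|exact:
    (measurableT_comp f2 mh)].
Qed.

Lemma cintegrable_cmeasurable d (T : measurableType d) (m : {measure set T ->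
    \bar R})
  (f : T -> R[i]) : cintegrable m f -> cmeasurable f.
Proof.
by move=> [/measurable_int/measurable_EFinP f1 /measurable_int/measurable_EFinP f2].
Qed.

Lemma cintegral_pushforward d1 d2 (T1 : measurableType d1) (T2 : measurableType d2)
    (m : {measure set T1 -> \bar R}) (h : T1 -> T2) (mh : measurable_fun setT h)
    (pm := measure_function_pushforward__canonical__measure_function_Measure m mh)
    (f : T2 -> R[i]) : cmeasurable f -> cintegrable m (f \o h) ->
  cintegrable pm f /\ cintegral pm f = cintegral m (f \o h).
Proof.
rewrite /pm => -[/measurable_EFinP mf1 /measurable_EFinP mf2] [f1 f2]; split.
  split; apply: integrable_pushforward => //.
apply: complexP; rewrite /cintegral /= /Rintegral integral_pushforward//.
Qed.

(** Induction along the construction of [lebesgue] as the image of a product measure under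
    [cons_pair]. In dimension [0] the measure is a Dirac mass and the empty product integrates to
    [1]. *)
Lemma cintegral_prod_tuple n (f : 'I_n -> R -> R[i]) :
  (forall i, cintegrable leb (f i)) ->
  cintegrable (lebesgue n) (fun x => \prod_(i < n) f i (tnth x i)) /\
  cintegral (lebesgue n) (fun x => \prod_(i < n) f i (tnth x i)) =
  \prod_(i < n) cintegral leb (f i).
Proof.
elim: n f => [|n IH] f fi.
  under eq_fun do rewrite big_ord0; rewrite big_ord0 /=.
  have k0 (c : R) : (\d_([tuple] : 0.-tuple R) : {measure set (0.-tuple R) ->
      \bar R}).-integrable setT (EFin \o cst c).
    apply/integrableP; split; first by apply/measurable_EFinP;
        exact: measurable_cst.
    by rewrite integral_dirac//= diracT mul1e ltry.
  have := k0 1; have := k0 0 => h0 h1; split; first by split.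
  rewrite /cintegral /Rintegral !integral_dirac//.
    by rewrite diracT !mul1e.
have [i1 i2] := IH (fun i => f (lift ord0 i)) (fun i => fi _).
have fE : (fun p => \prod_(i < n.+1) f i (tnth (cons_pair p) i)) =
    (fun p : measurableTypeR R * n.-tuple R =>
        f ord0 p.1 * \prod_(i < n) f (lift ord0 i) (tnth p.2 i)).
  apply/funext => p; rewrite big_ord_recl; congr (_ * _).
  by apply: eq_bigr => i _; rewrite /cons_pair (tnthS).
have mf : cmeasurable (fun x : n.+1.-tuple R => \prod_(i < n.+1) f i (tnth x i)).
  elim: (index_enum _) => [|i r IHr].
    by under eq_fun do rewrite big_nil; exact: cmeasurable_cst.
  under eq_fun do rewrite big_cons; apply: cmeasurableM => //.
  apply: (@cmeasurable_comp _ _ _ _ (f i) (fun x => tnth x i)).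
    exact: (@measurable_tnth _ R n.+1 i).
  exact: cintegrable_cmeasurable (fi i).
have ti := cintegrable_tensor (m1 := leb) (m2 := lebesgue n) (fi ord0) i1.
have te := cintegral_tensor (m1 := leb) (m2 := lebesgue n) (fi ord0) i1.
have [] := @cintegral_pushforward _ _ _ _ (leb \x lebesgue n)%E
  (@cons_pair R n) (@measurable_cons_pair R n) _ mf.
  by rewrite /comp fE.
by rewrite /comp fE te i2 big_ord_recl.
Qed.

End TupleProduct.

(** * Plancherel's identity for intervals of the line *)

Section OneDim.
Context {R : realType}.
Local Notation leb := (@lebesgue_measure R).
Implicit Types (p q : R * R) (t x : R).

(* With length [|p.2|], every pair of reals indexes an interval. *)
Definition ocitv_of p : set R := `]p.1, p.1 + `|p.2|]%classic.

(** This is [e^(-i x)], with the sign of the Fourier kernel. *)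
Definition expi (x : R) : R[i] := Complex (cos x) (- sin x).

Lemma normc_expi x : normc (expi x) = 1.
Proof. by rewrite /= sqrrN cos2Dsin2 sqrtr1. Qed.

Lemma cmeasurable_expi : cmeasurable expi.
Proof.
split; apply: continuous_measurable_fun; first exact: continuous_cos.
by move=> x; apply: cvgN; exact: continuous_sin.
Qed.

Lemma measurable_ocitv_of p : measurable (ocitv_of p).
Proof. exact: measurable_itv. Qed.

Definition indc (A : set R) x : R[i] := (\1_A x)%:C%C.

Lemma cintegrable_indc p : cintegrable leb (indc (ocitv_of p)).
Proof.
split; last exact: integrable0.
exact: integrable_indic_itv.
Qed.

(** The Fourier transform of the indicator of an interval; transforms of boxes are products of
    these. *)
Definition dirichlet p t : R[i] :=
  cintegral leb (fun x => expi (x * t) * indc (ocitv_of p) x).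

Lemma cintegrable_dirichlet p t :
  cintegrable leb (fun x => expi (x * t) * indc (ocitv_of p) x).
Proof.
apply: (cintegrable_bounded _ (cintegrable_normc (cintegrable_indc p))).
  apply: cmeasurableM; last exact: cintegrable_cmeasurable (cintegrable_indc p).
  apply: (@cmeasurable_comp _ _ _ _ _ expi (fun x => x * t)).
    exact: measurable_funM.
  exact: cmeasurable_expi.
by move=> x; rewrite normcM normc_expi mul1r.
Qed.

Lemma dirichletE p t : t != 0 -> dirichlet p t =
  Complex ((sin (t * (p.1 + `|p.2|)) - sin (t * p.1)) / t)
          ((cos (t * (p.1 + `|p.2|)) - cos (t * p.1)) / t).
Proof.
move=> t0; have pp : p.1 <= p.1 + `|p.2| by rewrite lerDl.
apply: complexP; rewrite /dirichlet /cintegral /=.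
  rewrite -(Rintegral_cos pp t0) [RHS]Rintegral_mkcond; apply: eq_Rintegral => x _.
  rewrite patchE indicE mulr0 subr0 (mulrC x).
  by case: ifP => _; rewrite ?mulr1 ?mulr0.
rewrite (_ : _ / _ = - ((cos (t * p.1) - cos (t * (p.1 + `|p.2|))) / t));
    last by field.
rewrite -(Rintegral_sin pp t0) Rintegral_mkcond -[RHS]mulN1r.
rewrite -RintegralZl//.
  apply: eq_Rintegral => x _.
  rewrite patchE indicE mulr0 add0r (mulrC x) mulN1r.
  by case: ifP => _; rewrite ?mulr1 ?mulr0 ?oppr0.
have [_ h] := cintegrable_dirichlet p t.
rewrite (_ : EFin \o _ = \- (fun x => (Im (expi (x * t) * indc (ocitv_of p)
    x))%:E))%E; first exact: integrableN.
apply/funext => x; rewrite /= patchE indicE mulr0 add0r (mulrC x).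
by case: ifP => _; rewrite ?mulr1 ?mulr0 ?oppr0// -?EFinN ?opprK ?oppr0.
Qed.

Lemma cmeasurable_dirichlet p : cmeasurable (dirichlet p).
Proof.
apply: (cmeasurable_cintegral_section leb
  (h := fun z => expi (z.1 * z.2) * indc (ocitv_of p) z.1)).
apply: cmeasurableM.
  apply: (@cmeasurable_comp _ _ _ _ _ expi (fun z : R * R => z.1 * z.2)).
    by apply: measurable_funM.
  exact: cmeasurable_expi.
apply: (@cmeasurable_comp _ _ _ _ _ (indc (ocitv_of p)) fst) => //.
exact: cintegrable_cmeasurable (cintegrable_indc p).
Qed.

(** The Fejer kernel up to normalization. The real part of a product of two interval transforms is a
    combination of four of these, hence the interest of their integral. *)
Definition fejer (u t : R) : R := (1 - cos (u * t)) / t ^+ 2.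

Lemma integral_fejer u : leb.-integrable setT (EFin \o fejer u) /\
  \int[leb]_t fejer u t = pi * `|u|.
Proof.
have f0 t : 0 <= fejer u t by rewrite divr_ge0 ?sqr_ge0// subr_ge0 cos_le1.
have mf : measurable_fun setT (fejer u).
  have op : open (~` [set (0 : R)]) by rewrite openC;
      exact/accessible_closed_set1/hausdorff_accessible/norm_hausdorff.
  rewrite -(setUv [set (0 : R)]); apply/measurable_funU => //.
    exact: open_measurable.
  split; first exact: measurable_fun_set1.
  apply: open_continuous_measurable_fun => // t; rewrite inE => /eqP t0.
  apply: cvgM; first by apply: cvgB; [exact: cvg_cst|exact: continuous_cos_scale].
  by apply: cvgV; [rewrite expf_neq0|exact: exprn_continuous].
split; last by rewrite /Rintegral integral_one_sub_cos.
apply/integrableP; split; first exact/measurable_EFinP.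
under eq_integral do rewrite gee0_abs ?lee_fin//.
by rewrite integral_one_sub_cos ltry.
Qed.

Lemma ae_neq0 : {ae leb, forall t : measurableTypeR R, t != 0 :> R}.
Proof.
exists [set 0]; split => //; first by rewrite lebesgue_measure_set1.
by move=> t /=; case: eqP.
Qed.

Lemma sqintegrable_dirichlet p : sqintegrable leb (dirichlet p).
Proof.
split; first exact: cmeasurable_dirichlet.
have [i e] := integral_fejer p.2.
have {}i := integrableZl measurableT 2 i.
have -> : (\int[leb]_t (normc (dirichlet p t) ^+ 2)%:E = \int[leb]_t (2%:E *
    (fejer p.2 t)%:E))%E.
  apply: ae_eq_integral => //.
  - exact: measurable_normcX2 (cmeasurable_dirichlet p).
  - exact: measurable_int i.
  have := ae_neq0; apply: filterS => t t0 _; rewrite dirichletE// normc_sq/=.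
  rewrite -EFinM; congr EFin; rewrite /fejer.
  have -> : cos (p.2 * t) = cos (t * (p.1 + `|p.2|) - t * p.1).
    rewrite mulrDr addrAC subrr add0r mulrC.
    by case: (ger0P p.2) => _ //; rewrite mulrN cosN.
  set X := t * (_ + _); set Y := t * p.1.
  rewrite cosB (_ : 2 * _ = (cos X ^+ 2 + sin X ^+ 2 + (cos Y ^+ 2 + sin Y ^+ 2)
     - 2 * (cos X * cos Y + sin X * sin Y)) / t ^+ 2); first by field.
  by rewrite !cos2Dsin2; field.
rewrite -ge0_fin_numE; first exact: integrable_fin_num i.
apply: integral_ge0 => t _.
by rewrite mule_ge0// lee_fin divr_ge0 ?sqr_ge0// subr_ge0 cos_le1.
Qed.

(** The right side is twice the length of the intersection of []a, b]] and []a', b']]. This is how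
    integrals proportional to [|u|] reassemble into an inner product of indicators. *)
Lemma overlap_length (a b a' b' : R) : a <= b -> a' <= b' ->
  `|b - a'| + `|a - b'| - `|b - b'| - `|a - a'| =
  2 * (if Num.max a a' < Num.min b b' then Num.min b b' - Num.max a a' else 0).
Proof.
move=> ab ab'; case: (lerP a a') => h1; case: (lerP b b') => h2.
all: rewrite ?(@ler0_norm _ (a - a')) ?(@gtr0_norm _ (a - a')) ?subr_le0
    ?subr_gt0//.
all: rewrite ?(@ler0_norm _ (b - b')) ?(@gtr0_norm _ (b - b')) ?subr_le0
    ?subr_gt0//.
all: case: ifP => [h|/negbT]; rewrite -?leNgt => *.
all: case: (ger0P (b - a')) => ?; case: (ger0P (a - b')) => ?; lra.
Qed.

(** Away from [0] the real part of the integrand is a sum of four signed Fejer kernels, whose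
    integrals combine by [overlap_length]; the imaginary part is odd. *)
Lemma dirichlet_dot p q :
  cintegral leb (fun t => dirichlet p t * conjc (dirichlet q t)) =
  (2 * pi)%:C%C * cintegral leb (fun x => indc (ocitv_of p) x * conjc (indc
      (ocitv_of q) x)).
Proof.
have ci := cintegrableM (sqintegrable_dirichlet p) (sqintegrable_conjc
    (sqintegrable_dirichlet q)).
set a := p.1; pose b := a + `|p.2|; set a' := q.1; pose b' := a' + `|q.2|.
have ab : a <= b by rewrite lerDl.
have ab' : a' <= b' by rewrite lerDl.
have lenE : leb (ocitv_of p `&` ocitv_of q) =
    (((`|b - a'| + `|a - b'| - `|b - b'| - `|a - a'|) / 2)%:E)%E.
  have -> : ocitv_of p `&` ocitv_of q = `]Num.max a a', Num.min b b']%classic.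
    apply/seteqP; split => x; rewrite /ocitv_of /= !in_itv/= gt_max le_min.
      by move=> [/andP[-> ->] /andP[-> ->]].
    by move=> /andP[/andP[-> ->] /andP[-> ->]].
  rewrite overlap_length// lebesgue_measure_itv/= lte_fin.
  by case: ifP => _; rewrite -?EFinB; congr EFin; field.
have dE t : t != 0 -> dirichlet p t * conjc (dirichlet q t) =
  Complex (fejer (b - a') t + fejer (a - b') t - fejer (b - b') t - fejer (a -
      a') t)
   ((sin (t * (b' - b)) - sin (t * (a' - b)) - sin (t * (b' - a)) + sin (t *
       (a' - a))) / t ^+ 2).
  move=> t0; rewrite !dirichletE// /fejer.
  rewrite -/a -/a' -/b -/b' !(mulrC _ t) ![t * (_ - _)]mulrBr !cosB !sinB.
  by apply: complexP; rewrite !reimE /=; field.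
have [h1 h2] := ci.
apply: complexP.
  rewrite [RHS]reimE mul0r subr0 -[LHS]/(\int[leb]_t Re (dirichlet p t * conjc
      (dirichlet q t))).
  transitivity (\int[leb]_t (fejer (b - a') t + fejer (a - b') t - fejer (b -
      b') t - fejer (a - a') t)).
    rewrite /Rintegral; congr fine; apply: ae_eq_integral => //.
    - exact: measurable_int h1.
    - apply/measurable_EFinP; apply: measurable_funB;
        [apply: measurable_funB; [apply: measurable_funD|]|];
        apply/measurable_EFinP; exact: measurable_int (integral_fejer _).1.
    - by have := ae_neq0; apply: filterS => t t0 _; rewrite dE.
  have fi u := (integral_fejer u).1.
  rewrite RintegralB//; last first.
    by apply: (integrableB measurableT (integrableD measurableT (fi _) (fi _))
        (fi _)).
  rewrite RintegralB//; last exact: (integrableD measurableT (fi _) (fi _)).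
  rewrite RintegralD// !(integral_fejer _).2.
  transitivity (2 * pi * fine (leb (ocitv_of p `&` ocitv_of q)));
      first by rewrite lenE/=; field.
  rewrite /cintegral/=; congr (_ * _); rewrite -(setIT (_ `&` _))
      -integral_indic//; last first.
    by apply: measurableI; exact: measurable_ocitv_of.
  by apply: eq_Rintegral => x _; rewrite indicI oppr0 mulr0 subr0.
rewrite [RHS]reimE mul0r addr0 -[LHS]/(\int[leb]_t Im (dirichlet p t * conjc
    (dirichlet q t))).
transitivity (0 : R).
  (* At [t = 0] the division makes [g] equal to [0]. The value of the transforms there is kept as a
     separate term supported on a null set, so measurability and integrability of [g] can be read
     off from the product. *)
  pose g t := (sin (t * (b' - b)) - sin (t * (a' - b)) - sin (t * (b' - a)) +
      sin (t * (a' - a))) / t ^+ 2.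
  have g0 t : Im (dirichlet p t * conjc (dirichlet q t)) =
     g t + (if t == 0 then Im (dirichlet p 0 * conjc (dirichlet q 0)) else 0).
    by case: eqVneq => [->|t0]; [rewrite /g !mul0r !sin0 !subr0 addr0 mul0r
        add0r|rewrite dE// addr0].
  have mg : measurable_fun setT (EFin \o g).
    rewrite (_ : EFin \o g = fun t => (Im (dirichlet p t * conjc (dirichlet q
        t)) - (\1_[set 0] t) * Im (dirichlet p 0 * conjc (dirichlet q 0)))%:E).
      apply/measurable_EFinP; apply: measurable_funB;
          first exact: (cintegrable_cmeasurable ci).2.
      by apply: measurable_funM => //; exact: measurable_indic.
    apply/funext => t; rewrite -[LHS]/((g t)%:E) g0 indicE; congr EFin.
    have -> : (t \in [set 0]) = (t == 0) by apply/idP/eqP => [|->]; rewrite inE.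
    by case: eqP => _; rewrite ?mul1r ?mul0r; ring.
  transitivity (\int[leb]_t g t).
    rewrite /Rintegral; congr fine; apply: ae_eq_integral => //;
        first exact: measurable_int h2.
    by have := ae_neq0; apply: filterS => t t0 _; rewrite dE.
  apply: integral_odd => [|t].
    apply: (le_integrable _ _ _ h2) => // t _;
        rewrite -[leLHS]/((`|g t|)%:E) lee_fin g0.
    by case: eqVneq => [->|t0]; [rewrite /g !mul0r !sin0 !subr0 addr0 mul0r
        normr0|rewrite addr0].
  by rewrite /g !mulNr !sinN sqrrN -mulNr; congr (_ / _); ring.
rewrite /cintegral/= [X in _ * X](_ : _ = 0) ?mulr0//.
by under eq_Rintegral do rewrite oppr0 mulr0 mul0r addr0;
    rewrite /Rintegral integral0.
Qed.

End OneDim.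

Lemma sqintegrable_indic {R : realType} d (T : measurableType d) (m : {measure
    set T -> \bar R}) (A : set T) :
  measurable A -> (m A < +oo)%E -> sqintegrable m (fun x => (\1_A x)%:C%C).
Proof.
move=> mA mAoo; split; first exact: cmeasurable_indic.
rewrite (eq_integral (fun x => (\1_A x)%:E)).
  by rewrite integral_indic// setIT.
move=> x _; rewrite normc_sq/= expr0n addr0 indicE.
by case: (x \in A); rewrite ?expr1n ?expr0n.
Qed.

(** * Boxes in several variables: transforms, and uniqueness of functions from their integrals *)

Section Boxes.
Context {R : realType} {n : nat}.
Local Notation leb := (@lebesgue_measure R).
Local Notation pt := (n.-tuple R).
Implicit Types (c : n.-tuple (R * R)) (x xi : pt).

Definition box c : set pt := [set x | forall i, ocitv_of (tnth c i) (tnth x i)].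
Definition boxf c x : R[i] := \prod_(i < n) indc (ocitv_of (tnth c i)) (tnth x i).
Definition boxhat c xi : R[i] := \prod_(i < n) dirichlet (tnth c i) (tnth xi i).

Lemma measurable_box c : measurable (box c).
Proof.
rewrite (_ : box c = \bigcap_(i in setT) ((tnth (T:=R) ^~ i) @^-1` ocitv_of
    (tnth c i))).
  apply: fin_bigcap_measurable => // i _; rewrite -[X in measurable X]setTI.
  by apply: (@measurable_tnth _ R n i) => //; exact: measurable_ocitv_of.
by apply/seteqP; split=> x /= Hx i => [_|]; [exact: Hx|exact: (Hx i I)].
Qed.

Lemma boxfE c x : boxf c x = (\1_(box c) x)%:C%C.
Proof.
rewrite indicE; have [h|h] := boolP (x \in box c).
  rewrite /boxf big1// => i _; rewrite /indc indicE.
  by move: h; rewrite inE => /(_ i) h; rewrite mem_set.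
have [i hi] : exists i, ~ ocitv_of (tnth c i) (tnth x i).
  by apply/existsNP => H; move/negP: h; apply; rewrite inE.
by rewrite /boxf (bigD1 i)//= /indc indicE memNset//= mul0r.
Qed.

Lemma cintegrable_boxf c : cintegrable (lebesgue n) (boxf c).
Proof. exact: (cintegral_prod_tuple (fun i => cintegrable_indc (tnth c i))).1. Qed.

Lemma lebesgue_box_lty c : (lebesgue n (box c) < +oo)%E.
Proof.
have [h _] := cintegrable_boxf c.
rewrite -(setIT (box c)) -integral_indic//; last exact: measurable_box.
have -> : (\int[lebesgue n]_x (\1_(box c) x)%:E = \int[lebesgue n]_x (Re (boxf
    c x))%:E)%E.
  by apply: eq_integral => x _; rewrite boxfE.
have := integrable_fin_num measurableT h; rewrite ge0_fin_numE//.
by apply: integral_ge0 => x _; rewrite boxfE lee_fin.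
Qed.

Lemma expi_sum (I : Type) (r : seq I) (F : I -> R) :
  expi (\sum_(i <- r) F i) = \prod_(i <- r) expi (F i).
Proof.
apply: (big_morph expi) => [x y|]; last by rewrite /expi cos0 sin0 oppr0.
by apply: complexP; rewrite !reimE/= ?cosD ?sinD; ring.
Qed.

Lemma fourier_integral_boxf c xi : fourier_integral (boxf c) xi = boxhat c xi.
Proof.
rewrite /boxhat /dirichlet.
have [_ <-] := cintegral_prod_tuple (fun i =>
    cintegrable_dirichlet (tnth c i) (tnth xi i)).
congr (cintegral _ _); apply/funext => x.
by rewrite big_split/= -expi_sum.
Qed.

Lemma sqintegrable_boxf c : sqintegrable (lebesgue n) (boxf c).
Proof.
rewrite (_ : boxf c = fun x => (\1_(box c) x)%:C%C); last by apply/funext => x;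
    rewrite boxfE.
by apply: sqintegrable_indic; [exact: measurable_box|exact: lebesgue_box_lty].
Qed.

Lemma conjc_prod (I : Type) (r : seq I) (F : I -> R[i]) :
  conjc (\prod_(i <- r) F i) = \prod_(i <- r) conjc (F i).
Proof. by apply: (big_morph _ conjcM); apply: complexP; rewrite /= ?oppr0. Qed.

Lemma boxf_dot c c' : cintegral (lebesgue n) (fun x =>
    boxf c x * conjc (boxf c' x)) =
  \prod_(i < n) cintegral leb (fun y => indc (ocitv_of (tnth c i)) y * conjc
      (indc (ocitv_of (tnth c' i)) y)).
Proof.
have s1 p : sqintegrable leb (indc (ocitv_of p)).
  apply: sqintegrable_indic; first exact: measurable_ocitv_of.
  have h : (leb (ocitv_of p) < +oo)%E.
    by rewrite /ocitv_of lebesgue_measure_itv/=; case: ifP => // _;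
        rewrite -EFinB ltry.
  exact: h.
have [_ <-] := cintegral_prod_tuple (fun i =>
    cintegrableM (s1 (tnth c i)) (sqintegrable_conjc (s1 (tnth c' i)))).
by congr (cintegral _ _); apply/funext => x; rewrite /boxf conjc_prod -big_split.
Qed.

Lemma cmeasurable_fourier_integral (f : pt -> R[i]) :
  cmeasurable f -> cmeasurable (fourier_integral f).
Proof.
move=> mf; apply: (cmeasurable_cintegral_section (lebesgue n)
  (h := fun z => expi (dotRn z.1 z.2) * f z.1)).
apply: cmeasurableM; last exact: (cmeasurable_comp measurable_fst mf).
apply: (@cmeasurable_comp _ _ _ _ _ expi (fun z : pt * pt => dotRn z.1 z.2));
    last exact: cmeasurable_expi.
rewrite /dotRn; apply: measurable_sum => i; apply: measurable_funM.
  exact: (measurableT_comp (@measurable_tnth _ R n i) measurable_fst).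
exact: (measurableT_comp (@measurable_tnth _ R n i) measurable_snd).
Qed.

Lemma boxhat_dot c c' :
  cintegrable (lebesgue n) (fun t => boxhat c t * conjc (boxhat c' t)) /\
  cintegral (lebesgue n) (fun t => boxhat c t * conjc (boxhat c' t)) =
  ((2 * pi) ^+ n)%:C%C * cintegral (lebesgue n) (fun x =>
      boxf c x * conjc (boxf c' x)).
Proof.
have [i e] := cintegral_prod_tuple (fun i => cintegrableM
    (sqintegrable_dirichlet (tnth c i)) (sqintegrable_conjc
    (sqintegrable_dirichlet (tnth c' i)))).
rewrite (_ : (fun t => boxhat c t * _) = fun x =>
    \prod_(i < n) (dirichlet (tnth c i) (tnth x i) * conjc (dirichlet (tnth c'
    i) (tnth x i)))); last first.
  by apply/funext => t; rewrite /boxhat conjc_prod -big_split.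
split => //; rewrite e boxf_dot; under eq_bigr do rewrite dirichlet_dot.
by rewrite big_split/= prodr_const card_ord rmorphXn.
Qed.

Lemma sqintegrable_boxhat c : sqintegrable (lebesgue n) (boxhat c).
Proof.
apply/sqintegrableP; split.
  rewrite (_ : boxhat c = fourier_integral (boxf c)); last first.
    by apply/funext => t; rewrite fourier_integral_boxf.
  exact/cmeasurable_fourier_integral/(cintegrable_cmeasurable (cintegrable_boxf c)).
have [[h _] _] := boxhat_dot c c; move: h; congr (_.-integrable _ _).
by apply/funext => t; rewrite mulc_conjc.
Qed.

Lemma setI_closed_box : setI_closed (range box).
Proof.
move=> _ _ [c _ <-] [c' _ <-].
(* Intervals are encoded by left end and length; the length of an intersection is clipped at [0], so
   that disjoint intervals give an empty one despite the absolute value in [ocitv_of]. *)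
pose f (p q : R * R) := (Num.max p.1 q.1,
  Num.max 0 (Num.min (p.1 + `|p.2|) (q.1 + `|q.2|) - Num.max p.1 q.1)).
have fE p q : ocitv_of (f p q) = ocitv_of p `&` ocitv_of q.
  apply/seteqP; split => y; rewrite /ocitv_of /f /= !in_itv/= (@ger0_norm _
      (Num.max 0 _)) ?le_max ?lexx//.
    rewrite gt_max => /andP[/andP[h1 h2]].
    rewrite addr_maxr addr0 addrC subrK le_max le_min h1 h2 /=.
    rewrite leNgt gt_max h1 h2 /= => /andP[-> ->].
    by split.
  move=> [/andP[h1 h2] /andP[h3 h4]].
  by rewrite gt_max h1 h3/= addr_maxr addr0 addrC subrK le_max le_min h2 h4 orbT.
exists [tuple f (tnth c i) (tnth c' i) | i < n] => //.
apply/seteqP; split => [x hx|x [h1 h2] i]; last by rewrite /= tnth_mktuple fE;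
    split.
by split=> i; have := hx i; rewrite tnth_mktuple fE => -[].
Qed.

(** Each side is []- k, k]], given by its left end and its length [2 k]. *)
Definition cube (k : nat) : n.-tuple (R * R) := [tuple (- k%:R, 2 * k%:R) | i < n].

Lemma cube_cover : \bigcup_k box (cube k) = setT.
Proof.
apply/seteqP; split => // x _.
pose M := \sum_(i < n) `|tnth x i|.
have M0 : 0 <= M by apply: sumr_ge0.
exists (Num.truncn M).+1 => // i.
rewrite tnth_mktuple /ocitv_of /= in_itv/= ger0_norm ?mulr_ge0//.
have h := truncnS_gt M.
have hi : `|tnth x i| <= M by rewrite /M (bigD1 i)//= lerDl sumr_ge0.
set K := (Num.truncn M).+1%:R in h *.
have := le_lt_trans hi h; rewrite ltr_norml => /andP[? ?].
by apply/andP; split; lra.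
Qed.

Lemma measurable_boxes : @measurable _ pt = <<s range box>>.
Proof.
apply/seteqP; split; last first.
  apply: smallest_sub; first exact: sigma_algebra_measurable.
  by move=> _ [c _ <-]; exact: measurable_box.
have mid : measurable_fun setT (id : g_sigma_algebraType (range box) -> pt).
  apply/measurable_fun_tnthP => i.
  apply: (measurability (@ocitv R)) => //.
  move=> _ [_ /ocitvP[->|[[a b] /= ab ->]] <-];
      first by rewrite preimage_set0 setI0; exact: measurable0.
  rewrite setTI.
  (* A condition on the coordinate [i] alone is exhausted by boxes whose other sides are []- k,
     k]]. *)
  pose c k : n.-tuple (R * R) := [tuple if j == i then (a, b - a) else (- k%:R,
      2 * k%:R) | j < n].
  rewrite (_ : _ @^-1` _ = \bigcup_k box (c k)).
    apply: bigcup_measurable => k _; apply: sub_sigma_algebra; exact: imageT.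
  apply/seteqP; split => x.
    rewrite /= in_itv/= => xi; have : [set: pt] x by [].
    rewrite -cube_cover => -[k _ hk]; exists k => // j.
    rewrite tnth_mktuple; case: eqVneq => [->|ji].
      by rewrite /ocitv_of /= in_itv/= ger0_norm ?subr_ge0 ?(ltW ab)// addrC subrK.
    by have := hk j; rewrite tnth_mktuple.
  move=> [k _ /(_ i)]; rewrite tnth_mktuple eqxx /ocitv_of /=.
  by rewrite in_itv/= ger0_norm ?subr_ge0 ?(ltW ab)// addrC subrK.
by move=> A mA; have := mid measurableT A mA; rewrite setTI preimage_id.
Qed.

(** The positive and negative parts of [h] are densities of two measures that agree on boxes, a
    generating class stable under intersection, and are finite on cubes. The measures are thus
    equal; comparing them on [h > 0] and on [h < 0] gives the claim. *)
Lemma box_integral_eq0 (m : {measure set pt -> \bar R}) (h : pt -> R) :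
  measurable_fun setT h ->
  (forall c, m.-integrable (box c) (EFin \o h)) ->
  (forall c, \int[m]_(x in box c) h x = 0) -> {ae m, forall x, h x = 0}.
Proof.
move=> mh hi h0.
have mEh : measurable_fun setT (EFin \o h) by exact/measurable_EFinP.
have mk (f : pt -> \bar R) : (forall x, 0 <= f x)%E -> measurable_fun setT f ->
    exists m1 : {measure set pt -> \bar R}, forall A,
        m1 A = (\int[m]_(x in A) f x)%E.
  move=> f0 mf; pose nu A := (\int[m]_(x in A) f x)%E.
  have nu0 : nu set0 = 0%E by rewrite /nu integral_set0.
  have nuge A : (0 <= nu A)%E by apply: integral_ge0.
  have nus : semi_sigma_additive nu.
    move=> F mF tF mUF; rewrite /nu ge0_integral_bigcup//.
      by apply: is_cvg_ereal_nneg_natsum_cond => k _ _; exact: integral_ge0.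
    exact: measurable_funTS.
  by exists (HB.pack_for {measure set pt -> \bar R} nu (isMeasure.Build _ _ _
      nu nu0 nuge nus)).
have [m1 m1E] := mk _ (fun x => funepos_ge0 _ x) (measurable_funepos mEh).
have [m2 m2E] := mk _ (fun x => funeneg_ge0 _ x) (measurable_funeneg mEh).
have m12 A : measurable A -> m1 A = m2 A.
  apply: (measure_unique (range box) (fun k => box (cube k)) measurable_boxes
    setI_closed_box) => [i||_ [c _ <-]|k].
  - exact: imageT.
  - exact: cube_cover.
  - rewrite m1E m2E; have mb := measurable_box c.
    have fp := integrable_fin_num mb (integrable_funepos mb (hi c)).
    have fn := integrable_fin_num mb (integrable_funeneg mb (hi c)).
    have := h0 c; rewrite /Rintegral integralE => /eqP.
    by rewrite fineB// subr_eq0 => /eqP e; rewrite -(fineK fp) -(fineK fn) e.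
  - rewrite m1E; have mb := measurable_box (cube k).
    have := integrable_fin_num mb (integrable_funepos mb (hi (cube k))).
    by rewrite ge0_fin_numE// integral_ge0.
have key A (f g : pt -> \bar R) : measurable A -> (forall x, 0 <= f x)%E ->
    measurable_fun setT f -> (\int[m]_(x in A) f x = \int[m]_(x in A) g x)%E ->
    (forall x, A x -> g x = 0%E) -> {ae m, forall x, A x -> f x = 0%E}.
  move=> mA f0 mf fg g0; apply/(ae_eq_integral_abs m mA (measurable_funTS mf)).
  under eq_integral do rewrite gee0_abs//.
  by rewrite fg; apply: integral0_eq.
have mpos : measurable [set x | 0 < h x].
  by rewrite -[X in measurable X]setTI -preimage_itvoy; exact: mh.
have mneg : measurable [set x | h x < 0].
  by rewrite -[X in measurable X]setTI -preimage_itvNyo; exact: mh.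
have pos : {ae m, forall x, 0 < h x -> funepos (EFin \o h) x = 0%E}.
  apply: (key _ _ (funeneg (EFin \o h))) => //.
  - exact: measurable_funepos.
  - by rewrite -m1E -m2E m12.
  - by move=> x /= hx; rewrite funenegE/= -EFin_max; congr EFin;
      apply/max_idPr; lra.
have neg : {ae m, forall x, h x < 0 -> funeneg (EFin \o h) x = 0%E}.
  apply: (key _ _ (funepos (EFin \o h))) => //.
  - exact: measurable_funeneg.
  - by rewrite -m1E -m2E m12.
  - by move=> x /= hx; rewrite funeposE/= -EFin_max; congr EFin;
      apply/max_idPr; lra.
apply: filterS2 pos neg => x hp hn.
case: (ltgtP (h x) 0) => // hx.
- move: (hn hx); rewrite funenegE/= -EFin_max => -[] e.
  by have : - h x <= 0; [rewrite -e le_max lexx|lra].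
- move: (hp hx); rewrite funeposE/= -EFin_max => -[] e.
  by have : h x <= 0; [rewrite -e le_max lexx|lra].
Qed.

Lemma box_cintegral_eq0 (m : {measure set pt -> \bar R}) (h : pt -> R[i]) :
  cmeasurable h -> (forall c, cintegrable m (fun x => h x * boxf c x)) ->
  (forall c, cintegral m (fun x => h x * boxf c x) = 0) -> {ae m, forall x,
      h x = 0}.
Proof.
move=> [mh1 mh2] hi h0.
have E (f : pt -> R) c : m.-integrable setT (fun x => (f x * \1_(box c) x)%:E) ->
    m.-integrable (box c) (EFin \o f) /\ \int[m]_x (f x * \1_(box c) x) =
        \int[m]_(x in box c) f x.
  move=> fi; have mb := measurable_box c; split.
    apply/(integrable_mkcond _ mb); congr (_.-integrable _ _): fi.
    by apply/funext => x; rewrite patchE indicE; case: ifP; rewrite ?mulr1 ?mulr0.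
  rewrite [RHS]Rintegral_mkcond; apply: eq_Rintegral => x _.
  by rewrite patchE indicE; case: ifP; rewrite ?mulr1 ?mulr0.
have Re1 c x : Re (h x * boxf c x) = Re (h x) * \1_(box c) x.
  by rewrite boxfE; case: (h x) => a b /=; rewrite mulr0 subr0.
have Im1 c x : Im (h x * boxf c x) = Im (h x) * \1_(box c) x.
  by rewrite boxfE; case: (h x) => a b /=; rewrite mulr0 add0r.
have ae1 : {ae m, forall x, Re (h x) = 0}.
  apply: box_integral_eq0 => // c.
    by have [+ _] := hi c; under eq_fun do rewrite Re1; case/E.
  have [+ _] := hi c; under eq_fun do rewrite Re1; case/E => _ <-.
  by have := congr1 (@complex.Re R) (h0 c); rewrite /cintegral/=;
      under eq_Rintegral do rewrite Re1.
have ae2 : {ae m, forall x, Im (h x) = 0}.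
  apply: box_integral_eq0 => // c.
    by have [_ +] := hi c; under eq_fun do rewrite Im1; case/E.
  have [_ +] := hi c; under eq_fun do rewrite Im1; case/E => _ <-.
  by have := congr1 (@complex.Im R) (h0 c); rewrite /cintegral/=;
      under eq_Rintegral do rewrite Im1.
by apply: filterS2 ae1 ae2 => x h1 h2; apply: complexP; rewrite ?h1 ?h2.
Qed.

Lemma total_family_box (m : {measure set pt -> \bar R}) :
  (forall c, sqintegrable m (boxf c)) -> total_family (fun c => L2class m (boxf c)).
Proof.
move=> sb u hu; apply: L2eq.
have ci c : cintegrable m (fun x => repr u x * boxf c x).
  by apply: cintegrableM => //; exact: repr_sqintegrable.
have z : {ae m, forall x, repr u x = 0}.
  apply: box_cintegral_eq0 => // [|c]; first exact: repr_cmeasurable.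
  have := hu c; rewrite -{1}(L2class_repr u) dotL2E//;
      last exact: repr_sqintegrable.
  move=> <-; congr (cintegral _ _); apply/funext => x; congr (_ * _).
  by rewrite boxfE; apply: complexP; rewrite /= ?oppr0.
have z0 := repr_sum (mu := m) [::] (fun _ : unit => 0) (fun _ => 0 : L2 m).
rewrite big_nil in z0.
by apply: filterS2 z z0 => x -> ->; rewrite big_nil.
Qed.

End Boxes.

(** * Plancherel's theorem *)

Section IsometryExtension.
Context d1 d2 (T1 : measurableType d1) (T2 : measurableType d2) (R : realType).
Context (mu : {measure set T1 -> \bar R}) (nu : {measure set T2 -> \bar R}).
Context (I : Type) (s : I -> L2 mu) (t : I -> L2 nu).
Hypothesis dot_st : forall i j, dotL2 (t i) (t j) = dotL2 (s i) (s j).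
Hypothesis stot : total_family s.

Lemma normL2_comb l : normL2 (comb t l) = normL2 (comb s l).
Proof.
suff e : normsq (comb t l) = normsq (comb s l).
  by apply: (pexpIrn (n := 2)); rewrite // ?nnegrE ?normL2_ge0// !normL2_sq.
have := dotL2_self (comb t l); have := dotL2_self (comb s l).
have -> : dotL2 (comb t l) (comb t l) = dotL2 (comb s l) (comb s l).
  rewrite /comb !dotL2_suml; apply: eq_bigr => p _.
  rewrite !dotL2Zl !dotL2_sumr; congr (_ * _); apply: eq_bigr => q _.
  by rewrite !dotL2Zr dot_st.
by move=> -> [].
Qed.

Lemma normL2_combB l l' :
  normL2 (comb t l - comb t l') = normL2 (comb s l - comb s l').
Proof.
have E d (T : measurableType d) (m : {measure set T -> \bar R}) (r : I -> L2 m) :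
    comb r l - comb r l' = comb r (l ++ [seq (-1 * p.1, p.2) | p <- l']).
  by rewrite comb_cat combZ scaleN1r.
by rewrite !E normL2_comb.
Qed.

(** The graph of the extension by density: [u] and [w] are approximated by one and the same
    combination. A relation is used because different lists may give equal vectors. *)
Definition ext_graph (u : L2 mu) (w : L2 nu) := forall e : R, 0 < e ->
  exists l, normL2 (u - comb s l) <= e /\ normL2 (w - comb t l) <= e.

Lemma ext_graph_unique u w w' : ext_graph u w -> ext_graph u w' -> w = w'.
Proof.
move=> h h'; apply/eqP; rewrite -subr_eq0; apply/eqP/normL2_eq0/eqP.
rewrite eq_le normL2_ge0 andbT; apply/ler_addgt0Pr => e e0; rewrite add0r.
have [l [h1 h2]] := h (e / 4) ltac:(by rewrite divr_gt0).
have [l' [h1' h2']] := h' (e / 4) ltac:(by rewrite divr_gt0).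
have a1 := normL2_dist w (comb t l) w'.
have a2 := normL2_dist (comb t l) (comb t l') w'.
have a3 := normL2_dist (comb s l) u (comb s l').
rewrite normL2_combB in a2; rewrite (normL2BC (comb s l) u) in a3.
rewrite (normL2BC (comb t l') w') in a2.
by move: a1 a2 a3 h1 h2 h1' h2'; do 7 move: (normL2 _) => ?; lra.
Qed.

Lemma ext_graph_total u : exists w, ext_graph u w.
Proof.
have /choice[l hl] : forall k : nat, exists l, normL2 (u - comb s l) <= k.+1%:R^-1.
  by move=> k; apply: total_family_dense => //; rewrite invr_gt0.
have small (e : R) : 0 < e -> exists N, forall k, (N <= k)%N ->
    k.+1%:R^-1 <= e :> R.
  move=> e0; exists (Num.truncn e^-1) => k Nk.
  rewrite -[leRHS]invrK lef_pV2 ?posrE ?invr_gt0//.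
  by rewrite (le_trans (ltW (truncnS_gt _)))// ler_nat.
have [|w hw] := @L2_complete _ _ _ nu (fun k => comb t (l k)).
  move=> e e0; have [N HN] := small (e / 2) ltac:(by rewrite divr_gt0).
  exists N => m k Nm Nk; rewrite normL2_combB.
  have := normL2_dist (comb s (l m)) u (comb s (l k)).
  rewrite (normL2BC (comb s (l m)) u).
  move=> /le_trans; apply; rewrite [leRHS]splitr.
  by rewrite lerD// (le_trans (hl _))// HN.
exists w => e e0; have [N HN] := small e e0; have [N' HN'] := hw e e0.
exists (l (maxn N N')); split.
  by apply: (le_trans (hl _)); apply: HN; exact: leq_maxl.
by rewrite normL2BC; apply: HN'; exact: leq_maxr.
Qed.

Lemma ext_graph_linear a u v w z : ext_graph u w -> ext_graph v z ->
  ext_graph (a *: u + v) (a *: w + z).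
Proof.
move=> h h' e e0; have na : 0 <= normc a by exact: normc_ge0.
have c0 : 0 < 2 * (normc a + 1) by lra.
have [l [h1 h2]] := h (e / (2 * (normc a + 1))) ltac:(by rewrite divr_gt0).
have [l' [h1' h2']] := h' (e / 2) ltac:(by rewrite divr_gt0).
exists ([seq (a * p.1, p.2) | p <- l] ++ l').
have key (x y : R) : 0 <= x -> x <= e / (2 * (normc a + 1)) -> y <= e / 2 ->
    normc a * x + y <= e.
  move=> x0 xe ye; have := ler_wpM2l na xe.
  have : normc a * (e / (2 * (normc a + 1))) <= e / 2.
    by rewrite mulrA ler_pdivrMr//; nra.
  lra.
have E d (T : measurableType d) (m : {measure set T -> \bar R}) (r : I ->
    L2 m) x y :
    normL2 (a *: x + y - comb r ([seq (a * p.1, p.2) | p <- l] ++ l')) <=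
    normc a * normL2 (x - comb r l) + normL2 (y - comb r l').
  rewrite comb_cat combZ opprD addrACA -scalerBr.
  by apply: (le_trans (normL2_triangle _ _)); rewrite normL2Z.
by split; apply: (le_trans (E _ _ _ _ _ _)); apply: key => //; exact: normL2_ge0.
Qed.

Lemma ext_graph_normL2 u w : ext_graph u w -> normL2 w = normL2 u.
Proof.
move=> h; apply/eqP; rewrite eq_le; apply/andP; split; apply/ler_addgt0Pr => e e0.
all: have [l [h1 h2]] := h (e / 2) ltac:(by rewrite divr_gt0).
all: have a1 := normL2_dist w (comb t l) 0; have a2 := normL2_dist u (comb s l) 0.
all: have a3 := normL2_dist (comb t l) w 0; have a4 := normL2_dist (comb s l) u 0.
all: rewrite !subr0 in a1 a2 a3 a4; rewrite (normL2BC (comb t l)) in a3.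
all: rewrite (normL2BC (comb s l)) in a4; rewrite normL2_comb in a1 a3.
all: by move: a1 a2 a3 a4 h1 h2; do 5 move: (normL2 _) => ?; lra.
Qed.

Lemma isometry_extension : exists F : {linear L2 mu -> L2 nu},
  (forall u v, dotL2 (F u) (F v) = dotL2 u v) /\ forall i, F (s i) = t i.
Proof.
have /choice[f hf] := ext_graph_total.
have flin : linear f.
  move=> a u v; apply: (ext_graph_unique (hf _)); exact: ext_graph_linear.
pose F : {linear L2 mu -> L2 nu} := HB.pack f (GRing.isLinear.Build _ _ _ _ f flin).
exists F; split; last first.
  move=> i; apply: (ext_graph_unique (hf _)) => e e0; exists [:: (1, i)].
  by rewrite /comb !big_seq1 !scale1r !subrr !normL20; split; exact: ltW.
have nF u : normsq (F u) = normsq u.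
  by rewrite -!normL2_sq; congr (_ ^+ 2); exact: ext_graph_normL2.
have reF u v : Re (dotL2 (F u) (F v)) = Re (dotL2 u v).
  have := normsqD (F u) (F v); have := normsqD u v.
  by rewrite -linearD !nF; lra.
move=> u v; apply: complexP; first exact: reF.
(* Real parts are determined by norms; the imaginary part at [u] is read off from the real part at
   [i u]. *)
have := reF ('i%C *: u) v; rewrite [F (_ *: u)](linearZ_LR F) !dotL2Zl.
have iM (z : R[i]) : Re ('i%C * z) = - Im z by case: z => a b /=;
    rewrite mul0r mul1r sub0r.
by rewrite !iM => /oppr_inj.
Qed.

End IsometryExtension.

(** Real and imaginary parts are estimated separately, which costs a constant. A bound on the
    Fourier integral uniform in the frequency is all that is drawn from it. *)
Lemma normc_cintegral_le d (T : measurableType d) (R : realType)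
    (m : {measure set T -> \bar R}) (f : T -> R[i]) : cintegrable m f ->
  normc (cintegral m f) <= 2 * \int[m]_x normc (f x).
Proof.
move=> fi; have ni := cintegrable_normc fi; case: (fi) => f1 f2.
have h (g : T -> R) : m.-integrable setT (EFin \o g) -> (forall x,
    `|g x| <= normc (f x)) ->
    `|\int[m]_x g x| <= \int[m]_x normc (f x).
  move=> gi gf; apply: (le_trans (le_normr_Rintegral _ gi)) => //.
  by apply: le_Rintegral => //; exact: integrable_norm gi.
have a1 := h _ f1 (fun x => normr_Re_le (f x)).
have a2 := h _ f2 (fun x => normr_Im_le (f x)).
set I := \int[m]_x normc (f x) in a1 a2 *.
have I0 : 0 <= I by exact: le_trans a1.
rewrite -ler_sqr ?nnegrE ?normc_ge0 ?mulr_ge0// normc_sq.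
rewrite -[Re _ ^+ 2]real_normK ?num_real// -[Im _ ^+ 2]real_normK ?num_real//.
apply: (@le_trans _ _ (I ^+ 2 + I ^+ 2)); first by rewrite lerD// lerXn2r// ?nnegrE.
by rewrite exprMn; have := sqr_ge0 I; lra.
Qed.

Section Plancherel.
Context (R : realType) (n : nat).
Local Notation pt := (n.-tuple R).
Local Notation leb := (@lebesgue R n).
Local Notation dual := (@dual_lebesgue R n).
Implicit Types (f g : pt -> R[i]) (c : n.-tuple (R * R)).

Lemma cintegral_dual f : cintegrable leb f ->
  cintegrable dual f /\ cintegral dual f = ((2 * pi) ^- n)%:C%C * cintegral leb f.
Proof. by move=> fi; split; [exact: cintegrable_mscale|exact:
    cintegral_mscale]. Qed.

Lemma sqintegrable_dual f : sqintegrable leb f -> sqintegrable dual f.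
Proof. exact: sqintegrable_mscale. Qed.

Lemma cintegrable_fourier_kernel f c : cintegrable leb f ->
  cintegrable (leb \x leb)%E (fun z => expi (dotRn z.1 z.2) * f z.1 * boxf c z.2).
Proof.
move=> fi; have ti := cintegrable_tensor fi (cintegrable_boxf c).
apply: (cintegrable_bounded _ (cintegrable_normc ti)).
  under eq_fun do rewrite -mulrA.
  apply: cmeasurableM; last exact: cintegrable_cmeasurable ti.
  apply: (@cmeasurable_comp _ _ _ _ _ expi (fun z : pt * pt => dotRn z.1 z.2));
      last exact: cmeasurable_expi.
  rewrite /dotRn; apply: measurable_sum => i; apply: measurable_funM.
    exact: (measurableT_comp (@measurable_tnth _ R n i) measurable_fst).
  exact: (measurableT_comp (@measurable_tnth _ R n i) measurable_snd).
by move=> z; rewrite -mulrA normcM normc_expi mul1r.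
Qed.

Lemma cmeasurable_expi_dot (x : pt) : cmeasurable (fun y : pt => expi (dotRn y x)).
Proof.
apply: (@cmeasurable_comp _ _ _ _ _ expi (fun y : pt => dotRn y x));
    last exact: cmeasurable_expi.
rewrite /dotRn; apply: measurable_sum => i; apply: measurable_funM => //.
exact: (@measurable_tnth _ R n i).
Qed.

Lemma cintegrable_expiM f (x : pt) : cintegrable leb f ->
  cintegrable leb (fun y => expi (dotRn y x) * f y).
Proof.
move=> fi; apply: (cintegrable_bounded _ (cintegrable_normc fi)).
  apply: cmeasurableM; [exact: cmeasurable_expi_dot|exact:
      cintegrable_cmeasurable fi].
by move=> z; rewrite normcM normc_expi mul1r.
Qed.

Lemma dotRnC (x y : pt) : dotRn x y = dotRn y x.
Proof. by apply: eq_bigr => i _; rewrite mulrC. Qed.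

Lemma cintegrable_fourier_box f c : cintegrable leb f ->
  cintegrable leb (fun xi => fourier_integral f xi * boxf c xi).
Proof.
move=> fi; set C := 2 * \int[leb]_x normc (f x).
have mf : cmeasurable (fourier_integral f).
  exact/cmeasurable_fourier_integral/(cintegrable_cmeasurable fi).
have bi := cintegrableZ (C%:C)%C (cintegrable_boxf c).
apply: (cintegrable_bounded _ (cintegrable_normc bi)).
  by apply: cmeasurableM => //; exact: cintegrable_cmeasurable (cintegrable_boxf c).
move=> xi; rewrite !normcM ler_wpM2r ?normc_ge0//.
have := normc_cintegral_le (cintegrable_expiM xi fi).
rewrite -[cintegral _ _]/(fourier_integral f xi).
under eq_Rintegral do rewrite normcM normc_expi mul1r.
by move=> /le_trans; apply; exact: (le_trans (ler_norm C) (normr_Re_le C%:C%C)).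
Qed.

(** The multiplication formula: Fubini with a symmetric kernel. The factor [boxf c] makes the kernel
    integrable on the product, and its transform is the explicit [boxhat c]. *)
Lemma fourier_multiplication f c : cintegrable leb f ->
  cintegral leb (fun xi => fourier_integral f xi * boxf c xi) =
  cintegral leb (fun x => f x * boxhat c x).
Proof.
move=> fi; have ki := cintegrable_fourier_kernel c fi.
have e1 := cintegral_prod12 ki; have e2 := cintegral_prod21 ki.
transitivity (cintegral (leb \x leb)%E (fun z =>
    expi (dotRn z.1 z.2) * f z.1 * boxf c z.2)).
  rewrite -e2 => [|y]/=.
    congr (cintegral _ _); apply/funext => y /=.
    under [in RHS]eq_fun do rewrite mulrC.
    by rewrite cintegralZ; [rewrite mulrC|exact: cintegrable_expiM].
  under eq_fun do rewrite mulrC; apply: cintegrableZ; exact: cintegrable_expiM.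
rewrite -e1 => [|x]/=.
  congr (cintegral _ _); apply/funext => x /=.
  under eq_fun do rewrite mulrAC mulrC dotRnC.
  rewrite cintegralZ; last exact/cintegrable_expiM/cintegrable_boxf.
  by rewrite -[X in _ * X]/(fourier_integral (boxf c) x) fourier_integral_boxf.
under eq_fun do rewrite mulrAC mulrC dotRnC.
by apply: cintegrableZ; exact/cintegrable_expiM/cintegrable_boxf.
Qed.

Let k : R := (2 * pi) ^- n.
(** [s] and [s'] are the box indicators in position and in frequency space; [t] and [t'] are their
    direct and inverse transforms. *)
Let s c := L2class leb (boxf c).
Let t c := L2class dual (boxhat c).
Let s' c := L2class dual (boxf c).
(** The inverse transform of a real function is the conjugate of the direct one, scaled by
    [(2 pi)^-n]. *)
Let inv_boxhat c := fun x => k%:C%C * conjc (boxhat c x).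
Let t' c := L2class leb (inv_boxhat c).

Lemma k_unit : k * (2 * pi) ^+ n = 1.
Proof. by rewrite mulVf// expf_neq0// mulf_neq0// gt_eqF// pi_gt0. Qed.

Lemma sqintegrable_inv_boxhat c : sqintegrable leb (inv_boxhat c).
Proof.
have := sqintegrable_lin k%:C%C (sqintegrable_conjc (sqintegrable_boxhat c))
    (sqintegrable0 leb).
by congr sqintegrable; apply/funext => x; rewrite addr0.
Qed.

Lemma boxf_dotC c c' : conjc (cintegral leb (fun x =>
    boxf c x * conjc (boxf c' x))) =
  cintegral leb (fun x => boxf c x * conjc (boxf c' x)).
Proof.
rewrite -cintegral_conjc; last first.
  by apply: cintegrableM; [|apply: sqintegrable_conjc]; exact: sqintegrable_boxf.
congr (cintegral _ _); apply/funext => x; rewrite !boxfE.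
by apply: complexP; rewrite !reimE/=; ring.
Qed.

Lemma boxhat_isometry c c' : dotL2 (t c) (t c') = dotL2 (s c) (s c').
Proof.
have [i e] := boxhat_dot c c'.
rewrite !dotL2E; last 4 first.
- exact: sqintegrable_boxf.
- exact: sqintegrable_boxf.
- exact/sqintegrable_dual/sqintegrable_boxhat.
- exact/sqintegrable_dual/sqintegrable_boxhat.
by rewrite (cintegral_dual i).2 e mulrA -rmorphM/= k_unit mul1r.
Qed.

Lemma inv_boxhat_isometry c c' : dotL2 (t' c) (t' c') = dotL2 (s' c) (s' c').
Proof.
have [i e] := boxhat_dot c c'.
rewrite !dotL2E; last 4 first.
- exact/sqintegrable_dual/sqintegrable_boxf.
- exact/sqintegrable_dual/sqintegrable_boxf.
- exact: sqintegrable_inv_boxhat.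
- exact: sqintegrable_inv_boxhat.
rewrite (cintegral_dual _).2; last first.
  by apply: cintegrableM; [|apply: sqintegrable_conjc]; exact: sqintegrable_boxf.
transitivity (cintegral leb (fun x => (k * k)%:C%C * conjc (boxhat c x * conjc
    (boxhat c' x)))).
  have kc : conjc k%:C%C = k%:C%C by apply: complexP; rewrite /= ?oppr0.
  congr (cintegral _ _); apply/funext => x; rewrite /inv_boxhat.
  by rewrite !conjcM !conjcK kc mulrACA -rmorphM.
rewrite cintegralZ.
  rewrite cintegral_conjc// e conjcM boxf_dotC mulrA; congr (_ * _).
  apply: complexP; rewrite !reimE /=; last by ring.
  by rewrite mul0r subr0 -mulrA k_unit mulr1.
have := cintegrableM (sqintegrable_conjc (sqintegrable_boxhat c))
    (sqintegrable_boxhat c').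
by congr cintegrable; apply/funext => x; rewrite conjcM conjcK.
Qed.

Lemma total_boxf : total_family s.
Proof. by apply: total_family_box => c; exact: sqintegrable_boxf. Qed.

Lemma total_boxf_dual : total_family s'.
Proof. by apply: total_family_box => c;
    exact/sqintegrable_dual/sqintegrable_boxf. Qed.

Lemma dot_inv_boxhat f c : sqintegrable leb f -> cintegrable leb f ->
  dotL2 (L2class leb f) (t' c) =
  cintegral dual (fun xi => fourier_integral f xi * boxf c xi).
Proof.
move=> fs fi; rewrite dotL2E//; last exact: sqintegrable_inv_boxhat.
rewrite (cintegral_dual (cintegrable_fourier_box c fi)).2 fourier_multiplication//.
rewrite -cintegralZ; last exact: (cintegrableM fs (sqintegrable_boxhat c)).
congr (cintegral _ _); apply/funext => x; rewrite /inv_boxhat conjcM conjcK mulrCA.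
by congr (_ * _); apply: complexP; rewrite /= ?oppr0.
Qed.

Lemma dot_boxf_dual f c : sqintegrable dual f ->
  dotL2 (L2class dual f) (s' c) = cintegral dual (fun xi => f xi * boxf c xi).
Proof.
move=> fs; rewrite dotL2E//; last exact/sqintegrable_dual/sqintegrable_boxf.
congr (cintegral _ _); apply/funext => x; congr (_ * _).
by rewrite boxfE; apply: complexP; rewrite /= ?oppr0.
Qed.

Section Transform.
Variable F : {linear L2 leb -> L2 dual}.
Hypothesis Fiso : forall u v, dotL2 (F u) (F v) = dotL2 u v.
Hypothesis Fs : forall c, F (s c) = t c.

Lemma normL2_isometry u : normL2 (F u) = normL2 u.
Proof.
have := Fiso u u; rewrite !dotL2_self => -[] e.
by apply: (pexpIrn (n := 2)); rewrite // ?nnegrE ?normL2_ge0// !normL2_sq.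
Qed.

(** On box indicators this is the multiplication formula; density and the isometry property of [F]
    extend it. It identifies the adjoint of [F] on boxes before surjectivity is known. *)
Lemma transform_adjoint u c : dotL2 (F u) (s' c) = dotL2 u (t' c).
Proof.
have B c0 : dotL2 (F (s c0)) (s' c) = dotL2 (s c0) (t' c).
  rewrite Fs dot_inv_boxhat; [|exact: sqintegrable_boxf|exact: cintegrable_boxf].
  rewrite /t dot_boxf_dual; last exact/sqintegrable_dual/sqintegrable_boxhat.
  by congr (cintegral _ _); apply/funext => x; rewrite fourier_integral_boxf.
have Bl l : dotL2 (F (comb s l)) (s' c) = dotL2 (comb s l) (t' c).
  rewrite /comb linear_sum !dotL2_suml; apply: eq_bigr => p _.
  by rewrite linearZ_LR !dotL2Zl B.
apply/eqP; rewrite -subr_eq0; apply/eqP/eq0_normc/eqP.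
rewrite eq_le normc_ge0 andbT; apply/ler_addgt0Pr => e e0; rewrite add0r.
set C := normL2 (s' c) + normL2 (t' c) + 1.
have [a0 b0] : 0 <= normL2 (s' c) /\ 0 <= normL2 (t' c) by rewrite !normL2_ge0.
have C0 : 0 < C by rewrite /C; lra.
have [l hl] := total_family_dense u total_boxf (divr_gt0 e0 C0).
have -> : dotL2 (F u) (s' c) - dotL2 u (t' c) =
    dotL2 (F (u - comb s l)) (s' c) - dotL2 (u - comb s l) (t' c).
  by rewrite linearB/= !dotL2Bl Bl; ring.
set w := u - _ in hl *.
apply: (@le_trans _ _ (normL2 w * normL2 (s' c) + normL2 w * normL2 (t' c))).
  rewrite (le_trans (le_normcD _ _))// normcN lerD//.
    by rewrite -(normL2_isometry w) dotL2_cauchy_schwarz.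
  exact: dotL2_cauchy_schwarz.
rewrite -mulrDr (le_trans (ler_wpM2r _ hl)) ?addr_ge0//.
by rewrite mulrAC ler_pdivrMr// ler_wpM2l ?(ltW e0)// /C lerDl.
Qed.

(** The isometry [G] that extends the inverse transform is a right inverse: [F (G w)] and [w] have
    equal inner products with all boxes. *)
Lemma transform_surjective w : exists u, F u = w.
Proof.
have [G [Giso Gs]] := isometry_extension inv_boxhat_isometry total_boxf_dual.
exists (G w); apply/eqP; rewrite -subr_eq0; apply/eqP/total_boxf_dual => c.
by rewrite dotL2Bl transform_adjoint -Gs Giso subrr.
Qed.

(** [F] applied to the class of [f] and the Fourier integral of [f] have the same integral over
    every box, so they agree almost everywhere. This is also why the Fourier integral is square
    integrable, without which its [L2class] would be a default value. *)
Lemma transformE f : sqintegrable leb f -> cintegrable leb f ->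
  sqintegrable dual (fourier_integral f) /\
  F (L2class leb f) = L2class dual (fourier_integral f).
Proof.
move=> fs fi; set w := F _.
have mf : cmeasurable (fourier_integral f).
  exact/cmeasurable_fourier_integral/(cintegrable_cmeasurable fi).
have wi c : cintegrable dual (fun x => repr w x * boxf c x).
  apply: cintegrableM; first exact: repr_sqintegrable.
  exact/sqintegrable_dual/sqintegrable_boxf.
have bi c := (cintegral_dual (cintegrable_fourier_box c fi)).1.
have dE c : (fun x => (repr w x - fourier_integral f x) * boxf c x) =
    fun x => -1 * (fourier_integral f x * boxf c x) + repr w x * boxf c x.
  by apply/funext => x; ring.
have z : {ae dual, forall x, repr w x - fourier_integral f x = 0}.
  apply: box_cintegral_eq0 => [|c|c].
  - by apply: cmeasurableB => //; exact: repr_cmeasurable.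
  - by rewrite dE; exact: cintegrable_lin.
  - rewrite dE cintegral_lin// -(dot_boxf_dual c (repr_sqintegrable w)).
    by rewrite L2class_repr transform_adjoint dot_inv_boxhat// mulN1r addNr.
have e : {ae dual, forall x, repr w x = fourier_integral f x}.
  by apply: filterS z => x /eqP; rewrite subr_eq0 => /eqP.
have sf : sqintegrable dual (fourier_integral f).
  have [mw wlt] := repr_sqintegrable w; split => //.
  have <- // : (\int[dual]_x (normc (repr w x) ^+ 2)%:E =
    \int[dual]_x (normc (fourier_integral f x) ^+ 2)%:E)%E.
  apply: ge0_ae_eq_integral => //.
  - exact: measurable_normcX2.
  - exact: measurable_normcX2.
  - by move=> x _; rewrite lee_fin sqr_ge0.
  - by move=> x _; rewrite lee_fin sqr_ge0.
  - by apply: filterS e => x -> _.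
split => //; rewrite -(L2class_repr w); apply/L2class_eq => //.
exact: repr_sqintegrable.
Qed.

End Transform.

(** The isometry extended from boxes satisfies [is_fourier], so the choice that defines [fourier] is
    not the zero map. *)
Lemma fourier_is_fourier : is_fourier (@fourier R n) /\
  forall f, sqintegrable leb f -> cintegrable leb f ->
    sqintegrable dual (fourier_integral f).
Proof.
have [F [Fiso Fs]] := isometry_extension boxhat_isometry total_boxf.
have FF : is_fourier F.
  split => //; last exact: transform_surjective.
  by move=> f fs fi; case: (transformE Fiso Fs fs fi).
split; last by move=> f fs fi; case: (transformE Fiso Fs fs fi).
rewrite /fourier /chooseor; case: pselect => [h|]; last by case; exists F.
exact: projT2 (cid h).
Qed.

End Plancherel.

(** * The interpolation inequality for step functions *)

Section MulOp.
Context d (T : measurableType d) (R : realType) (mu : {measure set T -> \bar R}).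
Implicit Types (phi psi : T -> R[i]) (u v : L2 mu).

Definition cbounded phi := cmeasurable phi /\ exists M : R, forall x,
    normc (phi x) <= M.

Definition mul_op phi u : L2 mu := L2class mu (fun x => phi x * repr u x).

Lemma sqintegrable_mul_op phi u : cbounded phi ->
  sqintegrable mu (fun x => phi x * repr u x).
Proof.
by move=> [mp [M hM]]; apply: (sqintegrable_mul mp hM); exact: repr_sqintegrable.
Qed.

Lemma repr_mul_op phi u : cbounded phi ->
  {ae mu, forall x, repr (mul_op phi u) x = phi x * repr u x}.
Proof. by move=> bp; apply: repr_L2class; exact: sqintegrable_mul_op. Qed.

Lemma mul_op_lin a phi psi u : cbounded phi -> cbounded psi ->
  mul_op (fun x => a * phi x + psi x) u = a *: mul_op phi u + mul_op psi u.
Proof.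
move=> bp bs; rewrite /mul_op -L2class_lin; [|exact: sqintegrable_mul_op..].
by congr (L2class _ _); apply/funext => x; rewrite mulrDl mulrA.
Qed.

Lemma mul_opD phi psi u : cbounded phi -> cbounded psi ->
  mul_op (fun x => phi x + psi x) u = mul_op phi u + mul_op psi u.
Proof.
move=> bp bs; rewrite -[mul_op phi u]scale1r -mul_op_lin//.
by congr (mul_op _ u); apply/funext => x; rewrite mul1r.
Qed.

Lemma normsq_mul_op_le phi u (M : R) : cmeasurable phi ->
  (forall x, normc (phi x) ^+ 2 <= M) -> normsq (mul_op phi u) <= M * normsq u.
Proof.
move=> mp hM.
have M0 : 0 <= M by apply: le_trans (hM point); exact: sqr_ge0.
have bp : cbounded phi.
  split => //; exists (Num.sqrt M) => x.
  by rewrite -[leLHS]ger0_norm ?normc_ge0// -sqrtr_sqr ler_wsqrtr.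
have si := repr_sqintegrable u.
rewrite -lee_fin EFinM normsq_class; last exact: sqintegrable_mul_op.
rewrite normsqE -ge0_integralZl_EFin//; last 2 first.
- by move=> x _; rewrite lee_fin sqr_ge0.
- by apply: measurable_normcX2; exact: repr_cmeasurable.
apply: ge0_le_integral => //.
- by move=> x _; rewrite lee_fin sqr_ge0.
- by apply: measurable_normcX2; exact: (sqintegrable_mul_op _ bp).1.
- by apply: measurable_funeM; apply: measurable_normcX2; exact: repr_cmeasurable.
- by move=> x _; rewrite -EFinM lee_fin normc_sqM ler_wpM2r// sqr_ge0.
Qed.

End MulOp.

Section MainBound.
Context (R : realType) (n : nat).
Local Notation pt := (n.-tuple R).
Local Notation leb := (@lebesgue R n).
Local Notation dual := (@dual_lebesgue R n).
Local Notation F := (@fourier R n).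

Lemma fourier_dot u v : dotL2 (F u) (F v) = dotL2 u v.
Proof. by have [[_ ->]] := fourier_is_fourier R n. Qed.

Lemma fourier_surjective w : exists u, F u = w.
Proof. by have [[_ _ h] _] := fourier_is_fourier R n; exact: h. Qed.

Lemma fourier_class (f : pt -> R[i]) : sqintegrable leb f -> cintegrable leb f ->
  F (L2class leb f) = L2class dual (fourier_integral f).
Proof. by have [[h _ _] _] := fourier_is_fourier R n; exact: h. Qed.

Lemma sqintegrable_fourier_integral (f : pt -> R[i]) : sqintegrable leb f ->
  cintegrable leb f -> sqintegrable dual (fourier_integral f).
Proof. by have [_] := fourier_is_fourier R n; apply. Qed.

Lemma normsq_fourier u : normsq (F u) = normsq u.
Proof. by have := fourier_dot u u; rewrite !dotL2_self => -[]. Qed.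

(** The squared Hilbert-Schmidt norm of [sum_k |g_k><g_k|], expressed through the Gram matrix. *)
Definition gram_sq (N : nat) (g : 'I_N -> L2 leb) : R :=
  \sum_(k < N) \sum_(l < N) normc (dotL2 (g k) (g l)) ^+ 2.

(* For fixed frequency the sum over k is an inner product with a function whose norm
   does not depend on the frequency. *)
Lemma fourier_pairing_bound (N : nat) (g : 'I_N -> L2 leb) (w : pt ->
    R[i]) (t : pt -> R[i])
    (W V : R) : cbounded w -> cbounded t ->
  (\int[leb]_x (normc (w x) ^+ 2)%:E = W%:E)%E ->
  (\int[dual]_x (normc (t x) ^+ 2)%:E = V%:E)%E ->
  normc (\sum_(k < N) dotL2 (F (mul_op w (g k))) (mul_op t (F (g k)))) ^+ 2
    <= W * V * gram_sq g.
Proof.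
move=> bw bt eW eV.
have sw : sqintegrable leb w by split; [exact: bw.1|rewrite eW ltry].
have st : sqintegrable dual t by split; [exact: bt.1|rewrite eV ltry].
pose f k := fun x => w x * repr (g k) x.
have sf k : sqintegrable leb (f k) by exact: sqintegrable_mul_op.
have fi k : cintegrable leb (f k) by apply: cintegrableM => //;
    exact: repr_sqintegrable.
pose h k := repr (F (g k)).
pose Psi (xi : pt) : R[i] := \sum_(k < N) fourier_integral (f k) xi * conjc (h
    k xi).
pose G (xi : pt) : L2 leb := \sum_(k < N) conjc (h k xi) *: g k.
(* Pairing [g k] with [om xi] gives the transform of [w g_k] at [xi], so [Psi xi] is the inner
   product of [G xi] and [om xi], and the modulus of [om xi] is that of [w]. *)
pose om (xi : pt) := fun x => conjc (w x * expi (dotRn x xi)).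
have mpsi : cmeasurable Psi.
  apply: cmeasurable_sum => k; apply: cmeasurableM.
    by have [] := sqintegrable_fourier_integral (sf k) (fi k).
  by apply: cmeasurable_conjc; exact: repr_cmeasurable.
have nom xi x : normc (om xi x) = normc (w x).
  by rewrite /om normc_conjc normcM normc_expi mulr1.
have som xi : sqintegrable leb (om xi).
  split; last by under eq_integral do rewrite nom; rewrite eW ltry.
  apply: cmeasurable_conjc; apply: cmeasurableM; [exact: bw.1|].
  exact: cmeasurable_expi_dot.
have psiE xi : Psi xi = dotL2 (G xi) (L2class leb (om xi)).
  rewrite /G dotL2_suml /Psi; apply: eq_bigr => k _.
  rewrite dotL2Zl mulrC; congr (_ * _).
  rewrite -{1}(L2class_repr (g k)) dotL2E//; last exact: repr_sqintegrable.
  congr (cintegral _ _); apply/funext => x; rewrite /om /f conjcK.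
  by rewrite -[Complex _ _]/(expi (dotRn x xi)); ring.
(* [Re (Q xi)] is [|G xi|^2]. Integrating over [xi] turns the products of [h l] and [h k] into inner
   products of [g l] and [g k] by unitarity, which leaves [gram_sq g]. *)
pose Q (xi : pt) : R[i] := \sum_(k < N) \sum_(l < N) (h l xi * conjc (h k xi))
    * dotL2 (g k) (g l).
have normG xi : normsq (G xi) = Re (Q xi).
  have := dotL2_self (G xi); rewrite /G dotL2_suml => e.
  rewrite -[LHS]/(Re (normsq (G xi))%:C%C) /G -e; congr Re.
  apply: eq_bigr => k _; rewrite dotL2Zl dotL2_sumr mulr_sumr.
  by apply: eq_bigr => l _; rewrite dotL2Zr conjcK; ring.
have iQ : cintegrable dual Q /\ cintegral dual Q = (gram_sq g)%:C%C.
  have i2 k l : cintegrable dual (fun xi => h l xi * conjc (h k xi) * dotL2 (g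
      k) (g l)).
    under eq_fun do rewrite mulrC; apply: cintegrableZ; exact: cintegrable_dot.
  have i1 k := cintegral_sum (index_enum 'I_N) (fun l => i2 k l).
  have [i0 e0] := cintegral_sum (index_enum 'I_N) (fun k => (i1 k).1).
  split => //; rewrite e0 /gram_sq rmorph_sum; apply: eq_bigr => k _.
  rewrite (i1 k).2 rmorph_sum; apply: eq_bigr => l _.
  under eq_fun do rewrite mulrC; rewrite cintegralZ; last exact: cintegrable_dot.
  rewrite -[cintegral _ _]/(dotL2 (F (g l)) (F (g k))) fourier_dot.
  by rewrite (dotL2C (g k)) mulc_conjc.
have W0 : 0 <= W by rewrite -lee_fin -eW; apply: integral_ge0 => x _;
    rewrite lee_fin sqr_ge0.
have psile xi : normc (Psi xi) ^+ 2 <= W * Re (Q xi).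
  rewrite psiE; apply: (le_trans (lerXn2r 2 _ _ (dotL2_cauchy_schwarz _ _))).
  - by rewrite nnegrE normc_ge0.
  - by rewrite nnegrE mulr_ge0// normL2_ge0.
  rewrite exprMn !normL2_sq normG mulrC le_eqVlt; apply/orP; left; apply/eqP.
  congr (_ * _); apply/EFin_inj; rewrite normsq_class// -eW.
  by apply: eq_integral => x _; rewrite nom.
have spsi : sqintegrable dual Psi /\ normsq (L2class dual Psi) <= W * gram_sq g.
  have [[iQ1 _] eQ] := iQ.
  have le1 : (\int[dual]_x (normc (Psi x) ^+ 2)%:E <= (W * gram_sq g)%:E)%E.
    rewrite EFinM (_ : (gram_sq g)%:E = \int[dual]_x (Re (Q x))%:E)%E; last first.
      have := congr1 (@complex.Re R) eQ; rewrite /cintegral /Rintegral /= => <-.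
      by rewrite fineK//; exact: integrable_fin_num iQ1.
    rewrite -ge0_integralZl_EFin//; last 2 first.
    - by move=> x _; rewrite lee_fin -normG normsq_ge0.
    - exact: measurable_int iQ1.
    apply: ge0_le_integral => //.
    - by move=> x _; rewrite lee_fin sqr_ge0.
    - exact: measurable_normcX2.
    - by apply: measurable_funeM; exact: measurable_int iQ1.
    - by move=> x _; rewrite -EFinM lee_fin.
  have s : sqintegrable dual Psi by split => //; rewrite (le_lt_trans le1)// ltry.
  by split => //; rewrite -lee_fin normsq_class.
have -> : \sum_(k < N) dotL2 (F (mul_op w (g k))) (mul_op t (F (g k))) =
    dotL2 (L2class dual Psi) (L2class dual t).
  rewrite [RHS]dotL2E//; last exact: spsi.1.
  have dE k : dotL2 (F (mul_op w (g k))) (mul_op t (F (g k))) =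
     cintegral dual (fun xi => fourier_integral (f k) xi * conjc (t xi * h k xi)).
    rewrite [F _](fourier_class (sf k) (fi k)).
    exact: (dotL2E (sqintegrable_fourier_integral (sf k) (fi k))
        (sqintegrable_mul_op _ bt)).
  under eq_bigr do rewrite dE.
  have ik k : cintegrable dual (fun xi => fourier_integral (f k) xi * conjc (t
      xi * h k xi)).
    apply: cintegrableM; first exact: sqintegrable_fourier_integral.
    by apply: sqintegrable_conjc; exact: sqintegrable_mul_op.
  have [_ <-] := cintegral_sum (index_enum 'I_N) ik.
  congr (cintegral _ _); apply/funext => xi; rewrite /Psi mulr_suml.
  by apply: eq_bigr => k _; rewrite conjcM; ring.
apply: (le_trans (lerXn2r 2 _ _ (dotL2_cauchy_schwarz _ _))).
- by rewrite nnegrE normc_ge0.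
- by rewrite nnegrE mulr_ge0// normL2_ge0.
have nt : normL2 (L2class dual t) ^+ 2 = V.
  by apply/EFin_inj; rewrite normL2_sq normsq_class.
have := spsi.2; rewrite -(normL2_sq (L2class dual Psi)) -nt.
move: (gram_sq g) (normL2 (L2class dual Psi)) (normL2 (L2class dual t)) =>
    S x y le_x.
by rewrite exprMn (mulrAC W) ler_wpM2r ?sqr_ge0.
Qed.

End MainBound.

Lemma dot_chi_self d (T : measurableType d) (R : realType) (mu : {measure set T
    -> \bar R})
    (A : set T) (u : L2 mu) : measurable A ->
  dotL2 (chi A u) u = (normsq (chi A u))%:C%C.
Proof.
move=> mA; have e := chiI u mA mA; rewrite setIid in e.
apply: etrans (dotL2_self (chi A u)); apply: etrans (dot_chi u u mA) _.
by apply: etrans (esym (dot_chi u (chi A u) mA)); rewrite e.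
Qed.

Section StepOperator.
Context d (T : measurableType d) (R : realType) (mu : {measure set T -> \bar R}).
Context (m : nat) (ia : T -> 'I_m.+1).
Implicit Types (s : 'I_m.+1 -> R[i]) (u : L2 mu).

(** A finite partition is given by an index function into a nonempty ordinal; the cell of [ord0] is
    reserved for the region of small density. *)
Definition fiber i : set T := ia @^-1` [set i].
Hypothesis mia : forall i, measurable (fiber i).

Lemma indic_fiber i x : \1_(fiber i) x = (ia x == i)%:R :> R.
Proof. by rewrite indicE; congr (_%:R); congr nat_of_bool; apply/idP/eqP;
    rewrite inE. Qed.

Lemma step_sum s x : s (ia x) = \sum_i s i * (\1_(fiber i) x)%:C%C.
Proof.
rewrite (bigD1 (ia x))//= indic_fiber eqxx mulr1 big1 ?addr0// => i ix.
by rewrite indic_fiber eq_sym (negbTE ix) mulr0.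
Qed.

Lemma cbounded_step s : cbounded (fun x => s (ia x)).
Proof.
split.
  under eq_fun do rewrite step_sum; apply: cmeasurable_sum => i.
  by apply: cmeasurableM; [exact: cmeasurable_cst|exact: cmeasurable_indic].
exists (\sum_i normc (s i)) => x.
by rewrite (bigD1 (ia x))//= lerDl sumr_ge0// => i _; exact: normc_ge0.
Qed.

Lemma mul_op_step s u : mul_op (fun x => s (ia x)) u = \sum_i s i *: chi (fiber
    i) u.
Proof.
apply: L2eq.
have hc : {ae mu, forall x, forall i, repr (chi (fiber i) u) x = (\1_(fiber i)
    x)%:C%C * repr u x}.
  suff: {ae mu, forall x, forall i, i \in index_enum 'I_m.+1 ->
      repr (chi (fiber i) u) x = (\1_(fiber i) x)%:C%C * repr u x}.
    by apply: filterS => x h i; apply: h; rewrite mem_index_enum.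
  elim: (index_enum _) => [|i r IH]; first by apply: aeW => x i.
  apply: filterS2 (repr_chi u (mia i)) IH => x h1 h2 j.
  by rewrite inE => /orP[/eqP ->//|]; exact: h2.
apply: filterS2 (filterI (repr_mul_op u (cbounded_step s)) hc)
  (repr_sum (index_enum _) s (fun i => chi (fiber i) u)) => x [-> h] ->.
by rewrite step_sum mulr_suml; apply: eq_bigr => i _; rewrite h mulrA.
Qed.

Lemma sum_chi_fiber u : \sum_i chi (fiber i) u = u.
Proof.
have := mul_op_step (fun _ => 1) u; under eq_bigr do rewrite scale1r; move=> <-.
rewrite /mul_op -[RHS]L2class_repr; congr (L2class _ _).
by apply/funext => x; rewrite mul1r.
Qed.

End StepOperator.

(** * The three lines theorem applied to the pairing of two partitions *)

Section KeyInequality.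
Context (R : realType) (n : nat).
Local Notation pt := (n.-tuple R).
Local Notation leb := (@lebesgue R n).
Local Notation dual := (@dual_lebesgue R n).
Local Notation F := (@fourier R n).
Context (N : nat) (g : 'I_N -> L2 leb).
Context (m p : nat) (ia : pt -> 'I_m.+1) (ib : pt -> 'I_p.+1).
Context (a : 'I_m.+1 -> R) (b : 'I_p.+1 -> R).
Hypothesis (mia : forall i, measurable (fiber ia i)) (mib : forall j,
    measurable (fiber ib j)).
Hypothesis (a0 : a ord0 = 0) (b0 : b ord0 = 0).
Implicit Types (s : 'I_m.+1 -> R[i]) (t : 'I_p.+1 -> R[i]).

Let massA i := \sum_(k < N) normsq (chi (fiber ia i) (g k)).
Let massB j := \sum_(k < N) normsq (chi (fiber ib j) (F (g k))).
Let tau := \sum_(k < N) normsq (g k).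

Let c i j := \sum_(k < N) dotL2 (F (chi (fiber ia i) (g k))) (chi (fiber ib j)
    (F (g k))).

(** [dotL2] conjugates its second argument, so the conjugate placed on [t] makes both symbols enter
    without conjugation, as analyticity in [z] demands. *)
Lemma pairing_step s t :
  \sum_(k < N) dotL2 (F (mul_op (fun x => s (ia x)) (g k)))
                     (mul_op (fun x => conjc (t (ib x))) (F (g k))) =
  \sum_i \sum_j c i j * (s i * t j).
Proof.
under eq_bigr => k _.
  rewrite mul_op_step// (mul_op_step mib (fun j => conjc (t j))).
  rewrite linear_sum dotL2_suml.
  under eq_bigr => i _.
    rewrite linearZ_LR dotL2Zl dotL2_sumr mulr_sumr.
    under eq_bigr do rewrite dotL2Zr conjcK.
    over.
  over.
rewrite exchange_big; apply: eq_bigr => i _; rewrite exchange_big;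
    apply: eq_bigr => j _.
by rewrite /c mulr_suml; apply: eq_bigr => k _ /=; ring.
Qed.

(** Summing out the frequency partition leaves [<chi g_k, g_k>] by unitarity. These marginals of [c]
    turn the derivative at [0] into the two weighted sums of masses. *)
Lemma sum_c_col i : \sum_j c i j = (massA i)%:C%C.
Proof.
rewrite /c exchange_big /massA rmorph_sum; apply: eq_bigr => k _.
by rewrite -dotL2_sumr sum_chi_fiber// fourier_dot dot_chi_self.
Qed.

Lemma sum_c_row j : \sum_i c i j = (massB j)%:C%C.
Proof.
rewrite /c exchange_big /massB rmorph_sum; apply: eq_bigr => k _.
by rewrite -dotL2_suml -linear_sum sum_chi_fiber// -dot_chi// dot_chi_self.
Qed.

Lemma sum_massA : \sum_i massA i = tau.
Proof.
rewrite /massA exchange_big; apply: eq_bigr => k _ /=.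
have : (\sum_i normsq (chi (fiber ia i) (g k)))%:C%C = (normsq (g k))%:C%C.
  transitivity (dotL2 (\sum_i chi (fiber ia i) (g k)) (g k)); last first.
    by rewrite sum_chi_fiber// dotL2_self.
  rewrite dotL2_suml rmorph_sum.
  by apply: eq_bigr => i _; rewrite /= dot_chi_self.
by case.
Qed.

Lemma sum_c : \sum_i \sum_j c i j = tau%:C%C.
Proof.
by under eq_bigr do rewrite sum_c_col; rewrite -rmorph_sum sum_massA.
Qed.

Lemma pairing_cauchy_schwarz (u : 'I_N -> L2 leb) (v : 'I_N -> L2 dual) :
  normc (\sum_k dotL2 (F (u k)) (v k)) ^+ 2 <=
  (\sum_k normsq (u k)) * \sum_k normsq (v k).
Proof.
have h : normc (\sum_k dotL2 (F (u k)) (v k)) <= \sum_k normL2 (u k) * normL2 (v k).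
  elim: (index_enum _) => [|k r IH]; first by rewrite !big_nil normc0.
  rewrite !big_cons (le_trans (le_normcD _ _))// lerD//.
  have -> : normL2 (u k) = normL2 (F (u k)) by rewrite /normL2 -!/(normsq _)
      normsq_fourier.
  exact: dotL2_cauchy_schwarz.
apply: (le_trans (lerXn2r 2 _ _ h)).
- by rewrite nnegrE normc_ge0.
- by rewrite nnegrE sumr_ge0// => k _; rewrite mulr_ge0// normL2_ge0.
have eu : \sum_k normsq (u k) = \sum_k normL2 (u k) ^+ 2.
  by apply: eq_bigr => k _; rewrite normL2_sq.
have ev : \sum_k normsq (v k) = \sum_k normL2 (v k) ^+ 2.
  by apply: eq_bigr => k _; rewrite normL2_sq.
by rewrite eu ev; exact: sum_cauchy_schwarz.
Qed.

(** [exp (l z)] at [z = x + i y]. *)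
Definition cexp (l x y : R) : R[i] :=
  Complex (expR (l * x) * cos (l * y)) (expR (l * x) * sin (l * y)).

Lemma cexpD l l' x y : cexp (l + l') x y = cexp l x y * cexp l' x y.
Proof.
by apply: complexP; rewrite !reimE /= !mulrDl expRD ?cosD ?sinD; ring.
Qed.

Lemma normc_cexp l x y : normc (cexp l x y) ^+ 2 = expR (2 * l * x).
Proof.
rewrite normc_sq /= !exprMn -mulrDr cos2Dsin2 mulr1 -expRM_natl.
by congr expR; ring.
Qed.

Let l (k : 'I_m.+1 * 'I_p.+1) := a k.1 / 2 + b k.2 / 2.

Lemma expsum_sq_pairing x y :
  expsum_sq (fun k : 'I_m.+1 * 'I_p.+1 => Re (c k.1 k.2)) (fun k =>
      Im (c k.1 k.2)) l x y =
  normc (\sum_i \sum_j c i j * (cexp (a i / 2) x y * cexp (b j / 2) x y)) ^+ 2.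
Proof.
rewrite pair_big/= normc_sq Re_sum Im_sum /expsum_sq; congr (_ ^+ 2 + _ ^+ 2).
- by apply: eq_bigr => k _; rewrite -cexpD !reimE/= /l; ring.
- by apply: eq_bigr => k _; rewrite -cexpD !reimE/= /l; ring.
Qed.

(** On [Re z = 1] each symbol is the indicator of the cell [ord0], where the weight is [0], plus a
    part supported on the other cells. The pairing splits into three: the position indicator against
    the whole frequency symbol, the rest against the frequency indicator, and the rest against the
    rest. Cauchy-Schwarz bounds two of them by the mass of a small cell, and [fourier_pairing_bound]
    bounds the third. *)
Lemma key_inequality (Ma Mb Wa Wb m1 : R) :
  0 < tau -> 0 < m1 ->
  (forall i, expR (a i) <= Ma) -> (forall j, expR (b j) <= Mb) ->
  (\int[leb]_x (if ia x == ord0 then 0 else expR (a (ia x)))%:E <= Wa%:E)%E ->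
  (\int[dual]_x (if ib x == ord0 then 0 else expR (b (ib x)))%:E <= Wb%:E)%E ->
  Num.sqrt (massA ord0 * (Mb * tau)) + Num.sqrt (Ma * tau * massB ord0) +
    Num.sqrt (Wa * Wb * gram_sq g) <= m1 ->
  \sum_i a i * massA i + \sum_j b j * massB j <= 2 * tau * ln (m1 / tau).
Proof.
move=> tau0 m10 aM bM hWa hWb hm1.
have := @expsum_derivative_le R _ (fun k : 'I_m.+1 * 'I_p.+1 =>
    Re (c k.1 k.2)) (fun k => Im (c k.1 k.2)) l tau m1 tau0 m10.
have nF : \sum_k normsq (F (g k)) = tau by apply: eq_bigr => k _;
    exact: normsq_fourier.
have bs x y : cbounded (fun z => cexp (a (ia z) / 2) x y).
  exact: (cbounded_step mia (fun i => cexp (a i / 2) x y)).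
have bt x y : cbounded (fun z => conjc (cexp (b (ib z) / 2) x y)).
  exact: (cbounded_step mib (fun i => conjc (cexp (b i / 2) x y))).
have usum phi (M : R) : cmeasurable phi -> (forall x, normc (phi x) ^+ 2 <= M) ->
    \sum_k normsq (mul_op phi (g k)) <= M * tau.
  by move=> mp hp; rewrite /tau mulr_sumr ler_sum// => k _; exact: normsq_mul_op_le.
have vsum phi (M : R) : cmeasurable phi -> (forall x, normc (phi x) ^+ 2 <= M) ->
    \sum_k normsq (mul_op phi (F (g k))) <= M * tau.
  by move=> mp hp; rewrite -nF mulr_sumr ler_sum// => k _; exact: normsq_mul_op_le.
have nsq_ge0 d (T : measurableType d) (mu : {measure set T ->
    \bar R}) (u : 'I_N -> L2 mu) :
    0 <= \sum_k normsq (u k) by rewrite sumr_ge0// => k _; exact: normsq_ge0.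
set C := (fun k => Re _); set D := (fun k => Im _) => H.
have h1 : forall y, expsum_sq C D l 0 y <= tau ^+ 2.
  move=> y; rewrite expsum_sq_pairing -pairing_step.
  apply: (le_trans (pairing_cauchy_schwarz _ _)); rewrite expr2.
  by apply: ler_pM => //; rewrite -[leRHS]mul1r; [apply: usum|apply: vsum];
    move=> *; rewrite ?normc_conjc ?normc_cexp ?mulr0 ?expR0//;
        [exact: (bs 0 y).1|exact: (bt 0 y).1].
have h2 : forall y, expsum_sq C D l 1 y <= m1 ^+ 2.
  move=> y; rewrite expsum_sq_pairing -pairing_step.
  pose s i := if i == ord0 then 0 else cexp (a i / 2) 1 y.
  pose t j := if j == ord0 then 0 else cexp (b j / 2) 1 y.
  have cexp0 : cexp (0 / 2) 1 y = 1 by rewrite /cexp !mul0r expR0 cos0 sin0 !mul1r.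
  have sE x : cexp (a (ia x) / 2) 1 y = (\1_(fiber ia ord0) x)%:C%C + s (ia x).
    rewrite indic_fiber /s; case: eqVneq => [->|_]; first by rewrite a0 cexp0 addr0.
    by rewrite add0r.
  have tE x : conjc (cexp (b (ib x) / 2) 1 y) = (\1_(fiber ib ord0) x)%:C%C +
      conjc (t (ib x)).
    rewrite indic_fiber /t; case: eqVneq => [->|_].
      by rewrite b0 cexp0; apply: complexP; rewrite !reimE/= ?oppr0 addr0.
    by rewrite add0r.
  have bind d (T : measurableType d) (A : set T) : measurable A ->
      cbounded (fun x => (\1_A x : R)%:C%C).
    by move=> mA; split; [exact: cmeasurable_indic|exists 1 => x;
        exact: normc_indic].
  have bS : cbounded (fun x => s (ia x)) by exact: (cbounded_step mia s).
  have bT : cbounded (fun x => conjc (t (ib x))).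
    exact: (cbounded_step mib (fun j => conjc (t j))).
  have uE k : mul_op (fun x => cexp (a (ia x) / 2) 1 y) (g k) =
      chi (fiber ia ord0) (g k) + mul_op (fun x => s (ia x)) (g k).
    rewrite -[chi _ _]/(mul_op (fun x => (\1_(fiber ia ord0) x)%:C%C) (g k)).
    rewrite -mul_opD//; last exact: bind.
    by congr (mul_op _ _); apply/funext => x; rewrite sE.
  have vE k : mul_op (fun x => conjc (cexp (b (ib x) / 2) 1 y)) (F (g k)) =
      chi (fiber ib ord0) (F (g k)) + mul_op (fun x => conjc (t (ib x))) (F (g k)).
    rewrite -[chi _ _]/(mul_op (fun x => (\1_(fiber ib ord0) x)%:C%C) (F (g k))).
    rewrite -mul_opD//; last exact: bind.
    by congr (mul_op _ _); apply/funext => x; rewrite tE.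
  have nt x : normc (conjc (cexp (b (ib x) / 2) 1 y)) ^+ 2 = expR (b (ib x)).
    by rewrite normc_conjc normc_cexp mulr1 mulrCA divff// mulr1.
  have ns0 x : normc (s (ia x)) ^+ 2 = if ia x == ord0 then 0 else expR (a (ia x)).
    rewrite /s; case: ifP => _; first by rewrite normc0 expr0n.
    by rewrite normc_cexp mulr1 mulrCA divff// mulr1.
  have nt0 x : normc (conjc (t (ib x))) ^+ 2 = if ib x == ord0 then 0 else expR
      (b (ib x)).
    rewrite normc_conjc /t; case: ifP => _; first by rewrite normc0 expr0n.
    by rewrite normc_cexp mulr1 mulrCA divff// mulr1.
  have ns x : normc (s (ia x)) ^+ 2 <= Ma.
    by rewrite ns0; case: ifP => // _; exact: le_trans (expR_ge0 _) (aM ord0).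
  have sq_le (z : R[i]) (B : R) : normc z ^+ 2 <= B -> normc z <= Num.sqrt B.
    by move=> zB; rewrite -[leLHS]ger0_norm ?normc_ge0// -sqrtr_sqr ler_wsqrtr.
  have fin d (T : measurableType d) (mu : {measure set T -> \bar R}) (f : T ->
      R) (B : R) :
      (forall x, 0 <= f x) -> (\int[mu]_x (f x)%:E <= B%:E)%E ->
      exists2 V : R, (\int[mu]_x (f x)%:E)%E = V%:E & V <= B.
    move=> f0 fB; have If : (0 <= \int[mu]_x (f x)%:E)%E.
      by apply: integral_ge0 => x _; rewrite lee_fin.
    exists (fine (\int[mu]_x (f x)%:E)); last first.
      by rewrite -lee_fin fineK// ge0_fin_numE// (le_lt_trans fB)// ltry.
    by rewrite fineK// ge0_fin_numE// (le_lt_trans fB)// ltry.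
  have [W eW WWa] := fin _ _ _ _ _ (fun x => sqr_ge0 (normc (s (ia x))))
      ltac:(by under eq_integral do rewrite ns0; exact: hWa).
  have [V eV VWb] := fin _ _ _ _ _ (fun x => sqr_ge0 (normc (conjc (t (ib
      x))))) ltac:(by under eq_integral do rewrite nt0; exact: hWb).
  have W0 : 0 <= W by rewrite -lee_fin -eW; apply: integral_ge0 => x _;
      rewrite lee_fin sqr_ge0.
  have V0 : 0 <= V by rewrite -lee_fin -eV; apply: integral_ge0 => x _;
      rewrite lee_fin sqr_ge0.
  have gram0 : 0 <= gram_sq g by apply: sumr_ge0 => k _; apply: sumr_ge0 =>
      k' _; exact: sqr_ge0.
  have tau1 := ltW tau0.
  rewrite lerXn2r// ?nnegrE ?normc_ge0 ?(ltW m10)//; apply: le_trans hm1.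
  set X := \sum_(k < N) _.
  have -> : X = \sum_k dotL2 (F (chi (fiber ia ord0) (g k))) (mul_op (fun x =>
      conjc (cexp (b (ib x) / 2) 1 y)) (F (g k)))
      + \sum_k dotL2 (F (mul_op (fun x => s (ia x)) (g k))) (chi (fiber ib
          ord0) (F (g k)))
      + \sum_k dotL2 (F (mul_op (fun x => s (ia x)) (g k))) (mul_op (fun x =>
          conjc (t (ib x))) (F (g k))).
    rewrite -!big_split; apply: eq_bigr => k _ /=.
    by rewrite uE linearD dotL2Dl {2}vE dotL2Dr addrA.
  apply: (le_trans (le_normcD _ _)); apply: lerD;
      [apply: (le_trans (le_normcD _ _)); apply: lerD|].
  - apply: sq_le; apply: (le_trans (pairing_cauchy_schwarz _ _));
      apply: ler_wpM2l => //.
    apply: vsum => [|x]; first exact: (bt 1 y).1.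
    by rewrite nt.
  - apply: sq_le; apply: (le_trans (pairing_cauchy_schwarz _ _));
      apply: ler_wpM2r => //.
    by apply: usum => //; exact: bS.1.
  - apply: sq_le; apply: (le_trans (fourier_pairing_bound _ bS bT eW eV)).
    by apply: ler_wpM2r => //; exact: ler_pM.
have h3 : \sum_k C k = tau.
  by have := congr1 (@complex.Re R) sum_c; rewrite pair_big Re_sum.
have := H h1 h2 h3.
(* The exponents are sums over the two indices, so each half of the derivative collapses to a
   marginal of [c]. *)
have -> : \sum_k C k * l k = (\sum_i a i * massA i + \sum_j b j * massB j) / 2.
  have eA : \sum_i a i * massA i = \sum_i \sum_j a i * Re (c i j).
    apply: eq_bigr => i _; rewrite -mulr_sumr; congr (_ * _).
    by have := congr1 (@complex.Re R) (sum_c_col i); rewrite Re_sum.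
  have eB : \sum_j b j * massB j = \sum_i \sum_j b j * Re (c i j).
    rewrite exchange_big; apply: eq_bigr => j _; rewrite -mulr_sumr; congr (_ * _).
    by have := congr1 (@complex.Re R) (sum_c_row j); rewrite Re_sum.
  rewrite eA eB -big_split /= mulr_suml.
  rewrite -(pair_bigA _ (fun i j => Re (c i j) * (a i / 2 + b j / 2)))/=.
  apply: eq_bigr => i _; rewrite -big_split mulr_suml; apply: eq_bigr => j _ /=.
  by move: (Re (c i j)) => z; ring.
by rewrite ler_pdivrMr// => /le_trans; apply; rewrite mulrC mulrA.
Qed.

End KeyInequality.

(** * Approximation of densities by step functions *)

Section Levels.
Context d (T : measurableType d) (R : realType) (mu : {measure set T -> \bar R}).
Context (p : T -> R) (tau : R).
Hypothesis p0 : forall x, 0 <= p x.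
Hypothesis mp : measurable_fun setT p.
Hypothesis ptau : (\int[mu]_x (p x)%:E = tau%:E)%E.

Lemma integrable_weight (f : T -> R) (B : R) : measurable_fun setT f ->
  (forall x, `|f x| <= B) -> mu.-integrable setT (fun x => (p x * f x)%:E).
Proof.
move=> mf fB.
have ip : mu.-integrable setT (fun x => (B * p x)%:E).
  under eq_fun do rewrite EFinM; apply: integrableZl => //.
  apply/integrableP; split; first exact/measurable_EFinP.
  by under eq_integral do rewrite gee0_abs ?lee_fin//; rewrite ptau ltry.
apply: (le_integrable _ _ _ ip) => //.
  by apply/measurable_EFinP; apply: measurable_funM.
move=> x _; rewrite lee_fin normrM (ger0_norm (p0 x)) mulrC.
by rewrite [leRHS]ger0_norm ?ler_wpM2r// mulr_ge0// (le_trans _ (fB x)).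
Qed.

Lemma integrable_mass : mu.-integrable setT (EFin \o p).
Proof.
have := @integrable_weight (fun _ => 1) 1 (measurable_cst _) (fun _ =>
    ltac:(by rewrite normr1)).
by congr (_.-integrable _ _); apply/funext => x; rewrite mulr1.
Qed.

Section Grid.
Context (e M delta : R).
Hypothesis e0 : 0 < e.
Hypothesis e1 : e <= 1.
Hypothesis M1 : 1 <= M.
Hypothesis delta0 : 0 < delta.

(** The positive part of [ln p] is truncated at [ln M] and the negative part dropped where [p < e].
    Both become bounded, so their integrals against [p] are finite before any entropy is known to
    be. *)
Definition clip x := Num.min (p x) M.
Definition logpos x := Num.max 0 (ln (clip x)).
Definition logneg x := if p x < e then 0 else Num.max 0 (- ln (p x)).

Let h x := (ln (clip x) - ln e) / delta.
Let K := Num.truncn ((ln M - ln e) / delta).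

(** Level [0] is the region of small density. The others round [ln (clip x)] down to the grid of
    mesh [delta] that starts at [ln e], with indices shifted by one; [K] is the last grid index
    needed. *)
Definition level x : 'I_K.+2 :=
  if p x < e then ord0 else inord (Num.truncn (h x)).+1.
Definition level_value (i : 'I_K.+2) : R :=
  if i == ord0 then 0 else ln e + (i.-1)%:R * delta.

Let M0 : 0 < M. Proof. exact: lt_le_trans M1. Qed.

Let eM : e <= M. Proof. exact: le_trans e1 M1. Qed.

Let clip_gt0 x : e <= p x -> 0 < clip x.
Proof. by move=> ep; rewrite lt_min M0 andbT (lt_le_trans e0). Qed.

Let clip_ge x : e <= p x -> e <= clip x.
Proof. by move=> ep; rewrite le_min ep. Qed.

Let hK x : e <= p x -> 0 <= h x /\ (Num.truncn (h x) <= K)%N.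
Proof.
move=> ep; have h0 : 0 <= h x.
  by rewrite divr_ge0 ?(ltW delta0)// subr_ge0 ler_ln ?posrE ?clip_ge ?clip_gt0.
split => //; apply: le_truncn; rewrite ler_pM2r ?invr_gt0// lerD2r.
by rewrite ler_ln ?posrE ?clip_gt0// /clip ge_min lexx orbT.
Qed.

Lemma level_valE x : e <= p x -> level x = (Num.truncn (h x)).+1 :> nat.
Proof.
by move=> ep; rewrite /level ltNge ep /= inordK// !ltnS; case: (hK ep).
Qed.

Lemma level_eq0 x : (level x == ord0) = (p x < e).
Proof.
have [ep|pe] := leP e (p x); last by rewrite /level pe.
by apply/negbTE; apply/eqP => /(congr1 val); rewrite [val _](level_valE ep).
Qed.

Lemma level_value_le i : expR (level_value i) <= M.
Proof.
rewrite -[leRHS](@lnK _ M) ?posrE// ler_expR /level_value; case: eqP => [_|i0];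
    first by rewrite ln_ge0.
have K0 : 0 <= (ln M - ln e) / delta.
  by rewrite divr_ge0 ?(ltW delta0)// subr_ge0 ler_ln ?posrE//; lra.
have iK : (i.-1)%:R <= (ln M - ln e) / delta.
  apply: (@le_trans _ _ K%:R); last by rewrite truncn_le.
  rewrite ler_nat.
  by have := ltn_ord i; case: (nat_of_ord i).
by move: iK; rewrite ler_pdivlMr// => iK; rewrite -lerBrDl.
Qed.

Lemma level_value_bounds x : e <= p x ->
  ln (clip x) - delta <= level_value (level x) <= ln (clip x).
Proof.
move=> ep; rewrite /level_value level_eq0 ltNge ep /= level_valE//=.
have [h0 _] := hK ep; have := truncnS_gt (h x); have := h0; rewrite -truncn_le.
rewrite -natr1 {2 3}/h ltr_pdivrMr// ler_pdivlMr// => h1 h2.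
by apply/andP; split; lra.
Qed.

Lemma measurable_clip : measurable_fun setT clip.
Proof. exact: measurable_minr. Qed.

Lemma measurable_level i : measurable (fiber level i).
Proof.
have mlt : measurable [set x | p x < e].
  by rewrite -[X in measurable X]setTI -preimage_itvNyo; exact: mp.
have mge : measurable [set x | e <= p x].
  by rewrite -[X in measurable X]setTI -preimage_itvcy; exact: mp.
have mh : measurable_fun setT h.
  apply: measurable_funM => //; apply: measurable_funB => //.
  by apply: (measurableT_comp (@measurable_ln R)); exact: measurable_clip.
have [->|i0] := eqVneq i ord0.
  rewrite (_ : fiber _ _ = [set x | p x < e])//.
  by apply/seteqP; split => x; rewrite /fiber /= -level_eq0 => /eqP.
rewrite (_ : fiber _ _ = [set x | e <= p x] `&` (h @^-1` `[(i.-1)%:R,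
    (i.-1).+1%:R[)).
  by apply: measurableI => //; rewrite -[X in measurable X]setTI; exact: mh.
have i1 : (i.-1).+1 = i by rewrite prednK// lt0n.
apply/seteqP; split => x.
  rewrite /fiber /= => xi; have ep : e <= p x.
    by rewrite leNgt -level_eq0 xi.
  split => //; rewrite in_itv/= -xi level_valE//=; have [h0 _] := hK ep.
  by rewrite truncn_le h0 truncnS_gt.
move=> [/= ep]; rewrite in_itv/= => hi; apply/val_inj; rewrite /= level_valE//.
by rewrite (truncn_def hi) i1.
Qed.

(** Rounding down keeps the exponential of the weight below the density, so the weighted measure of
    the cells is at most the total mass. Both constants [Wa] and [Wb] of [key_inequality] can thus
    be [tau]. *)
Lemma integral_exp_level_le :
  (\int[mu]_x (if level x == ord0 then 0 else expR (level_value (level x)))%:E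
      <= tau%:E)%E.
Proof.
have ms : measurable_fun setT (fun x => if level x == ord0 then 0 else expR
    (level_value (level x))).
  have [[ms _] _] := cbounded_step measurable_level (fun i =>
      (if i == ord0 then 0 else expR (level_value i))%:C%C).
  exact: ms.
rewrite -ptau; apply: ge0_le_integral => //.
- by move=> x _; rewrite lee_fin; case: ifP => // _; exact: expR_ge0.
- exact/measurable_EFinP.
- exact/measurable_EFinP.
- move=> x _; rewrite lee_fin level_eq0; case: ltP => // ep.
  have /andP[_ h1] := level_value_bounds ep.
  rewrite -ler_expR lnK ?posrE ?clip_gt0// in h1.
  by apply: (le_trans h1); rewrite ge_min lexx.
Qed.

Lemma logpos_bound x : `|logpos x| <= ln M.
Proof.
rewrite ger0_norm ?le_max ?lexx// ge_max ln_ge0//=.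
have [c0|c0] := ltP 0 (clip x); first by rewrite ler_ln ?posrE// /clip ge_min
    lexx orbT.
by rewrite ln0// ln_ge0.
Qed.

Lemma logneg_bound x : `|logneg x| <= - ln e.
Proof.
have le0 : 0 <= - ln e by rewrite oppr_ge0 ln_le0.
rewrite /logneg; case: ltP => ep; first by rewrite normr0.
rewrite ger0_norm ?le_max ?lexx// ge_max le0/= lerN2 ler_ln ?posrE//.
exact: lt_le_trans ep.
Qed.

Lemma measurable_logpos : measurable_fun setT logpos.
Proof.
apply: measurable_maxr => //; apply: (measurableT_comp (@measurable_ln R)).
exact: measurable_clip.
Qed.

Lemma measurable_logneg : measurable_fun setT logneg.
Proof.
apply: measurable_fun_ifT => //; first exact: measurable_fun_ltr.
apply: measurable_maxr => //; apply: measurable_funN.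
exact: (measurableT_comp (@measurable_ln R)).
Qed.

(** Rounding loses at most [delta] per unit of mass. On level [0] the weight is [0], and so are both
    truncated logarithms there, because [e <= 1]. *)
Lemma sum_level_ge :
  \int[mu]_x (p x * logpos x) - \int[mu]_x (p x * logneg x) - delta * tau <=
  \sum_i level_value i * \int[mu]_(x in fiber level i) p x.
Proof.
have i1 := integrable_weight measurable_logpos logpos_bound.
have i2 := integrable_weight measurable_logneg logneg_bound.
have i3 := integrable_mass.
have ii i : mu.-integrable setT (EFin \o (fun x =>
    level_value i * (p x * \1_(fiber level i) x))).
  have b1 x : `|\1_(fiber level i) x| <= 1 :> R.
    by rewrite indicE; case: (_ \in _); rewrite ?normr1 ?normr0.
  have ip := integrable_weight (measurable_indic (measurable_level i)) b1.
  exact: (integrableZl measurableT (level_value i) ip).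
have sE x : \sum_i level_value i * (p x * \1_(fiber level i) x) = p x *
    level_value (level x).
  rewrite (bigD1 (level x))//= indic_fiber eqxx mulr1 big1 ?addr0 1?mulrC// => k kx.
  by rewrite indic_fiber eq_sym (negbTE kx) !mulr0.
(* The real summands are embedded in the complex numbers so that [cintegral_sum] applies. *)
have ci k : cintegrable mu (fun x => (level_value k * (p x * \1_(fiber level k)
    x))%:C%C).
  by split; [exact: ii|exact: integrable0].
have [is_ es] := cintegral_sum (index_enum 'I_K.+2) ci.
have sumE : (fun x => Re (\sum_k (level_value k * (p x * \1_(fiber level k)
    x))%:C%C)) =
    fun x => p x * level_value (level x).
  by apply/funext => x; rewrite -sE Re_sum.
have -> : \sum_i level_value i * \int[mu]_(x in fiber level i) p x =
    \int[mu]_x (p x * level_value (level x)).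
  rewrite -sumE -[RHS]/(Re (cintegral mu (fun x =>
      \sum_k (level_value k * (p x * \1_(fiber level k) x))%:C%C))).
  rewrite es Re_sum; apply: eq_bigr => k _; rewrite /cintegral/=.
  have b1 x : `|\1_(fiber level k) x| <= 1 :> R.
    by rewrite indicE; case: (_ \in _); rewrite ?normr1 ?normr0.
  have ip := integrable_weight (measurable_indic (measurable_level k)) b1.
  rewrite RintegralZl//; congr (_ * _); rewrite Rintegral_mkcond.
  apply: eq_Rintegral => x _; rewrite patchE indicE.
  by case: ifP; rewrite ?mulr1 ?mulr0.
have i4 : mu.-integrable setT (EFin \o (fun x => p x * level_value (level x))).
  by rewrite -sumE; exact: is_.1.
have -> : tau = \int[mu]_x p x by rewrite /Rintegral ptau.
have i5 : mu.-integrable setT (EFin \o (fun x => p x * logpos x - p x * logneg x)).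
  exact: (@integrableB _ _ _ _ _ measurableT _ _ i1 i2).
have i6 : mu.-integrable setT (EFin \o (fun x => delta * p x)).
  exact: (integrableZl measurableT delta i3).
rewrite -RintegralZl// -RintegralB// -RintegralB//.
apply: le_Rintegral => //; first exact: (@integrableB _ _ _ _ _ measurableT _ _
    i5 i6).
move=> x _; rewrite (mulrC delta) -!mulrBr; apply: ler_wpM2l => //.
have [ep|pe] := leP e (p x); last first.
  rewrite /level_value level_eq0 pe /logneg pe /logpos.
  have -> : Num.max 0 (ln (clip x)) = 0.
    apply/max_idPl/ln_le0; rewrite /clip ge_min.
    by rewrite (le_trans (ltW pe)).
  by rewrite subr0 sub0r oppr_le0 ltW.
have /andP[+ _] := level_value_bounds ep; apply: le_trans; apply: lerB => //.
rewrite /logneg ltNge ep /= /logpos /clip.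
have px0 : 0 < p x by exact: lt_le_trans ep.
case: (leP (p x) M) => pM.
  by move: (ln (p x)) => z; case: (leP 0 z) => ?; case: (leP 0 (- z)) => ?; lra.
have lM : 0 <= ln M by exact: ln_ge0.
have lp : 0 <= ln (p x) by apply: ln_ge0; exact: le_trans (ltW pM).
by rewrite (max_idPr lM) (_ : Num.max 0 (- ln (p x)) = 0) ?subr0//;
    apply/max_idPl; rewrite oppr_le0.
Qed.

End Grid.

(** A cutoff at [1] switches off the corresponding part of the logarithm; the one-sided bounds
    [entropy_bound_x] and [entropy_bound_xi] depend on it. *)
Lemma logpos1 x : logpos 1 x = 0.
Proof. by apply/max_idPl/ln_le0; rewrite ge_min lexx orbT. Qed.

Lemma logneg1 x : logneg 1 x = 0.
Proof.
by rewrite /logneg; case: ltP => // h; apply/max_idPl; rewrite oppr_le0 ln_ge0.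
Qed.

Lemma integral_logneg_le (e : R) : 0 < e -> e <= 1 ->
  ((\int[mu]_x (p x * logneg e x))%:E <=
   \int[mu]_x (p x * Num.max 0 (- ln (p x)))%:E)%E.
Proof.
move=> e0 e1; have ie := integrable_weight (measurable_logneg e) (logneg_bound
    e0 e1).
rewrite fineK; last exact: integrable_fin_num ie.
have nn x : 0 <= logneg e x by rewrite /logneg; case: ifP; rewrite ?le_max ?lexx.
apply: ge0_le_integral => //.
- by move=> x _; rewrite lee_fin mulr_ge0.
- exact: measurable_int ie.
- apply/measurable_EFinP; apply: measurable_funM => //;
    apply: measurable_maxr => //.
  by apply: measurable_funN; exact: (measurableT_comp (@measurable_ln R)).
- move=> x _; rewrite lee_fin ler_wpM2l// /logneg; case: ifP => // _.
  by rewrite le_max lexx.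
Qed.

(** Monotone convergence along integer cutoffs; at a fixed point the cutoff is eventually
    inactive. *)
Lemma integral_logpos_limit (B : R) :
  (forall M, 1 <= M -> \int[mu]_x (p x * logpos M x) <= B) ->
  (\int[mu]_x (p x * Num.max 0 (ln (p x)))%:E <= B%:E)%E.
Proof.
move=> hB; pose f k x := (p x * logpos k.+1%:R x)%:E.
have M1 k : 1 <= k.+1%:R :> R by rewrite ler1n.
have ik k := integrable_weight (measurable_logpos k.+1%:R) (logpos_bound (M1 k)).
have f0 k x : setT x -> (0 <= f k x)%E.
  by move=> _; rewrite lee_fin mulr_ge0// le_max lexx.
have fnd x : setT x -> {homo f^~ x : k j / (k <= j)%N >-> (k <= j)%E}.
  move=> _ k j kj; rewrite lee_fin ler_wpM2l// ge_max !le_max lexx/=.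
  have [c0|c0] := ltP 0 (clip k.+1%:R x); last by rewrite (ln0 c0) lexx.
  have cc : clip k.+1%:R x <= clip j.+1%:R x.
    by rewrite le_min !ge_min lexx/= ler_nat ltnS kj orbT.
  by rewrite [X in _ || X]ler_ln ?cc ?orbT// posrE// (lt_le_trans c0).
have lim x : (limn (f^~ x) = (p x * Num.max 0 (ln (p x)))%:E)%E.
  apply/cvg_lim => //; apply: cvg_near_cst.
  near=> k; rewrite /f /logpos /clip (min_idPl _)//.
  rewrite ltW// (lt_le_trans (truncnS_gt (p x)))// ler_nat ltnS.
  by near: k; exact: nbhs_infty_ge.
have := @cvg_monotone_convergence _ _ _ mu setT measurableT f (fun k =>
    measurable_int _ (ik k)) f0 fnd.
move=> /cvg_lim -/(_ (@ereal_hausdorff R)).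
under eq_integral do rewrite lim.
move=> <-; apply: lime_le.
  apply: ereal_nondecreasing_is_cvgn => k j kj; apply: ge0_le_integral => //.
  - by move=> x; exact: f0.
  - exact: measurable_int (ik k).
  - exact: measurable_int (ik j).
  - by move=> x Tx; exact: fnd.
near=> k; have := hB _ (M1 k); rewrite -lee_fin fineK//.
exact: integrable_fin_num (ik k).
Unshelve. all: by end_near. Qed.

(** Dominated convergence with dominating function [p]: a point of positive density eventually
    leaves the region, and a point of density [0] contributes nothing, however large the region. *)
Lemma small_mass (eta : R) : 0 < eta -> exists2 e, 0 < e <= 1 &
  \int[mu]_(x in [set x | p x < e]) p x <= eta.
Proof.
move=> eta0; pose A k := [set x | p x < k.+1%:R^-1].
have mA k : measurable (A k).
  by rewrite -[X in measurable X]setTI /A -preimage_itvNyo; exact: mp.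
pose f k x := (p x * \1_(A k) x)%:E.
have b1 k x : `|\1_(A k) x| <= 1 :> R.
  by rewrite indicE; case: (_ \in _); rewrite ?normr1 ?normr0.
have ik k := integrable_weight (measurable_indic (mA k)) (b1 k).
have fc : {ae mu, forall x, setT x -> f^~ x @ \oo --> (0 : \bar R)}.
  apply: aeW => x _; apply: cvg_near_cst; near=> k.
  have [px|px] := eqVneq (p x) 0; first by rewrite /f px mul0r.
  rewrite /f indicE memNset ?mulr0// /A /=; apply/negP; rewrite -leNgt.
  have px0 : 0 < p x by rewrite lt_neqAle eq_sym px p0.
  rewrite -[leRHS]invrK lef_pV2 ?posrE ?invr_gt0//.
  rewrite (le_trans (ltW (truncnS_gt _)))// ler_nat ltnS.
  by near: k; exact: nbhs_infty_ge.
have fb : {ae mu, forall x k, setT x -> (`|f k x| <= (EFin \o p) x)%E}.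
  apply: aeW => x k _; rewrite lee_fin normrM (ger0_norm (p0 x)).
  by rewrite ler_piMr.
have [_ _] := dominated_convergence measurableT (fun k => measurable_int _ (ik k))
  (measurable_cst _) fc integrable_mass fb.
rewrite integral0 => /fine_cvgP[_] /cvgrPdist_le /(_ _ eta0) [N _ HN].
exists N.+1%:R^-1; first by rewrite invr_gt0 ltr0n/= invf_le1// ler1n.
have := HN N (leqnn N); rewrite sub0r normrN => /(le_trans (ler_norm _)).
rewrite Rintegral_mkcond; apply: le_trans.
rewrite le_eqVlt; apply/orP; left; apply/eqP.
apply: eq_Rintegral => x _; rewrite patchE indicE.
by rewrite -[x \in A N]/(x \in [set x | p x < N.+1%:R^-1]); case: ifP;
    rewrite ?mulr1 ?mulr0.
Unshelve. all: by end_near. Qed.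

Lemma mass_below_le (e : R) : \int[mu]_(x in [set x | p x < e]) p x <= tau.
Proof.
have mA : measurable [set x | p x < e].
  by rewrite -[X in measurable X]setTI -preimage_itvNyo; exact: mp.
have iA : mu.-integrable [set x | p x < e] (EFin \o p).
  by apply: (integrableS measurableT) => //; exact: integrable_mass.
rewrite -lee_fin fineK; last exact: integrable_fin_num iA.
rewrite -ptau; apply: ge0_subset_integral => //.
  exact/measurable_EFinP.
by move=> x _; rewrite lee_fin.
Qed.

End Levels.

Lemma nneseries_EFin_cvg (R : realType) (x : nat -> R) (V : R) : (forall k,
    0 <= x k) ->
  (\sum_(k <oo) (x k)%:E = V%:E)%E ->
  (fun N => \sum_(k < N) x k) @ \oo --> V /\ forall N, \sum_(k < N) x k <= V.
Proof.
move=> x0 e.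
have x0' k : (0 <= (x k)%:E)%E by rewrite lee_fin.
split; last first.
  move=> N; rewrite -lee_fin -e -sumEFin -(big_mkord xpredT (fun k => (x k)%:E)).
  exact: nneseries_lim_ge.
have c : (fun N => (\sum_(0 <= k < N) (x k)%:E)%E) @ \oo --> V%:E.
  by rewrite -e; apply: is_cvg_nneseries => k _ _.
have := c; rewrite (_ : (fun N => _) = EFin \o (fun N => \sum_(k < N) x k)).
  by move/fine_cvgP => [_].
by apply/funext => N; rewrite /= sumEFin big_mkord.
Qed.

(** * The quadratic form and the operator norm *)

Section OperatorNorm.
Context d (T : measurableType d) (R : realType) (mu : {measure set T -> \bar R}).
Implicit Type P : L2 mu -> L2 mu.

Lemma opnorm_has_ubound P : psd_op P ->
  has_ubound [set normL2 (P u) | u in [set u | normL2 u <= 1]].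
Proof.
move=> [_ [M hM] _]; exists (Num.max M 0) => _ [w /= w1 <-].
apply: (le_trans (hM w)); apply: (@le_trans _ _ (Num.max M 0 * normL2 w)).
  by rewrite ler_wpM2r ?normL2_ge0// le_max lexx.
by rewrite ler_piMr// le_max lexx orbT.
Qed.

Lemma opnorm_ge0 P : psd_op P -> 0 <= opnorm P.
Proof.
move=> psdP; apply: ub_le_sup; first exact: opnorm_has_ubound.
by exists 0; rewrite /= ?normL20 ?ler01// (psd_op0 psdP) normL20.
Qed.

Lemma opnormP P u : psd_op P -> normL2 (P u) <= opnorm P * normL2 u.
Proof.
move=> psdP; have [Pl _ _] := psdP.
have [u0|uN0] := eqVneq (normL2 u) 0.
  by rewrite (normL2_eq0 u0) (psd_op0 psdP) !normL20 mulr0.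
have up : 0 < normL2 u by rewrite lt_neqAle eq_sym uN0 normL2_ge0.
pose v := ((normL2 u)^-1)%:C%C *: u.
have nv : normL2 v = 1.
  rewrite normL2Z /= expr0n addr0 sqrtr_sqr ger0_norm ?invr_ge0 ?(ltW up)//.
  by rewrite mulVf.
have Pv : normL2 (P v) = (normL2 u)^-1 * normL2 (P u).
  have -> : P v = ((normL2 u)^-1)%:C%C *: P u.
    by have := Pl ((normL2 u)^-1)%:C%C u 0; rewrite addr0 (psd_op0 psdP) addr0.
  by rewrite normL2Z /= expr0n addr0 sqrtr_sqr ger0_norm ?invr_ge0 ?(ltW up).
have : normL2 (P v) <= opnorm P.
  apply: ub_le_sup; first exact: opnorm_has_ubound.
  by exists v => //=; rewrite nv.
by rewrite Pv mulrC ler_pdivrMr.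
Qed.

Lemma qform_le_opnorm P u : psd_op P -> qform P u <= opnorm P * normsq u.
Proof.
move=> psdP; have h := dotL2_cauchy_schwarz (P u) u.
rewrite -normL2_sq expr2 mulrA.
apply: (le_trans (le_trans (ler_norm _) (normr_Re_le _))); apply: (le_trans h).
by rewrite ler_wpM2r ?normL2_ge0// opnormP.
Qed.

Lemma psd_op_opnorm_gt0 P u : psd_op P -> P u <> 0 -> 0 < opnorm P.
Proof.
move=> psdP Pu0; have h := opnormP u psdP.
have Pu1 : 0 < normL2 (P u).
  by rewrite lt_neqAle normL2_ge0 andbT eq_sym; apply/eqP => /normL2_eq0.
rewrite ltNge; apply/negP => o0; have := mulr_le0_ge0 o0 (normL2_ge0 u).
by move=> /(le_trans h); rewrite leNgt Pu1.
Qed.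

Lemma chiT (u : L2 mu) : chi setT u = u.
Proof.
rewrite /chi -[RHS]L2class_repr; congr (L2class _ _).
by apply/funext => x; rewrite indicT mul1r.
Qed.

Lemma nu_opT P (g : nat -> L2 mu) :
  (forall u, (qform P u)%:E = (\sum_(k <oo) (normc (dotL2 u (g k)) ^+ 2)%:E)%E) ->
  nu_op P setT = (\sum_(k <oo) (normsq (g k))%:E)%E.
Proof.
move=> Pg; rewrite (nu_op_form_sum measurableT Pg).
by apply: eq_eseriesr => k _; rewrite chiT.
Qed.

End OperatorNorm.

(** * From step functions to the entropies of a state *)

Section StateInequality.
Context (R : realType) (n : nat).
Local Notation pt := (n.-tuple R).
Local Notation leb := (@lebesgue R n).
Local Notation dual := (@dual_lebesgue R n).
Local Notation F := (@fourier R n).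
Context (rho : {linear L2 leb -> L2 leb}) (rhohat : {linear L2 dual -> L2 dual}).
Context (g : nat -> L2 leb) (tau : R).
Hypothesis psd_rho : psd_op rho.
Hypothesis Pg : forall u,
  (qform rho u)%:E = (\sum_(k <oo) (normc (dotL2 u (g k)) ^+ 2)%:E)%E.
Hypothesis Phg : forall w,
  (qform rhohat w)%:E = (\sum_(k <oo) (normc (dotL2 w (F (g k))) ^+ 2)%:E)%E.
Hypothesis gtau : (\sum_(k <oo) (normsq (g k))%:E = tau%:E)%E.
Hypothesis tau0 : 0 < tau.

Let kappa := opnorm rho.
Let p := rdensity g.
Let q := rdensity (fun k => F (g k)).

Let gfin : (\sum_(k <oo) (normsq (g k))%:E < +oo)%E. Proof. by rewrite gtau
    ltry. Qed.

Let htau : (\sum_(k <oo) (normsq (F (g k)))%:E = tau%:E)%E.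
Proof. by rewrite -gtau; apply: eq_eseriesr => k _; rewrite normsq_fourier. Qed.

Let hfin : (\sum_(k <oo) (normsq (F (g k)))%:E < +oo)%E. Proof. by rewrite htau
    ltry. Qed.

(** For fixed [k] the sum over [l] is a partial sum of [qform rho (g k)], which is at most
    [kappa * normsq (g k)]. *)
Lemma gram_sq_le N : gram_sq (fun k : 'I_N => g k) <= kappa * tau.
Proof.
have [_ le1] := nneseries_EFin_cvg (fun k => normsq_ge0 (g k)) gtau.
apply: (@le_trans _ _ (\sum_(k < N) kappa * normsq (g k))); last first.
  by rewrite -mulr_sumr ler_wpM2l// opnorm_ge0.
apply: ler_sum => k _.
apply: (@le_trans _ _ (qform rho (g k))); last exact: qform_le_opnorm.
have [_ ->] := nneseries_EFin_cvg (fun l => sqr_ge0 (normc (dotL2 (g k) (g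
    l)))) (esym (Pg (g k))).
by [].
Qed.

Let p0 x : 0 <= p x. Proof. exact: rdensity_ge0. Qed.
Let q0 x : 0 <= q x. Proof. exact: rdensity_ge0. Qed.
Let mp : measurable_fun setT p. Proof. exact: measurable_rdensity. Qed.
Let mq : measurable_fun setT q. Proof. exact: measurable_rdensity. Qed.

Let ptau : (\int[leb]_x (p x)%:E = tau%:E)%E.
Proof. by rewrite -(integral_rdensity Pg gfin)// (nu_opT Pg) gtau. Qed.

Let qtau : (\int[dual]_x (q x)%:E = tau%:E)%E.
Proof. by rewrite -(integral_rdensity Phg hfin)// (nu_opT Phg) htau. Qed.

Let mass_p A : measurable A ->
  (\sum_(k <oo) (normsq (chi A (g k)))%:E = (\int[leb]_(x in A) p x)%:E)%E.
Proof.
move=> mA; rewrite -(nu_op_form_sum mA Pg) (integral_rdensity Pg gfin)//.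
rewrite fineK//; apply: integrable_fin_num => //.
by apply: (integrableS measurableT) => //; exact: integrable_mass p0 mp ptau.
Qed.

Let mass_q A : measurable A ->
  (\sum_(k <oo) (normsq (chi A (F (g k))))%:E = (\int[dual]_(x in A) q x)%:E)%E.
Proof.
move=> mA; rewrite -(nu_op_form_sum mA Phg) (integral_rdensity Phg hfin)//.
rewrite fineK//; apply: integrable_fin_num => //.
by apply: (integrableS measurableT) => //; exact: integrable_mass q0 mq qtau.
Qed.

(** [key_inequality] for the first [N] vectors, then [N] to infinity. The partitions come from the
    full densities and the bound [m1] does not depend on [N]: the main term is the square root of
    [tau * tau * (kappa * tau)], and [y * tau] absorbs the two terms of small density. Since
    [tau > 0], partial traces are eventually positive. *)
Lemma state_inequality (e M e' M' delta y : R) :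
  0 < e -> e <= 1 -> 1 <= M -> 0 < e' -> e' <= 1 -> 1 <= M' -> 0 < delta -> 0 < y ->
  Num.sqrt ((\int[leb]_(x in [set x | p x < e]) p x) * (M' * tau)) +
    Num.sqrt (M * tau * \int[dual]_(x in [set x | q x < e']) q x) <= y * tau ->
  \int[leb]_x (p x * logpos p M x) + \int[dual]_x (q x * logpos q M' x) <=
  \int[leb]_x (p x * logneg p e x) + \int[dual]_x (q x * logneg q e' x) +
  2 * delta * tau + 2 * tau * ln (Num.sqrt (kappa * tau) + y).
Proof.
move=> e0 e1 M1 e0' e1' M1' delta0 y0 hy.
set ia := level p e M delta; set ib := level q e' M' delta.
pose a := @level_value _ e M delta; pose b := @level_value _ e' M' delta.
have mia : forall i, measurable (fiber ia i) by exact: measurable_level.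
have mib : forall i, measurable (fiber ib i) by exact: measurable_level.
have [ct lt_] := nneseries_EFin_cvg (fun k => normsq_ge0 (g k)) gtau.
pose VA i := \int[leb]_(x in fiber ia i) p x.
pose VB j := \int[dual]_(x in fiber ib j) q x.
have cA i := nneseries_EFin_cvg (fun k => normsq_ge0 (chi (fiber ia i) (g k)))
    (mass_p (mia i)).
have cB j := nneseries_EFin_cvg (fun k => normsq_ge0 (chi (fiber ib j) (F (g
    k)))) (mass_q (mib j)).
have lA := sum_level_ge p0 mp ptau e0 e1 M1 delta0.
have lB := sum_level_ge q0 mq qtau e0' e1' M1' delta0.
pose m1 := (Num.sqrt (kappa * tau) + y) * tau.
have sq0 : 0 <= Num.sqrt (kappa * tau) by exact: sqrtr_ge0.
have m10 : 0 < m1 by rewrite mulr_gt0// ltr_wpDl.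
have A0 : VA ord0 = \int[leb]_(x in [set x | p x < e]) p x.
  congr (Rintegral _ _ _); apply/seteqP; split => x; rewrite /fiber /=.
    by move/eqP; rewrite level_eq0.
  by rewrite -(level_eq0 p e0 e1 M1 delta0) => /eqP.
have B0 : VB ord0 = \int[dual]_(x in [set x | q x < e']) q x.
  congr (Rintegral _ _ _); apply/seteqP; split => x; rewrite /fiber /=.
    by move/eqP; rewrite level_eq0.
  by rewrite -(level_eq0 q e0' e1' M1' delta0) => /eqP.
have M0 : 0 <= M by exact: le_trans ler01 M1.
have M0' : 0 <= M' by exact: le_trans ler01 M1'.
have key N : 0 < \sum_(k < N) normsq (g k) ->
    \sum_i a i * \sum_(k < N) normsq (chi (fiber ia i) (g k)) +
    \sum_j b j * \sum_(k < N) normsq (chi (fiber ib j) (F (g k))) <=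
    2 * (\sum_(k < N) normsq (g k)) * ln (m1 / \sum_(k < N) normsq (g k)).
  move=> tN0; apply: (@key_inequality _ _ _ (fun k : 'I_N =>
      g k) _ _ ia ib a b mia mib _ _ M M' tau tau m1) => //.
  - exact: level_value_le.
  - exact: level_value_le.
  - exact: integral_exp_level_le.
  - exact: integral_exp_level_le.
  - have tN := ltW tN0.
    apply: (@le_trans _ _ (y * tau + tau * Num.sqrt (kappa * tau))); last first.
      by rewrite /m1 mulrDl addrC (mulrC tau).
    apply: lerD; first apply: le_trans hy.
      rewrite -A0 -B0; apply: lerD; apply: ler_wsqrtr.
        apply: ler_pM => //; first by apply: sumr_ge0 => k _; exact: normsq_ge0.
        - by rewrite mulr_ge0.
        - exact: (cA ord0).2.
        - by rewrite ler_wpM2l// lt_.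
      apply: ler_pM => //; first by rewrite mulr_ge0.
      - by apply: sumr_ge0 => k _; exact: normsq_ge0.
      - by rewrite ler_wpM2l// lt_.
      - exact: (cB ord0).2.
    rewrite -[X in X * Num.sqrt _](gtr0_norm tau0) -sqrtr_sqr -sqrtrM ?sqr_ge0//.
    by apply: ler_wsqrtr; rewrite expr2 ler_wpM2l ?mulr_ge0 ?(ltW tau0)//
        gram_sq_le.
have lim : \sum_i a i * VA i + \sum_j b j * VB j <= 2 * tau * ln (m1 / tau).
  have c1 : (fun N => \sum_i a i * \sum_(k < N) normsq (chi (fiber ia i) (g k)) +
      \sum_j b j * \sum_(k < N) normsq (chi (fiber ib j) (F (g k)))) @ \oo -->
      \sum_i a i * VA i + \sum_j b j * VB j.
    apply: cvgD.
      apply: cvg_big => [|i _]; first exact: add_continuous.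
      by apply: cvgM; [exact: cvg_cst|exact: (cA i).1].
    apply: cvg_big => [|i _]; first exact: add_continuous.
    by apply: cvgM; [exact: cvg_cst|exact: (cB i).1].
  have c2 : (fun N => 2 * (\sum_(k < N) normsq (g k)) *
      ln (m1 / \sum_(k < N) normsq (g k))) @ \oo --> 2 * tau * ln (m1 / tau).
    apply: cvgM; first by apply: cvgM; [exact: cvg_cst|exact: ct].
    apply: (@cvg_comp _ _ _ (fun N => m1 / \sum_(k < N) normsq (g k)) (@ln R) _
        (nbhs (m1 / tau))).
      apply: cvgM; first exact: cvg_cst.
      by apply: cvgV; [rewrite gt_eqF|exact: ct].
    by apply: continuous_ln; rewrite divr_gt0.
  apply: (ler_cvg_to c1 c2).
  by near=> N; apply: key; near: N; exact: (cvgr_gt tau ct).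
have e1m : m1 / tau = Num.sqrt (kappa * tau) + y by rewrite /m1 mulfK// gt_eqF.
rewrite e1m in lim; move: lA lB lim; rewrite -/ia -/ib -/a -/b.
rewrite -[\sum_i a i * \int[leb]_(x in _) _]/(\sum_i a i * VA i).
rewrite -[\sum_i b i * \int[dual]_(x in _) _]/(\sum_i b i * VB i).
set X1 := \sum_i _; set X2 := \sum_i _.
do 4 move: (\int[_]_x _) => ?.
move=> h1 h2 h3; lra.
Unshelve. all: by end_near. Qed.

Hypothesis kappa0 : 0 < kappa.
Let s := Num.sqrt (kappa * tau).
Let s0 : 0 < s. Proof. by rewrite sqrtr_gt0 mulr_gt0. Qed.

Lemma entropy_pos_rhoE : entropy_pos (mu := leb) rho =
  (\int[leb]_x (p x * Num.max 0 (- ln (p x)))%:E)%E.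
Proof. exact: (entropy_posE Pg gfin). Qed.

Lemma entropy_pos_rhohatE : entropy_pos (mu := dual) rhohat =
  (\int[dual]_x (q x * Num.max 0 (- ln (q x)))%:E)%E.
Proof. exact: (entropy_posE Phg hfin). Qed.

Lemma entropy_neg_rhoE : entropy_neg (mu := leb) rho =
  (\int[leb]_x (p x * Num.max 0 (ln (p x)))%:E)%E.
Proof. exact: (entropy_negE Pg gfin). Qed.

Lemma entropy_neg_rhohatE : entropy_neg (mu := dual) rhohat =
  (\int[dual]_x (q x * Num.max 0 (ln (q x)))%:E)%E.
Proof. exact: (entropy_negE Phg hfin). Qed.

Let sqrt_small (X c z : R) : 0 < c -> 0 < z -> X <= z ^+ 2 / c ->
    Num.sqrt (X * c) <= z.
Proof.
move=> c0 z0; rewrite ler_pdivlMr// => h.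
by rewrite -[leRHS](gtr0_norm z0) -sqrtr_sqr ler_wsqrtr.
Qed.

Let small_p (c z : R) : 0 < c -> 0 < z -> exists2 e, 0 < e <= 1 &
  Num.sqrt ((\int[leb]_(x in [set x | p x < e]) p x) * c) <= z.
Proof.
move=> c0 z0; have zc : 0 < z ^+ 2 / c by rewrite divr_gt0// exprn_gt0.
have [e e01 he] := small_mass p0 mp ptau zc.
by exists e => //; exact: sqrt_small.
Qed.

Let small_q (c z : R) : 0 < c -> 0 < z -> exists2 e, 0 < e <= 1 &
  Num.sqrt (c * \int[dual]_(x in [set x | q x < e]) q x) <= z.
Proof.
move=> c0 z0; have zc : 0 < z ^+ 2 / c by rewrite divr_gt0// exprn_gt0.
have [e e01 he] := small_mass q0 mq qtau zc.
by exists e => //; rewrite mulrC; exact: sqrt_small.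
Qed.

(** The upper cutoffs are given, and the lower ones are then chosen so that the small cells
    contribute at most [y * tau]. The constant arises from [2 ln s = ln tau + ln kappa]. *)
Lemma entropy_bound (Px Pxi M M' : R) :
  entropy_pos (mu := leb) rho = Px%:E -> entropy_pos (mu := dual) rhohat = Pxi%:E ->
  1 <= M -> 1 <= M' ->
  \int[leb]_x (p x * logpos p M x) + \int[dual]_x (q x * logpos q M' x) <=
  Px + Pxi + tau * (ln tau + ln kappa).
Proof.
rewrite entropy_pos_rhoE entropy_pos_rhohatE => hPx hPxi M1 M1'.
apply/ler_addgt0Pr => eps eps0.
have M0 : 0 < M by exact: lt_le_trans M1.
have M0' : 0 < M' by exact: lt_le_trans M1'.
(* The rounding costs [2 delta tau], and replacing [ln (s + y)] by [ln s] costs at most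
   [2 tau delta] because [y = s * delta]; together they make [eps]. *)
pose delta := eps / (4 * tau); have delta0 : 0 < delta by rewrite divr_gt0//
    mulr_gt0.
pose y := s * delta; have y0 : 0 < y by rewrite mulr_gt0.
have z0 : 0 < y * tau / 2 by rewrite divr_gt0// mulr_gt0.
have [e /andP[e0 e1] he] := small_p (mulr_gt0 M0' tau0) z0.
have [e' /andP[e0' e1'] he'] := small_q (mulr_gt0 M0 tau0) z0.
have hy := lerD he he'; rewrite -splitr in hy.
have h := state_inequality e0 e1 M1 e0' e1' M1' delta0 y0 hy.
have h1 : \int[leb]_x (p x * logneg p e x) <= Px.
  by rewrite -lee_fin -hPx; exact: integral_logneg_le p0 mp ptau _ e0 e1.
have h2 : \int[dual]_x (q x * logneg q e' x) <= Pxi.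
  by rewrite -lee_fin -hPxi; exact: integral_logneg_le q0 mq qtau _ e0' e1'.
have ls : ln tau + ln kappa = 2 * ln s.
  rewrite addrC -lnM ?posrE// -[kappa * tau]sqr_sqrtr ?mulr_ge0 ?(ltW kappa0)
      ?(ltW tau0)//.
  by rewrite lnXn// mulr2n mulrDl mul1r.
have ly : ln (s + y) <= ln s + delta.
  have d1 : 0 < 1 + delta by rewrite ltr_wpDl.
  rewrite /y -[X in X + _]mulr1 -mulrDr lnM ?posrE// lerD2l le_ln1Dx//.
  by rewrite (lt_trans _ delta0)// ltrN10.
have l2 : 2 * tau * ln (s + y) <= 2 * tau * (ln s + delta).
  by rewrite ler_wpM2l// mulr_ge0// ltW.
have td : tau * delta = eps / 4 by rewrite /delta; field; rewrite gt_eqF.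
apply: (le_trans h); rewrite ls.
move: h1 h2 l2; rewrite -/s.
move: (\int[_]_x _) (\int[_]_x _) (ln (s + y)) (ln s) => a b c f h1 h2 l2.
nra.
Qed.

(** The position density is cut above at [1] and the frequency density below at [1], which removes
    two of the four logarithmic integrals. The mass below [1] is at most [tau], so [y = 2] serves
    for every [M'], and the bound is uniform in [M']. *)
Lemma entropy_bound_xi (Px M' : R) : entropy_pos (mu := leb) rho = Px%:E ->
    1 <= M' ->
  \int[dual]_x (q x * logpos q M' x) <= Px + 2 * tau + 2 * tau * ln (s + 2).
Proof.
rewrite entropy_pos_rhoE => hPx M1'.
have M0' : 0 < M' by exact: lt_le_trans M1'.
have [e /andP[e0 e1] he] := small_p (mulr_gt0 M0' tau0) tau0.
have he' : Num.sqrt (1 * tau * \int[dual]_(x in [set x | q x < 1]) q x) <= tau.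
  rewrite mul1r mulrC; apply: sqrt_small => //.
  by rewrite expr2 mulfK ?gt_eqF//; exact: mass_below_le.
have hy : Num.sqrt ((\int[leb]_(x in [set x | p x < e]) p x) * (M' * tau)) +
    Num.sqrt (1 * tau * \int[dual]_(x in [set x | q x < 1]) q x) <= 2 * tau.
  by rewrite mulr_natl mulr2n lerD.
have := state_inequality e0 e1 (lexx 1) ltr01 (lexx 1) M1' ltr01 (ltr0Sn R 1) hy.
have h1 : \int[leb]_x (p x * logneg p e x) <= Px.
  by rewrite -lee_fin -hPx; exact: integral_logneg_le p0 mp ptau _ e0 e1.
have -> : \int[leb]_x (p x * logpos p 1 x) = 0.
  by under eq_Rintegral do rewrite logpos1 mulr0; rewrite /Rintegral integral0.
have -> : \int[dual]_x (q x * logneg q 1 x) = 0.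
  by under eq_Rintegral do rewrite logneg1 mulr0; rewrite /Rintegral integral0.
rewrite add0r addr0 mulr1 => /le_trans; apply.
by rewrite lerD2r lerD2r.
Qed.

Lemma entropy_bound_x (Pxi M : R) : entropy_pos (mu := dual) rhohat = Pxi%:E ->
    1 <= M ->
  \int[leb]_x (p x * logpos p M x) <= Pxi + 2 * tau + 2 * tau * ln (s + 2).
Proof.
rewrite entropy_pos_rhohatE => hPxi M1.
have M0 : 0 < M by exact: lt_le_trans M1.
have [e /andP[e0 e1] he] := small_q (mulr_gt0 M0 tau0) tau0.
have he' : Num.sqrt ((\int[leb]_(x in [set x | p x < 1]) p x) * (1 * tau)) <= tau.
  rewrite mul1r; apply: sqrt_small => //.
  by rewrite expr2 mulfK ?gt_eqF//; exact: mass_below_le.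
have hy : Num.sqrt ((\int[leb]_(x in [set x | p x < 1]) p x) * (1 * tau)) +
    Num.sqrt (M * tau * \int[dual]_(x in [set x | q x < e]) q x) <= 2 * tau.
  by rewrite mulr_natl mulr2n lerD.
have := state_inequality ltr01 (lexx 1) M1 e0 e1 (lexx 1) ltr01 (ltr0Sn R 1) hy.
have h1 : \int[dual]_x (q x * logneg q e x) <= Pxi.
  by rewrite -lee_fin -hPxi; exact: integral_logneg_le q0 mq qtau _ e0 e1.
have -> : \int[dual]_x (q x * logpos q 1 x) = 0.
  by under eq_Rintegral do rewrite logpos1 mulr0; rewrite /Rintegral integral0.
have -> : \int[leb]_x (p x * logneg p 1 x) = 0.
  by under eq_Rintegral do rewrite logneg1 mulr0; rewrite /Rintegral integral0.
rewrite add0r addr0 mulr1 => /le_trans; apply.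
by rewrite lerD2r lerD2r.
Qed.

Let pos_fin d (T : measurableType d) (mu : {measure set T ->
    \bar R}) (r f : T -> R) :
  (forall x, 0 <= r x) ->
  (\int[mu]_x (r x * Num.max 0 (f x))%:E < +oo)%E ->
  exists P, (\int[mu]_x (r x * Num.max 0 (f x))%:E)%E = P%:E.
Proof.
move=> r0 h; exists (fine (\int[mu]_x (r x * Num.max 0 (f x))%:E)).
rewrite fineK// ge0_fin_numE// integral_ge0// => x _.
by rewrite lee_fin mulr_ge0// le_max lexx.
Qed.

Lemma entropy_neg_rhohat_lty : (entropy_pos (mu := leb) rho < +oo)%E ->
  (entropy_neg (mu := dual) rhohat < +oo)%E.
Proof.
rewrite {1}entropy_pos_rhoE => /(pos_fin p0)[Px hPx].
have h M' : 1 <= M' -> _ := entropy_bound_xi (etrans entropy_pos_rhoE hPx).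
rewrite entropy_neg_rhohatE (le_lt_trans (integral_logpos_limit q0 mq qtau h))//.
exact: ltry.
Qed.

Lemma entropy_neg_rho_lty : (entropy_pos (mu := dual) rhohat < +oo)%E ->
  (entropy_neg (mu := leb) rho < +oo)%E.
Proof.
rewrite {1}entropy_pos_rhohatE => /(pos_fin q0)[Pxi hPxi].
have h M : 1 <= M -> _ := entropy_bound_x (etrans entropy_pos_rhohatE hPxi).
rewrite entropy_neg_rhoE (le_lt_trans (integral_logpos_limit p0 mp ptau h))//.
exact: ltry.
Qed.

Lemma entropy_rhoE :
  entropy (mu := leb) rho = (- (entropy_neg (mu :=
      leb) rho - entropy_pos (mu := leb) rho))%E.
Proof. exact: (entropyE Pg gfin). Qed.

Lemma entropy_rhohatE : entropy (mu := dual) rhohat =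
  (- (entropy_neg (mu := dual) rhohat - entropy_pos (mu := dual) rhohat))%E.
Proof. exact: (entropyE Phg hfin). Qed.

(** The one-sided bounds make all four integrals finite. In [entropy_bound] the upper cutoffs then
    go to infinity one after the other, [M] first with [M'] fixed, so that the limit lemma is
    applied to a single density each time. *)
Lemma entropy_sum_finite :
  (entropy_pos (mu := leb) rho < +oo)%E -> (entropy_pos (mu :=
      dual) rhohat < +oo)%E ->
  exists x xi : R, [/\ entropy (mu := leb) rho = x%:E,
    entropy (mu := dual) rhohat = xi%:E & - (tau * (ln tau + ln kappa)) <= x + xi].
Proof.
move=> h1 h2; have n1 := entropy_neg_rho_lty h2; have n2 :=
    entropy_neg_rhohat_lty h1.
rewrite entropy_rhoE entropy_rhohatE.
move: h1 h2 n1 n2; rewrite {1}entropy_pos_rhoE {1}entropy_pos_rhohatE.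
rewrite {1}entropy_neg_rhoE {1}entropy_neg_rhohatE.
move=> /(pos_fin p0)[Px hPx] /(pos_fin q0)[Pxi hPxi] /(pos_fin p0)[Nx hNx]
    /(pos_fin q0)[Nxi hNxi].
rewrite entropy_pos_rhoE entropy_pos_rhohatE entropy_neg_rhoE entropy_neg_rhohatE.
rewrite hPx hPxi hNx hNxi.
exists (Px - Nx), (Pxi - Nxi); split.
- by rewrite -EFinB -EFinN opprB.
- by rewrite -EFinB -EFinN opprB.
set B := tau * _.
have h M M' (M1 : 1 <= M) (M1' : 1 <= M') :=
  entropy_bound (etrans entropy_pos_rhoE hPx) (etrans entropy_pos_rhohatE hPxi)
      M1 M1'.
have a1 M' : 1 <= M' -> Nx <= Px + Pxi + B - \int[dual]_x (q x * logpos q M' x).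
  move=> M1'; rewrite -lee_fin -hNx; apply: integral_logpos_limit p0 mp ptau _
      _ => M M1.
  by rewrite lerBrDr; exact: h.
have a2 : Nxi <= Px + Pxi + B - Nx.
  rewrite -lee_fin -hNxi; apply: integral_logpos_limit q0 mq qtau _ _ => M' M1'.
  by rewrite lerBrDr (addrC _ Nx) -lerBrDr; exact: a1.
by move: a2; lra.
Qed.

End StateInequality.

(** [rhohat] is known only through the intertwining relation; as the transform is unitary and onto,
    this determines its form everywhere. If [tau] were [0], all [g k] would vanish and so would
    [rho]. *)
Lemma state_decomposition (R : realType) (n : nat)
  (rho : {linear L2 (@lebesgue R n) -> L2 (@lebesgue R n)})
  (rhohat : {linear L2 (@dual_lebesgue R n) -> L2 (@dual_lebesgue R n)})
  (tau := fine (optrace rho)) :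
  is_state rho -> (exists f, rho f <> 0) ->
  (forall f, rhohat (fourier f) = fourier (rho f)) ->
  psd_op rho /\ 0 < tau /\ 0 < opnorm rho /\ exists g : nat -> L2 (@lebesgue R n),
  [/\ forall u, (qform rho u)%:E = (\sum_(k <oo) (normc (dotL2 u (g k)) ^+ 2)%:E)%E,
      forall w, (qform rhohat w)%:E =
        (\sum_(k <oo) (normc (dotL2 w (fourier (g k))) ^+ 2)%:E)%E &
      (\sum_(k <oo) (normsq (g k))%:E = tau%:E)%E].
Proof.
move=> [bd pos tr] [f0 rho0] inter.
have psd : psd_op rho by split => // a u v; exact: linearP.
have tE : optrace rho = tau%:E.
  rewrite fineK// ge0_fin_numE//; apply: esum_ge0 => e _.
  exact: (qform_ge0 e psd).
have [g Pg] := chol_form_sum psd tE.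
have gt := optrace_form_sum Pg; rewrite tE in gt.
have tau0 : 0 < tau.
  have [_ le1] := nneseries_EFin_cvg (fun k => normsq_ge0 (g k)) (esym gt).
  have t0 : 0 <= tau by have := le1 0%N; rewrite big_ord0.
  rewrite lt_neqAle t0 andbT eq_sym; apply/eqP => tau00.
  have g0 k : g k = 0.
    apply: normsq_eq0; apply/eqP; rewrite eq_le normsq_ge0 andbT -tau00.
    by rewrite (le_trans _ (le1 k.+1))// big_ord_recr/= lerDr sumr_ge0// =>
        i _; exact: normsq_ge0.
  apply: rho0; apply: (psd_op_eq0 psd); apply/EFin_inj;
      rewrite Pg eseries0// => k _ _.
  by rewrite g0 dotL20r normc0 expr0n.
split => //; split => //; split; first exact: psd_op_opnorm_gt0 rho0.
exists g; split => // w; have [u <-] := fourier_surjective w.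
have -> : qform rhohat (fourier u) = qform rho u.
  by rewrite /qform inter fourier_dot.
by rewrite Pg; apply: eq_eseriesr => k _; rewrite fourier_dot.
Qed.

Unset Implicit Arguments.

(* The sum of the entropies is the dual addition of \bar R, for which
   -oo + +oo = +oo: if one entropy is -oo, the inequality says that the other
   one is +oo. *)
Theorem corollary1p7 (R : realType) (n : nat)
  (rho : {linear L2 (@lebesgue R n) -> L2 (@lebesgue R n)})
  (rhohat : {linear L2 (@dual_lebesgue R n) -> L2 (@dual_lebesgue R n)}) :
  is_state rho ->
  (exists f, rho f <> 0) ->
  (forall f, rhohat (fourier f) = fourier (rho f)) ->
  (entropy_pos (mu := lebesgue n) rho < +oo)%E \/
    (entropy_pos (mu := dual_lebesgue n) rhohat < +oo)%E ->
  [/\ (entropy_pos (mu := lebesgue n) rho < +oo)%E ->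
        (entropy_neg (mu := dual_lebesgue n) rhohat < +oo)%E,
      (entropy_pos (mu := dual_lebesgue n) rhohat < +oo)%E ->
        (entropy_neg (mu := lebesgue n) rho < +oo)%E &
      (entropy (mu := lebesgue n) rho
         + entropy (mu := dual_lebesgue n) rhohat
       >= (- (fine (optrace rho) * (ln (fine (optrace rho)) + ln (opnorm
           rho))))%:E)%dE].
Proof.
move=> st nz inter fin1.
have [psd [tau0 [kappa0 [g [Pg Phg gt]]]]] := state_decomposition st nz inter.
have n2 := entropy_neg_rhohat_lty psd Pg Phg gt tau0.
have n1 := entropy_neg_rho_lty psd Pg Phg gt tau0.
apply: (And3 n2 n1).
have ex := entropy_rhoE Pg gt; have exi := entropy_rhohatE Phg gt.
have top (x : \bar R) : (x + +oo = +oo)%dE /\ (+oo + x = +oo)%dE.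
  by case: x.
have infty (N : \bar R) : (N < +oo)%E -> (- (N - +oo) = +oo)%E by case: N.
(* If one positive part is infinite, the other is finite, and hence so is the negative part on the
   infinite side. That entropy is then [+oo], which dominates the dual sum even against [-oo]. *)
have [p1|] := ltP (entropy_pos (mu := lebesgue n) rho) +oo%E; last first.
  rewrite leye_eq => /eqP p1; case: fin1; first by rewrite p1 ltxx.
  by move=> /n1 h; rewrite ex p1 infty// (top _).2 leey.
have [p2|] := ltP (entropy_pos (mu := dual_lebesgue n) rhohat) +oo%E; last first.
  rewrite leye_eq => /eqP p2.
  by rewrite exi p2 (infty _ (n2 p1)) (top _).1 leey.
have [x [xi [-> -> h]]] := entropy_sum_finite psd Pg Phg gt tau0 kappa0 p1 p2.
by rewrite -[leRHS]/((x + xi)%:E) lee_fin.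
Qed.
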